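(* Let $c>0$ and consider in $\mathbb R^3$, with $\mathbf x=(x,y,z)$, the distributional solution $(\mathbf v,p)$, $\mathbf v=(v_x,v_y,v_z)$, of $$\partial_t\mathbf v+c\operatorname{grad}p=0,\qquad\partial_tp+c\operatorname{div}\mathbf v=0$$ with the Riemann initial data $p_0=0$, $\mathbf v_0(\mathbf x)=(0,0,\Theta(x)\Theta(z))$, where $\Theta(s)=0$ for $s<0$ and $\Theta(s)=1$ for $s\ge0$. Then for $t>0$ the $x$-component of the velocity, evaluated on the plane $x=0$, is $$v_x(t,\mathbf x)\big|_{x=0}=\frac1{2\pi}\int_{|z|}^{ct}\frac{dr}{\sqrt{r^2-z^2}}=\frac1{2\pi}\,\mathscr L\Big(\frac{|z|}{ct}\Big)\ \text{ for }0<|z|\le ct,\qquad v_x(t,\mathbf x)\big|_{x=0}=0\ \text{ for }|z|>ct,$$ where, for $0<s\le1$, $$\mathscr L(s)=\ln\frac{1+\sqrt{1-s^2}}{s},\qquad \mathscr L(s)=-\ln\frac s2-\frac{s^2}4+\mathcal O(s^4)\ (s\to0^+),\qquad e^{-\mathscr L(s)}=\tan\frac{\arcsin s}{2}.$$ Therefore the $x$-component of the velocity has a logarithmic singularity at the origin $x=z=0$, which is the corner of the initial discontinuity of the $z$-component.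
   Context: Distributional solution: $q=(\mathbf v,p)$ is a $C^1$ map from $[0,\infty)$ into $(D'(\mathbb R^3))^4$, the equations hold for every $t$ as identities in $D'(\mathbb R^3)$ (spatial derivatives being distributional), and $q(0)$ equals the initial data, regarded as regular distributions (i.e. given by integration against $L^1_{\mathrm{loc}}$ functions). For these data the solution formula is, for test functions $\psi$, $$\langle v_x(t,\cdot)|\psi\rangle=\frac1{4\pi}\int_0^{ct}dr\,\frac1r\,\partial_r\Big[\frac1r\,\partial_r\Big(r\int_{\mathbb R^3}d\mathbf x\,I(r,\mathbf x)\psi(\mathbf x)\Big)\Big],\qquad I(r,\mathbf x)=\int_{S^2_r}d\mathbf y\,\frac{y_xy_z}{r^2}\,\Theta(x-y_x)\Theta(z-y_z),$$ where $S^2_r$ is the sphere of radius $r$ about $0$ and $\mathbf y=(y_x,y_y,y_z)$. The values on the plane $x=0$ are those obtained by evaluating $I$ at $x=0$, i.e. $v_x(t,\mathbf x)=\frac1{4\pi}\int_0^{ct}dr\,\frac1r\partial_r[\frac1r\partial_r(r\,I(r,\mathbf x))]$ with $I(r,\mathbf x)|_{x=0}=\frac{2(r^2-z^2)^{3/2}}{3r}\Theta(r-|z|)$. *)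

(* Defs.v *)
From HB Require Import structures.
From mathcomp Require Export all_boot all_order all_algebra.
From mathcomp Require Export all_classical all_reals all_analysis.

Set Implicit Arguments.
Unset Strict Implicit.
Unset Printing Implicit Defensive.

Export Order.TTheory GRing.Theory Num.Theory.
Export numFieldNormedType.Exports.

Local Open Scope classical_set_scope.
Local Open Scope ring_scope.

Notation leb1 R := (@lebesgue_measure R).
Notation leb3 R := ((leb1 R \x leb1 R) \x leb1 R)%E.

(* A point (x, y, z) of R^3 is ((x, y), z); the indices 0, 1, 2 of 'I_3 stand
   for the coordinates x, y, z. *)
Definition basis3 (R : realType) (i : 'I_3) : R * R * R :=
  ((i == 0 :> nat)%:R, (i == 1 :> nat)%:R, (i == 2 :> nat)%:R).

Section TestFunctionsAndDistributions.
Context {R : realType}.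

Definition partial (i : 'I_3) (f : R * R * R -> R) : R * R * R -> R :=
  fun x => 'D_(basis3 R i) f x.

(* A multi-index is a word in the coordinates, of length the order. *)
Definition partials (s : seq 'I_3) (f : R * R * R -> R) : R * R * R -> R :=
  foldr partial f s.

Definition smooth (f : R * R * R -> R) : Prop :=
  forall s : seq 'I_3, continuous (partials s f) /\
    forall (i : 'I_3) x, derivable (partials s f) x (basis3 R i).

Definition supported_in (K : set (R * R * R)) (f : R * R * R -> R) : Prop :=
  forall x, ~ K x -> f x = 0.

Definition is_test (psi : R * R * R -> R) : Prop :=
  smooth psi /\ exists2 K, compact K & supported_in K psi.

(* Functionals are total on R^3 -> R, but only their values on test functions
   are ever used: equality in D'(R^3) is equality on test functions. *)
Definition functional : Type := (R * R * R -> R) -> R.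

Definition linear_on_test (T : functional) : Prop :=
  forall (a : R) phi psi, is_test phi -> is_test psi ->
    T (fun x => a * phi x + psi x) = a * T phi + T psi.

(* Continuity on D(R^3): on every compact set, T is bounded by finitely many of
   the seminorms sup |d^s psi|. *)
Definition continuous_on_test (T : functional) : Prop :=
  forall K : set (R * R * R), compact K -> exists (C : R) (N : nat),
    forall psi, is_test psi -> supported_in K psi ->
    forall M : R,
      (forall s : seq 'I_3, (size s <= N)%N ->
         forall x, `|partials s psi x| <= M) ->
      `|T psi| <= C * M.

Definition is_distribution (T : functional) : Prop :=
  linear_on_test T /\ continuous_on_test T.

Definition regular_distr (f : R * R * R -> R) : functional :=
  fun psi => \int[leb3 R]_x (f x * psi x).

Definition distr_partial (i : 'I_3) (T : functional) : functional :=
  fun psi => - T (partial i psi).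

(* u is a C^1 map from [0, +oo[ to D'(R^3), with the topology of pointwise
   convergence on test functions, and u' is its derivative (one-sided at 0). *)
Definition C1_curve (u u' : R -> functional) : Prop :=
  (forall t, 0 <= t -> is_distribution (u t) /\ is_distribution (u' t)) /\
  forall psi, is_test psi ->
    (forall t, 0 <= t ->
      (fun s => (s - t)^-1 * (u s psi - u t psi))
        @ within [set s | 0 <= s] t^' --> u' t psi) /\
    {within `[0, +oo[, continuous (fun t => u' t psi)}.

(* Distributional solutions of  d_t v + c grad p = 0,  d_t p + c div v = 0
   with initial data v0, p0. *)
Definition distr_solution (c : R) (v0 : 'I_3 -> R * R * R -> R)
    (p0 : R * R * R -> R) (v : 'I_3 -> R -> functional) (p : R -> functional) :
    Prop :=
  exists (v' : 'I_3 -> R -> functional) (p' : R -> functional),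
    [/\ (forall i, C1_curve (v i) (v' i)) /\ C1_curve p p',
        forall t, 0 <= t -> forall psi, is_test psi -> forall i,
          v' i t psi + c * distr_partial i (p t) psi = 0,
        forall t, 0 <= t -> forall psi, is_test psi ->
          p' t psi + c * \sum_(i < 3) distr_partial i (v i t) psi = 0,
        forall psi, is_test psi -> forall i,
          v i 0 psi = regular_distr (v0 i) psi
      & forall psi, is_test psi -> p 0 psi = regular_distr p0 psi].

End TestFunctionsAndDistributions.

Section RiemannProblem.
Context {R : realType}.

Definition Theta (s : R) : R := if 0 <= s then 1 else 0.

Definition riemann_p0 : R * R * R -> R := cst 0.

Definition riemann_v0 (i : 'I_3) (X : R * R * R) : R :=
  let: (x, y, z) := X in
  if i == 2 :> nat then Theta x * Theta z else 0.

(* Surface integral over the sphere of radius r about 0, in spherical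
   coordinates with polar angle a (from the z-axis) and azimuth b. *)
Definition sphere_int (r : R) (f : R * R * R -> R) : R :=
  \int[leb1 R]_(a in `[0, pi]) \int[leb1 R]_(b in `[0, pi *+ 2])
    (f (r * (sin a * cos b), r * (sin a * sin b), r * cos a)
       * (r ^+ 2 * sin a)).

Definition I_sph (r : R) (X : R * R * R) : R :=
  let: (x, y, z) := X in
  sphere_int r (fun Y => let: (yx, yy, yz) := Y in
    yx * yz / r ^+ 2 * Theta (x - yx) * Theta (z - yz)).

(* F |-> 1/(4 pi) \int_0^T dr (1/r) d_r [(1/r) d_r (r F(r))] *)
Definition radial_op (T : R) (F : R -> R) : R :=
  (4 * pi)^-1 * \int[leb1 R]_(r in `[0, T])
    (r^-1 * derive1 (fun s => s^-1 * derive1 (fun q => q * F q) s) r).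

Definition vx_formula (c t : R) : functional :=
  fun psi => radial_op (c * t)
    (fun r => \int[leb3 R]_X (I_sph r X * psi X)).

(* Pointwise values of v_x, obtained by evaluating I at the point X. *)
Definition vx_at (c t : R) (X : R * R * R) : R :=
  radial_op (c * t) (fun r => I_sph r X).

Definition Lfun (s : R) : R := ln ((1 + Num.sqrt (1 - s ^+ 2)) / s).

(* f(s) = k ln|s - a| + O(1) as s -> a, with k != 0 *)
Definition log_singularity (f : R -> R) (a : R) : Prop :=
  exists2 k : R, k != 0 &
    (fun s => f s - k * ln `|s - a|) =O_ (a^') (cst 1 : R -> R).

End RiemannProblem.

(* Main.v *)
(* For fixed x, Kirchhoff's formula for p is obtained by testing along the
   backward characteristics r = c (t - s): pairing the unknowns with the
   translates psi(. + r omega) and averaging over omega in S^2, the average of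
     r d_t p + c p + c r omega . grad p
   does not depend on s, because the defect is the integral over S^2 of the
   divergence of a tangential field.  Evaluating at s = 0 and s = t expresses
   p(t), and then v_x(t) = - c \int_0^t d_x p, by spherical averages of
   G(h) = <v_z(0), psi(. + h)>.  Differentiating such pairings in time requires
   the uniform boundedness principle on D(R^3), proved with a gliding hump.
   On the other side \int I(r, .) psi is r^2 times the average of
   omega_x omega_z G(r omega), and each operator (1/r) d_r replaces a factor
   omega_i by a derivative d_i G, again by the tangential divergence identity;
   so the solution formula equals the expression found for v_x.
   On the plane x = 0 the integral over the azimuth gives -2, the polar
   integral gives r I = (2/3) (r^2 - z^2)^(3/2), and the radial operator yields
   2 / sqrt(r^2 - z^2), whose primitive is ln(r + sqrt(r^2 - z^2)). *)

From HB Require Import structures.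
Require Import Defs.
From mathcomp Require Import ring lra measurable_realfun.

Local Open Scope classical_set_scope.
Local Open Scope ring_scope.

(** * Calculus in three variables *)

Section LineDerivatives.
Context {R : realType}.
Local Notation V := (R * R * R)%type.
Implicit Types (f g psi : V -> R) (X Y d : V) (i j : 'I_3) (s : seq 'I_3).

Definition tr (h : V) (f : V -> R) : V -> R := fun X => f (X + h).

Definition coord (X : V) (i : 'I_3) : R :=
  if i == 0 :> nat then X.1.1 else if i == 1 :> nat then X.1.2 else X.2.

Definition norm1 (d : V) : R := \sum_(i < 3) `|coord d i|.

Lemma is_derive_line f X v (x : R) : derivable f (X + x *: v) v ->
  is_derive x 1 (fun t : R => f (X + t *: v)) ('D_v f (X + x *: v)).
Proof.
have E : (fun h : R => h^-1 *: (((fun t : R => f (X + t *: v)) \o shift x) (h *: (1 : R))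
    - f (X + x *: v))) =
   (fun h : R => h^-1 *: ((f \o shift (X + x *: v)) (h *: v) - f (X + x *: v))).
  by apply/funext => h /=; rewrite scaler1 scalerDl addrCA.
by move=> df; split; rewrite /derivable /derive E.
Qed.

Lemma is_derive_continuous (f : R -> R) (x a : R) :
  is_derive x (1 : R) f a -> {for x, continuous f}.
Proof.
by move=> H; apply/differentiable_continuous/derivable1_diffP; exact: ex_derive.
Qed.

Lemma is_deriveMf (f g : R -> R) (x df dg : R) :
  is_derive x (1 : R) f df -> is_derive x (1 : R) g dg ->
  is_derive x (1 : R) (fun t => f t * g t) (df * g x + f x * dg).
Proof.
move=> Hf Hg; have := is_deriveM Hf Hg => /is_derive_eq; apply.
by rewrite addrC mulrC.
Qed.

Lemma lipschitz_derive (f df : R -> R) (M x y : R) :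
  (forall z, is_derive z (1 : R) f (df z)) ->
  (forall z, `|z - x| <= `|y - x| -> `|df z| <= M) ->
  `|f y - f x| <= M * `|y - x|.
Proof.
move=> Hd HM.
have cf (a b : R) : {within `[a, b], continuous f}.
  by apply: continuous_subspaceT => z; exact: is_derive_continuous (Hd z).
have [xy|yx] := leP x y.
  have [c + ->] := MVT_segment xy (fun x _ => Hd x) (cf _ _).
  rewrite in_itv /= => /andP[xc cy]; rewrite normrM ler_wpM2r// HM//.
  by rewrite !ger0_norm ?subr_ge0// lerB.
have [c + E] := MVT_segment (ltW yx) (fun x _ => Hd x) (cf _ _).
rewrite in_itv /= => /andP[xc cy].
rewrite distrC E (distrC y) normrM ler_wpM2r// HM//.
by rewrite distrC (distrC y) !ger0_norm ?subr_ge0 ?(ltW yx)// lerB.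
Qed.

Lemma derivable_partials f s i X : smooth f ->
  derivable (partials s f) X (basis3 R i).
Proof. by move=> /(_ s)[_]; apply. Qed.

Lemma is_derive_partials f s i X (x : R) : smooth f ->
  is_derive x 1 (fun t : R => partials s f (X + t *: basis3 R i))
    (partials (i :: s) f (X + x *: basis3 R i)).
Proof. by move=> sf; apply: is_derive_line; exact: derivable_partials. Qed.

Lemma step1 f s i X (x M : R) : smooth f ->
  (forall Y, `|partials (i :: s) f Y| <= M) ->
  `|partials s f (X + x *: basis3 R i) - partials s f X| <= M * `|x|.
Proof.
move=> sf HM.
have := @lipschitz_derive _ _ M 0 x
  (fun z => is_derive_partials f s i X z sf) (fun z _ => HM _).
by rewrite scale0r addr0 subr0.
Qed.

Lemma step2 f s i X (x M : R) : smooth f ->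
  (forall Y, `|partials (i :: i :: s) f Y| <= M) ->
  `|partials s f (X + x *: basis3 R i) - partials s f X
     - x * partials (i :: s) f X| <= M * `|x| * `|x|.
Proof.
move=> sf HM.
pose g (t : R) := partials s f (X + t *: basis3 R i) - t * partials (i :: s) f X.
pose dg (t : R) := partials (i :: s) f (X + t *: basis3 R i) - partials (i :: s) f X.
have Hg z : is_derive z (1 : R) g (dg z).
  have H := is_derive_partials f s i X z sf.
  by rewrite /g /dg; apply: is_derive_eq; rewrite scaler0 add0r scaler1.
have := @lipschitz_derive g dg (M * `|x|) 0 x Hg.
rewrite /g scale0r addr0 subr0 mul0r subr0 [_ - _ - _ in X in _ -> X]addrAC.
apply => z; rewrite subr0 => zx.
apply: (le_trans (step1 _ _ _ _ _ _ sf HM)).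
by rewrite ler_wpM2l// (le_trans (normr_ge0 _) (HM X)).
Qed.

Definition c0 : 'I_3 := @Ordinal 3 0 isT.
Definition c1 : 'I_3 := @Ordinal 3 1 isT.
Definition c2 : 'I_3 := @Ordinal 3 2 isT.

Lemma sum3 (F : 'I_3 -> R) : \sum_(i < 3) F i = F c0 + F c1 + F c2.
Proof.
rewrite !big_ord_recr big_ord0 /= add0r; congr (F _ + F _ + F _); exact/val_inj.
Qed.

Lemma ord3P (P : 'I_3 -> Prop) : P c0 -> P c1 -> P c2 -> forall i, P i.
Proof.
move=> P0 P1 P2 [[|[|[|//]]] H]; [move: P0|move: P1|move: P2];
  by congr P; exact/val_inj.
Qed.

Lemma decomp3 d : d = coord d c0 *: basis3 R c0 + coord d c1 *: basis3 R c1
   + coord d c2 *: basis3 R c2.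
Proof.
case: d => [[x y] z]; rewrite /basis3 /coord /=.
by apply/pair_equal_spec; split; [apply/pair_equal_spec; split|];
  rewrite /= /GRing.scale /=; ring.
Qed.

Lemma norm1_ge0 d : 0 <= norm1 d.
Proof. exact: sumr_ge0. Qed.

Lemma taylor1 f s X d (M : R) : smooth f ->
  (forall i Y, `|partials (i :: s) f Y| <= M) ->
  `|partials s f (X + d) - partials s f X| <= M * norm1 d.
Proof.
move=> sf HM; rewrite {1}[d]decomp3 /norm1 sum3 !addrA.
set X1 := X + _; set X2 := X1 + _; set X3 := X2 + _.
rewrite [leLHS](_ : _ = `|(partials s f X1 - partials s f X) +
  (partials s f X2 - partials s f X1) + (partials s f X3 - partials s f X2)|);
  last by congr (`|_|); ring.
rewrite !mulrDr; apply: (le_trans (ler_normD _ _)).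
apply: lerD; last exact: step1.
by apply: (le_trans (ler_normD _ _)); apply: lerD; exact: step1.
Qed.

Lemma taylor2 f s X d (M : R) : smooth f ->
  (forall i j Y, `|partials (i :: j :: s) f Y| <= M) ->
  `|partials s f (X + d) - partials s f X
    - \sum_(i < 3) coord d i * partials (i :: s) f X| <= 3 * M * norm1 d ^+ 2.
Proof.
move=> sf HM; rewrite {1}[d]decomp3 sum3 !addrA.
have M0 : 0 <= M by apply: le_trans (HM c0 c0 X).
set X1 := X + _; set X2 := X1 + _; set X3 := X2 + _.
rewrite [leLHS](_ : _ = `|
  (partials s f X1 - partials s f X - coord d c0 * partials (c0 :: s) f X) +
  (partials s f X2 - partials s f X1 - coord d c1 * partials (c1 :: s) f X1) +
  (partials s f X3 - partials s f X2 - coord d c2 * partials (c2 :: s) f X2) +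
  coord d c1 * (partials (c1 :: s) f X1 - partials (c1 :: s) f X) +
  coord d c2 * ((partials (c2 :: s) f X2 - partials (c2 :: s) f X1) +
    (partials (c2 :: s) f X1 - partials (c2 :: s) f X))|); last first.
  congr (`|_|).
  move: (partials s f X) (partials s f X1) (partials s f X2) (partials s f X3).
  move: (partials (c0 :: s) f X) (partials (c1 :: s) f X) (partials (c2 :: s) f X).
  move: (partials (c1 :: s) f X1) (partials (c2 :: s) f X1) (partials (c2 :: s) f X2).
  by move: (coord d c0) (coord d c1) (coord d c2) => *; ring.
have e1 := step2 f s c0 X (coord d c0) M sf (HM _ _).
have e2 := step2 f s c1 X1 (coord d c1) M sf (HM _ _).
have e3 := step2 f s c2 X2 (coord d c2) M sf (HM _ _).
have e4 := step1 f (c1 :: s) c0 X (coord d c0) M sf (HM _ _).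
have e5 := step1 f (c2 :: s) c1 X1 (coord d c1) M sf (HM _ _).
have e6 := step1 f (c2 :: s) c0 X (coord d c0) M sf (HM _ _).
rewrite -/X1 in e1 e4 e6; rewrite -/X2 in e2 e5; rewrite -/X3 in e3.
have n0 := normr_ge0 (coord d c0); have n1 := normr_ge0 (coord d c1).
have n2 := normr_ge0 (coord d c2).
apply: (@le_trans _ _ (M * `|coord d c0| * `|coord d c0| + M * `|coord d c1| * `|coord d c1|
  + M * `|coord d c2| * `|coord d c2| + `|coord d c1| * (M * `|coord d c0|)
  + `|coord d c2| * (M * `|coord d c1| + M * `|coord d c0|))).
  apply: (le_trans (ler_normD _ _)); apply: lerD; last first.
    rewrite normrM ler_wpM2l// (le_trans (ler_normD _ _))//; exact: lerD.
  apply: (le_trans (ler_normD _ _)); apply: lerD; last by rewrite normrM ler_wpM2l.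
  apply: (le_trans (ler_normD _ _)); apply: lerD => //.
  by apply: (le_trans (ler_normD _ _)); apply: lerD.
rewrite /norm1 sum3; move: n0 n1 n2.
move: `|coord d c0| `|coord d c1| `|coord d c2| => x y z x0 y0 z0.
rewrite -subr_ge0 [leRHS](_ : _ = M * (2 * (x * x + y * y + z * z) + 5 * (x * y)
  + 5 * (x * z) + 5 * (y * z))); last ring.
by rewrite mulr_ge0// !addr_ge0// ?mulr_ge0// ?addr_ge0// mulr_ge0.
Qed.

End LineDerivatives.

(** * Smooth functions and test functions *)

Section TestFunctions.
Context {R : realType}.
Local Notation V := (R * R * R)%type.
Implicit Types (f g psi : V -> R) (X Y d h : V) (i j : 'I_3) (s : seq 'I_3).

Lemma partial_tr i h f : partial i (tr h f) = tr h (partial i f).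
Proof.
apply/funext => X; rewrite /partial /tr /derive.
congr (lim (_ @ 0^')); apply/funext => k /=; by rewrite addrA.
Qed.

Lemma partials_tr s h f : partials s (tr h f) = tr h (partials s f).
Proof. by elim: s => //= i s ->; rewrite partial_tr. Qed.

Lemma derivable_tr h f X v : derivable f (X + h) v -> derivable (tr h f) X v.
Proof.
rewrite /derivable /tr.
set a := (fun k : R => _); set b := (fun k : R => _).
suff -> : b = a by [].
by apply/funext => k; rewrite /a /b /= addrA.
Qed.

Lemma smooth_tr h f : smooth f -> smooth (tr h f).
Proof.
move=> sf s; rewrite partials_tr; split; last first.
  by move=> i X; apply: derivable_tr; exact: derivable_partials.
move=> X; apply: (@continuous_comp _ _ _ (fun Y : V => Y + h)).
  by apply: continuousD; [exact: cvg_id|exact: cvg_cst].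
exact: (sf s).1.
Qed.

Lemma partials_lin s (a : R) f g : smooth f -> smooth g ->
  partials s (fun X => a * f X + g X) =
  (fun X => a * partials s f X + partials s g X).
Proof.
move=> sf sg; elim: s => //= i s ->; apply/funext => X; rewrite /partial.
have Df := derivable_partials f s i X sf; have Dg := derivable_partials g s i X sg.
rewrite [LHS](@deriveD _ _ _ (fun X => a * partials s f X) (partials s g)) //.
  by congr (_ + _); exact: (deriveZ a Df).
exact: (@derivableZ _ _ _ _ a _ _ Df).
Qed.

Lemma smooth_lin (a : R) f g : smooth f -> smooth g ->
  smooth (fun X => a * f X + g X).
Proof.
move=> sf sg s; rewrite partials_lin//; split.
  move=> X; apply: cvgD; last exact: (sg s).1.
  by apply: cvgM; [exact: cvg_cst|exact: (sf s).1].
move=> i X; apply: (@derivableD _ _ _ (fun X => a * partials s f X) (partials s g)).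
  exact: (@derivableZ _ _ _ _ a _ _ (derivable_partials f s i X sf)).
exact: derivable_partials.
Qed.

Lemma smooth_partials s f : smooth f -> smooth (partials s f).
Proof.
move=> sf t; have -> : partials t (partials s f) = partials (t ++ s) f.
  by rewrite /partials foldr_cat.
exact: sf.
Qed.

Lemma smooth0 : smooth (fun _ : V => 0 : R).
Proof.
have E s : partials s (fun _ : V => 0 : R) = (fun _ => 0).
  elim: s => //= i s ->; apply/funext => X; exact: derive_cst.
by move=> s; rewrite E; split=> [X|i X]; [exact: cvg_cst|exact: derivable_cst].
Qed.

Lemma partials0 s : partials s (fun _ : V => 0 : R) = (fun _ => 0).
Proof. elim: s => //= i s ->; apply/funext => X; exact: derive_cst. Qed.

Definition box (m : R) : set V := [set X | `|X| <= m].

Lemma compact_box (m : R) : compact (box m).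
Proof.
have -> : box m = ((`[-m, m] `*` `[-m, m]) `*` `[-m, m])%classic.
  apply/seteqP; split => [[[x y] z]|[[x y] z]] /=; rewrite /box /= !in_itv /=.
    by rewrite !prod_normE /= !ge_max => /andP[/andP[]]; rewrite !ler_norml.
  by move=> [[]]; rewrite !prod_normE /= !ge_max -!ler_norml => -> -> ->.
apply: compact_setX; [apply: compact_setX|]; exact: segment_compact.
Qed.

Lemma supported_in_partials (K : set V) s f : compact K -> supported_in K f ->
  supported_in K (partials s f).
Proof.
move=> cK sK; elim: s => //= i s IH X nKX.
have oK : open (~` K) by apply: closed_openC; apply: compact_closed => //; exact: norm_hausdorff.
rewrite /partial (@near_eq_derive _ _ _ _ (cst 0)) ?derive_cst//.
by near=> Y; apply: IH; near: Y; exact: open_nbhs_nbhs.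
Unshelve. all: by end_near. Qed.

Lemma is_test_partials s f : is_test f -> is_test (partials s f).
Proof.
move=> [sf [K cK sK]]; split; first exact: smooth_partials.
by exists K => //; exact: supported_in_partials.
Qed.

Lemma is_test_box f : is_test f -> exists2 m : R, 0 <= m & supported_in (box m) f.
Proof.
move=> [sf [K cK sK]].
have [M [Mr HM]] := compact_bounded cK.
exists (`|M| + 1); first by rewrite addr_ge0.
move=> X nX; apply: sK => KX; apply: nX; apply: (HM (`|M| + 1)) => //.
by rewrite ltr_pwDr// ler_norm.
Qed.

Lemma box_is_test (m : R) f : smooth f -> supported_in (box m) f -> is_test f.
Proof. by move=> sf sK; split=> //; exists (box m) => //; exact: compact_box. Qed.

Lemma supported_in_tr (m r : R) h f : supported_in (box m) f -> `|h| <= r ->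
  supported_in (box (m + r)) (tr h f).
Proof.
move=> sK hr X nX; rewrite /tr; apply: sK => /= Xh; apply: nX; rewrite /box /=.
by rewrite -[X](addrK h) (le_trans (ler_normB _ _))// lerD.
Qed.

Lemma supported_in_box_le (m r : R) f : m <= r -> supported_in (box m) f ->
  supported_in (box r) f.
Proof. by move=> mr sK X nX; apply: sK => Xm; apply: nX; exact: le_trans mr. Qed.

Lemma is_test_tr h f : is_test f -> is_test (tr h f).
Proof.
move=> tf; have [m m0 sK] := is_test_box f tf.
apply: (@box_is_test (m + `|h|)); first by apply: smooth_tr; case: tf.
exact: supported_in_tr.
Qed.

Lemma is_test_lin (a : R) f g : is_test f -> is_test g ->
  is_test (fun X => a * f X + g X).
Proof.
move=> tf tg; have [m m0 sm] := is_test_box f tf.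
have [n n0 sn] := is_test_box g tg.
apply: (@box_is_test (m + n)); first by apply: smooth_lin; [case: tf|case: tg].
move=> X nX; rewrite (supported_in_box_le _ _ _ _ sm X nX) ?lerDl//.
by rewrite (supported_in_box_le _ _ _ _ sn X nX) ?lerDr// mulr0 addr0.
Qed.

Lemma is_test0 : is_test (fun _ : V => 0 : R).
Proof. by apply: (@box_is_test 0); [exact: smooth0|move=> X _]. Qed.

Lemma test_bounded f : is_test f -> exists2 M : R, 0 <= M & forall X, `|f X| <= M.
Proof.
move=> [sf [K cK sK]].
have cf : {within K, continuous f} by apply: continuous_subspaceT; exact: (sf [::]).1.
have [M [Mr HM]] := compact_bounded (continuous_compact cf cK).
exists (`|M| + 1); first by rewrite addr_ge0.
move=> X; have [KX|nKX] := pselect (K X).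
  apply: (HM (`|M| + 1)); first by rewrite ltr_pwDr// ler_norm.
  by exists X.
by rewrite sK// normr0 addr_ge0.
Qed.

Lemma test_bounded_partials N f : is_test f ->
  exists2 M : R, 0 <= M & forall s, (size s <= N)%N -> forall X, `|partials s f X| <= M.
Proof.
elim: N f => [|N IH] f tf.
  by have [M M0 HM] := test_bounded f tf; exists M => // -[|//].
have [M M0 HM] := test_bounded f tf.
have [A A0 HA] := IH _ (is_test_partials [:: c0] f tf).
have [B B0 HB] := IH _ (is_test_partials [:: c1] f tf).
have [C C0 HC] := IH _ (is_test_partials [:: c2] f tf).
exists (M + A + B + C); first by rewrite !addr_ge0.
move=> s; case: (lastP s) => [_ X|{}s i].
  by apply: le_trans (HM X) _; rewrite -!addrA lerDl !addr_ge0.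
rewrite size_rcons ltnS => /[dup] /HA a /[dup] /HB b /HC c X.
have E : partials (rcons s i) f = partials s (partial i f).
  by rewrite /partials foldr_rcons.
rewrite E; move: i {E}; apply: ord3P.
- by apply: (le_trans (a X)); lra.
- by apply: (le_trans (b X)); lra.
- by apply: (le_trans (c X)); lra.
Qed.

End TestFunctions.

Section SmoothLimits.
Context {R : realType}.
Local Notation V := (R * R * R)%type.
Implicit Types (f g psi : V -> R) (X Y d h : V) (i j : 'I_3) (s : seq 'I_3).

Lemma partial_comm_aux f i j X (M h : R) : smooth f ->
  (forall a b c Y, `|partials [:: a; b; c] f Y| <= M) ->
  `|f (X + h *: basis3 R i + h *: basis3 R j) - f (X + h *: basis3 R i)
    - f (X + h *: basis3 R j) + f X - h ^+ 2 * partials [:: j; i] f X|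
  <= 2 * M * `|h| ^+ 3.
Proof.
move=> sf HM; set ei := basis3 R i; set ej := basis3 R j.
have M0 : 0 <= M by apply: le_trans (HM c0 c0 c0 X).
pose phi (t : R) := f (X + h *: ej + t *: ei) - f (X + t *: ei)
  - t * (h * partials [:: j; i] f X).
pose dphi (t : R) := partials [:: i] f (X + h *: ej + t *: ei)
  - partials [:: i] f (X + t *: ei) - h * partials [:: j; i] f X.
have Hd z : is_derive z (1 : R) phi (dphi z).
  have H1 := is_derive_partials f [::] i (X + h *: ej) z sf.
  have H2 := is_derive_partials f [::] i X z sf.
  by rewrite /phi /dphi; apply: is_derive_eq; rewrite scaler0 add0r scaler1.
have := @lipschitz_derive _ phi dphi (2 * M * `|h| ^+ 2) 0 h Hd.
rewrite subr0 => H.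
rewrite [leLHS](_ : _ = `|phi h - phi 0|); last first.
  congr (`|_|); rewrite /phi !scale0r !addr0 [X + h *: ej + _]addrAC.
  by move: (f _) (f _) (f _) (f _) => *; ring.
apply: (le_trans (H _)) => [z zh|]; last by rewrite -mulrA -exprSr.
rewrite /dphi [X + h *: ej + _]addrAC.
set Y := X + z *: ei.
have e1 := step2 f [:: i] j Y h M sf (HM _ _ _).
have e2 : `|partials [:: j; i] f Y - partials [:: j; i] f X| <= M * `|z|.
  by apply: step1.
rewrite subr0 in zh.
rewrite (_ : _ - _ - _ = (partials [:: i] f (Y + h *: ej) - partials [:: i] f Y
  - h * partials [:: j; i] f Y) + h * (partials [:: j; i] f Y - partials [:: j; i] f X)); last first.
  by move: (partials _ _ _) (partials _ _ _) (partials _ _ _) (partials _ _ _) => *; ring.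
apply: (le_trans (ler_normD _ _)); rewrite normrM.
apply: (@le_trans _ _ (M * `|h| * `|h| + `|h| * (M * `|h|))).
  by apply: lerD => //; rewrite ler_wpM2l// (le_trans e2)// ler_wpM2l.
by rewrite le_eqVlt; apply/orP; left; apply/eqP; ring.
Qed.

Lemma partial_comm f i j : is_test f ->
  partial i (partial j f) = partial j (partial i f).
Proof.
move=> tf; have sf := tf.1; apply/funext => X.
have [M M0 HM] := test_bounded_partials 3 f tf.
have H3 a b c Y : `|partials [:: a; b; c] f Y| <= M by apply: HM.
apply/eqP; rewrite -subr_eq0 -normr_le0; apply/ler_addgt0Pl => e e0; rewrite addr0.
pose k := e / (4 * (M + 1)).
have k0 : 0 < k by rewrite divr_gt0// mulr_gt0// ltr_wpDl.
have A := partial_comm_aux f i j X M k sf H3.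
have B := partial_comm_aux f j i X M k sf H3.
rewrite [X + _ + _]addrAC in B.
rewrite -(ler_pM2l (exprn_gt0 2 k0)) -[X in X * `|_|]ger0_norm ?exprn_ge0 ?(ltW k0)//.
rewrite -normrM [leLHS](_ : _ = `|(f (X + k *: basis3 R i + k *: basis3 R j) - f (X + k *: basis3 R i)
    - f (X + k *: basis3 R j) + f X - k ^+ 2 * partials [:: j; i] f X) -
   (f (X + k *: basis3 R i + k *: basis3 R j) - f (X + k *: basis3 R j)
    - f (X + k *: basis3 R i) + f X - k ^+ 2 * partials [:: i; j] f X)|); last first.
  rewrite /=; congr (`|_|).
  by move: (f _) (f _) (f _) (f _) (partial _ _ _) (partial _ _ _) => *; ring.
apply: (le_trans (ler_normB _ _)); apply: (le_trans (lerD A B)).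
rewrite (ger0_norm (ltW k0)) [leLHS](_ : _ = k ^+ 2 * (4 * M * k)); last by ring.
rewrite ler_pM2l ?exprn_gt0// /k mulrA ler_pdivrMr ?mulr_gt0// ?ltr_wpDl//.
by rewrite -subr_ge0 [leRHS](_ : _ = 4 * e); [rewrite mulr_ge0// ltW|ring].
Qed.

Lemma cvg_le_tail (a e : R ^nat) (n0 : nat) :
  (forall n m, (n0 <= n)%N -> (n <= m)%N -> `|a m - a n| <= e n) ->
  e @ \oo --> 0 ->
  cvg (a @ \oo) /\ forall n, (n0 <= n)%N -> `|lim (a @ \oo) - a n| <= e n.
Proof.
move=> H e0.
have ca : cvg (a @ \oo).
  apply/cauchy_cvgP/cauchy_exP => eps eps0.
  have /cvgrPdist_lt/(_ _ eps0) [N _ HN] := e0.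
  exists (a (maxn n0 N)); exists (maxn n0 N) => //= m Nm.
  rewrite /ball /= distrC; apply: le_lt_trans (H _ _ (leq_maxl _ _) Nm) _.
  have := HN (maxn n0 N) (leq_maxr _ _); rewrite sub0r normrN.
  exact/le_lt_trans/ler_norm.
split=> // n n0n.
have cn : `|a m - a n| @[m --> \oo] --> `|lim (a @ \oo) - a n|.
  by apply: cvg_norm; apply: cvgB => //; exact: cvg_cst.
rewrite -(cvg_lim _ cn)//; apply: limr_le; first by apply/cvg_ex; eexists; exact: cn.
by near=> m; apply: H => //; near: m; exact: nbhs_infty_ge.
Unshelve. all: by end_near. Qed.

Lemma derive_of_quadratic (f : V -> R) X v (a M : R) :
  (forall x : R, `|f (X + x *: v) - f X - x * a| <= M * `|x| * `|x|) ->
  is_derive X v f a.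
Proof.
move=> H.
have L : (fun h : R => h^-1 *: ((f \o shift X) (h *: v) - f X)) @ 0^' --> a.
  apply/cvgrPdist_le => e e0.
  near=> h.
  have h0 : h != 0 by near: h; exact: nbhs_dnbhs_neq.
  rewrite /= [h *: v + X]addrC distrC.
  have h0' : 0 < `|h| by rewrite normr_gt0.
  rewrite -(ler_pM2l h0') -normrM mulrBr -[h * (_ *: _)]/(h * (h^-1 * _)) mulrA mulfV// mul1r.
  apply: (le_trans (H h)); rewrite mulrC ler_pM2l//.
  rewrite mulrC; apply: (@le_trans _ _ (`|h| * (`|M| + 1))).
    by rewrite ler_wpM2l// (le_trans (ler_norm _))// lerDl.
  rewrite -ler_pdivlMr ?ltr_wpDl//; near: h; apply: dnbhs0_le.
  by rewrite divr_gt0// ltr_wpDl.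
split; first by apply/cvg_ex; exists a.
exact: cvg_lim.
Unshelve. all: by end_near. Qed.
Lemma norm1_le d : norm1 d <= 3 * `|d|.
Proof.
rewrite /norm1 sum3; case: d => [[x y] z]; rewrite /coord /=.
have [a b c] : [/\ `|x| <= `|(x, y, z)|, `|y| <= `|(x, y, z)| & `|z| <= `|(x, y, z)|].
  by rewrite !prod_normE /= !le_max !lexx !orbT.
by lra.
Qed.

Lemma lipschitz_continuous f (M : R) :
  (forall X d, `|f (X + d) - f X| <= M * norm1 d) -> continuous f.
Proof.
move=> H X; apply/cvgrPdist_le => e e0; near=> Y.
rewrite distrC -{1}[Y](subrKC X) (le_trans (H _ _))//.
apply: (@le_trans _ _ ((`|M| + 1) * (3 * `|Y - X|))).
  apply: (@le_trans _ _ ((`|M| + 1) * norm1 (Y - X))).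
    by rewrite ler_wpM2r ?norm1_ge0// (le_trans (ler_norm _))// lerDl.
  by rewrite ler_wpM2l ?addr_ge0// norm1_le.
rewrite mulrA -ler_pdivlMl ?mulr_gt0 ?ltr_wpDl//.
rewrite distrC; near: Y; apply: cvgr_dist_le => //.
by rewrite mulr_gt0// invr_gt0 mulr_gt0// ltr_wpDl.
Unshelve. all: by end_near. Qed.

Lemma smooth_limit (S : nat -> V -> R) :
  (forall n, smooth (S n)) ->
  (forall s, exists M : R, forall n X, `|partials s (S n) X| <= M) ->
  (forall s X, cvg (partials s (S n) X @[n --> \oo])) ->
  let F := fun X => lim (S n X @[n --> \oo]) in
  smooth F /\ forall s X, partials s F X = lim (partials s (S n) X @[n --> \oo]).
Proof.
move=> sS bS cS F.
pose G s X := lim (partials s (S n) X @[n --> \oo]).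
have GE s X : partials s (S n) X @[n --> \oo] --> G s X by exact: cS.
have Glip s : exists M : R, forall X d, `|G s (X + d) - G s X| <= M * norm1 d.
  have [A HA] := bS (c0 :: s); have [B HB] := bS (c1 :: s).
  have [C HC] := bS (c2 :: s); pose M := Num.max A (Num.max B C).
  exists M => X d.
  have cn : `|partials s (S n) (X + d) - partials s (S n) X| @[n --> \oo]
    --> `|G s (X + d) - G s X| by apply: cvg_norm; apply: cvgB; exact: GE.
  rewrite -(cvg_lim _ cn)//; apply: limr_le; first by apply/cvg_ex; eexists; exact: cn.
  near=> n; apply: taylor1 => //.
  have [MA MB MC] : [/\ A <= M, B <= M & C <= M].
    by rewrite /M !le_max !lexx !orbT.
  apply: ord3P => Y.
  - by apply: le_trans MA; exact: HA.
  - by apply: le_trans MB; exact: HB.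
  - by apply: le_trans MC; exact: HC.
have Gcont s : continuous (G s).
  by have [M HM] := Glip s; exact: lipschitz_continuous HM.
have Gder s i X : is_derive X (basis3 R i) (G s) (G (i :: s) X).
  have [M HM] := bS (i :: i :: s).
  have Hq (x : R) : `|G s (X + x *: basis3 R i) - G s X - x * G (i :: s) X| <= M * `|x| * `|x|.
    have cn : `|partials s (S n) (X + x *: basis3 R i) - partials s (S n) X - x * partials (i :: s) (S n) X| @[n --> \oo]
      --> `|G s (X + x *: basis3 R i) - G s X - x * G (i :: s) X|.
      apply: cvg_norm; apply: cvgB; first by apply: cvgB; exact: GE.
      by apply: cvgM; [exact: cvg_cst|exact: GE].
    rewrite -(cvg_lim _ cn)//; apply: limr_le; first by apply/cvg_ex; eexists; exact: cn.
    by near=> n; exact: step2.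
  exact: derive_of_quadratic Hq.
have E s : partials s F = G s.
  elim: s => //= i s ->; apply/funext => X.
  by have [_ <-] := Gder s i X.
split=> [s|s X]; last by rewrite E.
by rewrite E; split=> // i X; have [] := Gder s i X.
Unshelve. all: by end_near. Qed.

End SmoothLimits.

(** * Uniform boundedness for distributions *)

Section BanachSteinhaus.
Context {R : realType}.
Local Notation V := (R * R * R)%type.
Implicit Types (f g psi : V -> R) (X Y d h : V) (s : seq 'I_3).

Definition bnd (N : nat) (M : R) f :=
  forall s, (size s <= N)%N -> forall X, `|partials s f X| <= M.

Definition DK (K : set V) f := is_test f /\ supported_in K f.

Lemma linear_scale (T : @functional R) (a : R) f : linear_on_test T -> is_test f ->
  T (fun X => a * f X) = a * T f.
Proof.
move=> lT tf; have t0 := @is_test0 R.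
have T0 : T (fun _ => 0) = 0.
  have : T (fun _ => 0) = T (fun _ => 0) + T (fun _ => 0).
    rewrite -[X in _ = X + _]mul1r -(lT 1 _ _ t0 t0).
    by congr T; apply/funext => x; rewrite mulr0 addr0.
  by move=> /eqP; rewrite -subr_eq subrr => /eqP.
have := lT a _ _ tf t0; rewrite T0 addr0 => <-.
by congr T; apply/funext => X; rewrite addr0.
Qed.

Lemma linear_sub (T : @functional R) f g : linear_on_test T -> is_test f -> is_test g ->
  T (fun X => f X - g X) = T f - T g.
Proof.
move=> lT tf tg; have := lT (-1) _ _ tg tf; rewrite mulN1r addrC => <-.
by congr T; apply/funext => X; rewrite mulN1r addrC.
Qed.

Lemma linear_add (T : @functional R) f g : linear_on_test T -> is_test f -> is_test g ->
  T (fun X => f X + g X) = T f + T g.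
Proof.
move=> lT tf tg; have := lT 1 _ _ tf tg; rewrite mul1r => <-.
by congr T; apply/funext => X; rewrite mul1r.
Qed.

Lemma is_test_sub f g : is_test f -> is_test g -> is_test (fun X => f X - g X).
Proof.
move=> tf tg; have := is_test_lin (-1) _ _ tg tf.
by congr is_test; apply/funext => X; rewrite mulN1r addrC.
Qed.

Lemma is_test_add f g : is_test f -> is_test g -> is_test (fun X => f X + g X).
Proof.
move=> tf tg; have := is_test_lin 1 _ _ tf tg.
by congr is_test; apply/funext => X; rewrite mul1r.
Qed.

Lemma is_test_scale (a : R) f : is_test f -> is_test (fun X => a * f X).
Proof.
move=> tf; have := is_test_lin a _ _ tf (@is_test0 R).
by congr is_test; apply/funext => X; rewrite addr0.
Qed.

Lemma partials_scale s (a : R) f : smooth f ->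
  partials s (fun X => a * f X) = (fun X => a * partials s f X).
Proof.
move=> sf; have := partials_lin s a _ _ sf (@smooth0 R).
rewrite partials0 => E; transitivity (partials s (fun X => a * f X + 0)).
  by congr partials; apply/funext => X; rewrite addr0.
by rewrite E; apply/funext => X; rewrite addr0.
Qed.

Lemma partials_sub s f g : smooth f -> smooth g ->
  partials s (fun X => f X - g X) = (fun X => partials s f X - partials s g X).
Proof.
move=> sf sg; have := partials_lin s (-1) _ _ sg sf => E.
transitivity (partials s (fun X => -1 * g X + f X)).
  by congr partials; apply/funext => X; rewrite mulN1r addrC.
by rewrite E; apply/funext => X; rewrite mulN1r addrC.
Qed.

Lemma partials_add s f g : smooth f -> smooth g ->
  partials s (fun X => f X + g X) = (fun X => partials s f X + partials s g X).
Proof.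
move=> sf sg; have := partials_lin s 1 _ _ sf sg => E.
transitivity (partials s (fun X => 1 * f X + g X)).
  by congr partials; apply/funext => X; rewrite mul1r.
by rewrite E; apply/funext => X; rewrite mul1r.
Qed.

Section GlidingHump.
Variables (J : Type) (U : J -> @functional R) (K : set V).
Hypothesis cK : compact K.
Hypothesis dU : forall j, is_distribution (U j).
Hypothesis bU : forall f, DK K f -> exists B : R, forall j, `|U j f| <= B.
Hypothesis nU : ~ exists (C : R) (N : nat), forall j f, DK K f -> forall M,
  bnd N M f -> `|U j f| <= C * M.

Lemma hump (N : nat) (e A : R) : 0 < e -> 0 <= A ->
  exists j f, [/\ DK K f, bnd N e f & A < `|U j f|].
Proof.
move=> e0 A0; apply: contrapT => H; apply: nU; exists (A / e), N => j f Df M Hf.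
have M0 : 0 <= M by apply: le_trans (Hf [::] isT 0).
have [Mn0|Mn0] := eqVneq M 0.
  rewrite Mn0.
  have f0 : f = fun X => 0 * f X.
    apply/funext => X; rewrite mul0r; apply/eqP; rewrite -normr_le0.
    by have := Hf [::] isT X; rewrite Mn0.
  rewrite mulr0 f0 linear_scale ?mul0r ?normr0//; first exact: (dU j).1.
  by case: Df.
have {Mn0}M0 : 0 < M by rewrite lt_neqAle eq_sym Mn0.
rewrite leNgt; apply/negP => Hc; apply: H; exists j, (fun X => e / M * f X); split.
- split; first by apply: is_test_scale; case: Df.
  by move=> X nX; rewrite Df.2 ?mulr0.
- move=> s sN X; rewrite partials_scale; last by case: Df => -[].
  rewrite normrM ger0_norm ?divr_ge0 ?(ltW e0) ?(ltW M0)//.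
  by rewrite -[leRHS](divfK (lt0r_neq0 M0)) ler_wpM2l ?Hf// divr_ge0 ?(ltW e0) ?(ltW M0).
- rewrite linear_scale; [|exact: (dU j).1|by case: Df].
  rewrite normrM ger0_norm ?divr_ge0 ?(ltW e0) ?(ltW M0)//.
  rewrite -ltr_pdivrMl ?divr_gt0// invf_div.
  by move: Hc; congr (_ < _); field; rewrite lt0r_neq0.
Qed.

(* Sum of the humps so far, order of the seminorms that the next hump must keep
   small, and the allowed size. *)
Definition state := {st : (V -> R) * nat * R | DK K st.1.1 /\ 0 < st.2}.
Definition stS (x : state) := (sval x).1.1.
Definition stN (x : state) := (sval x).1.2.
Definition stE (x : state) := (sval x).2.

Lemma hump_step (x : state) : exists y : J * (V -> R) * state,
  let: (j, f, x') := y in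
  [/\ DK K f, bnd (stN x) (stE x) f, stS x' = (fun X => stS x X + f X),
      (stN x < stN x')%N /\ stE x' <= stE x / 2 &
   [/\ exists B : R, (forall j, `|U j (stS x)| <= B) /\ B + (stN x)%:R + 2 < `|U j f|
     & exists C : R, [/\ 0 <= C, C * (2 * stE x') <= 1 &
       forall g M, DK K g -> bnd (stN x') M g -> `|U j g| <= C * M]]].
Proof.
case: x => -[[S N] e] [/= DS e0]; rewrite /stS /stN /stE /=.
have [B HB] := bU S DS.
have [j0 [f0 _]] := hump 0 1 0 ltr01 (lexx _).
have B0 : 0 <= B by apply: le_trans (HB j0).
have [j [f [Df bf Hf]]] := hump N e (B + N%:R + 2) e0 (addr_ge0 (addr_ge0 B0 (ler0n _ _)) (ler0n _ _)).
have [C [n HC]] := (dU j).2 K cK.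
pose C' := `|C|; pose e' := Num.min (e / 2) (2 * (C' + 1))^-1.
have C'0 : 0 <= C' by exact: normr_ge0.
have e'0 : 0 < e'.
  rewrite lt_min; apply/andP; split; first exact: divr_gt0.
  by rewrite invr_gt0; apply: mulr_gt0 => //; apply: ltr_wpDl => //; exact: normr_ge0.
have D' : DK K (fun X => S X + f X).
  split; first by apply: is_test_add; [case: DS|case: Df].
  by move=> X nX; rewrite DS.2// Df.2// addr0.
exists (j, f, exist _ ((fun X => S X + f X), maxn N.+1 n, e') (conj D' e'0)) => /=.
split=> //; first by split; [exact: leq_maxl|rewrite ge_min lexx].
split; first by exists B.
exists C'; split=> //.
  have : e' <= (2 * (C' + 1))^-1 by rewrite ge_min lexx orbT.
  have C1 : 0 < C' + 1 by rewrite ltr_wpDl.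
  move=> H; apply: (@le_trans _ _ ((C' + 1) * (2 * (2 * (C' + 1))^-1))).
    by apply: ler_pM; rewrite ?mulr_ge0 ?(ltW e'0)// ?lerDl// ler_wpM2l.
  by rewrite mulrCA mulrA mulfV// lt0r_neq0// mulr_gt0.
move=> g M Dg bg; have M0 : 0 <= M by apply: le_trans (bg [::] isT 0).
apply: (@le_trans _ _ (C * M)).
  apply: HC => //; [by case: Dg|by case: Dg|].
  by move=> s sn; apply: bg; rewrite (leq_trans sn)// leq_maxr.
by rewrite ler_wpM2r// ler_norm.
Qed.

End GlidingHump.

Lemma banach_steinhaus (J : Type) (U : J -> @functional R) (K : set V) :
  compact K -> (forall j, is_distribution (U j)) ->
  (forall f, DK K f -> exists B : R, forall j, `|U j f| <= B) ->
  exists (C : R) (N : nat), forall j f, DK K f -> forall M,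
    bnd N M f -> `|U j f| <= C * M.
Proof.
move=> cK dU bU; apply: contrapT => nU.
have [F HF] := choice (hump_step _ U K cK dU bU nU).
have D0 : DK K (fun _ => 0) by split; [exact: is_test0|].
pose st0 : state K := exist _ ((fun _ => 0), 0%N, 1) (conj D0 ltr01).
pose st n := iter n (fun x => (F x).2) st0.
pose S n := stS K (st n); pose e n := stE K (st n); pose N n := stN K (st n).
pose f n := (F (st n)).1.2; pose j n := (F (st n)).1.1.
have H n : [/\ DK K (f n), bnd (N n) (e n) (f n), S n.+1 = (fun X => S n X + f n X),
      (N n < N n.+1)%N /\ e n.+1 <= e n / 2 &
   [/\ exists B : R, (forall j, `|U j (S n)| <= B) /\ B + (N n)%:R + 2 < `|U (j n) (f n)|
     & exists C : R, [/\ 0 <= C, C * (2 * e n.+1) <= 1 &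
       forall g M, DK K g -> bnd (N n.+1) M g -> `|U (j n) g| <= C * M]]].
  have := HF (st n); rewrite /f /j /S /e /N /=.
  by case: (F (st n)) => -[jj ff] x'.
have DS n : DK K (S n) by rewrite /S /stS; case: (st n) => -[[a b] c] [].
have e0 n : 0 < e n by rewrite /e /stE; case: (st n) => -[[a b] c] [].
have sS n : smooth (S n) by case: (DS n) => -[].
have sf n : smooth (f n) by case: (H n) => -[[]].
have NS n : (N n < N n.+1)%N by case: (H n) => _ _ _ [].
have Nmono n m : (n <= m)%N -> (N n <= N m)%N.
  elim: m => [|m IH]; first by rewrite leqn0 => /eqP ->.
  by rewrite leq_eqVlt => /predU1P[->//|]; rewrite ltnS => /IH /leq_trans; apply; exact: ltnW.
have Nge n : (n <= N n)%N by elim: n => // n IH; exact: leq_ltn_trans (NS n).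
have eS n : e n.+1 <= e n / 2 by case: (H n) => _ _ _ [].
have ele n : e n <= 2^-1 ^+ n.
  elim: n => [|n IH]; first by rewrite expr0.
  by apply: le_trans (eS n) _; rewrite exprSr ler_wpM2r// invr_ge0.
have tail n m s X : (n <= m)%N -> (size s <= N n)%N ->
    `|partials s (S m) X - partials s (S n) X| <= 2 * e n - 2 * e m.
  move=> nm sN; elim: m nm => [|m IH].
    by rewrite leqn0 => /eqP ->; rewrite !subrr normr0.
  rewrite leq_eqVlt => /predU1P[->|]; first by rewrite !subrr normr0.
  rewrite ltnS => nm; have {IH}IH := IH nm.
  have [_ bf -> _ _] := H m; rewrite partials_add//.
  have := bf s (leq_trans sN (Nmono _ _ nm)) X.
  have := eS m; have := ler_normD (partials s (S m) X - partials s (S n) X) (partials s (f m) X).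
  rewrite -[_ - _ + _]addrAC; move: IH; lra.
have tail' n m s X : (n <= m)%N -> (size s <= N n)%N ->
    `|partials s (S m) X - partials s (S n) X| <= 2 * e n.
  by move=> nm sN; apply: le_trans (tail _ _ _ _ nm sN) _; have := e0 m; lra.
have e2 : (2 * e n) @[n --> \oo] --> (0 : R).
  have L : (2 * 2^-1 ^+ n : R) @[n --> \oo] --> (2 * 0 : R).
    apply: cvgM; [exact: cvg_cst|apply: cvg_expr].
    by rewrite ger0_norm ?invr_ge0// invf_lt1 ?ltr1n.
  rewrite mulr0 in L; apply: (@squeeze_cvgr _ _ _ _ (cst 0) _ _ _ _ _ L); last exact: cvg_cst.
  by near=> n; rewrite mulr_ge0 ?(ltW (e0 n))//= ler_wpM2l.
have lims s X n : (size s <= N n)%N -> cvg (partials s (S m) X @[m --> \oo]) /\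
    `|lim (partials s (S m) X @[m --> \oo]) - partials s (S n) X| <= 2 * e n.
  move=> sN.
  have [c Hc] := cvg_le_tail (fun m => partials s (S m) X) (fun n => 2 * e n) n
     (fun k m nk km => tail' k m s X km (leq_trans sN (Nmono _ _ nk))) e2.
  by split=> //; exact: Hc.
pose G := fun X => lim (S n X @[n --> \oo]).
have [sG GE] : smooth G /\ forall s X, partials s G X = lim (partials s (S n) X @[n --> \oo]).
  apply: smooth_limit => //; last by move=> s X; have [] := lims s X (size s) (Nge _).
  move=> s.
  have [M M0 HM] : exists2 M : R, 0 <= M & forall k, (k <= size s)%N -> forall X, `|partials s (S k) X| <= M.
    elim: (size s) => [|n [M M0 HM]].
      have [M M0 HM] := test_bounded _ (is_test_partials s _ (DS 0%N).1).
      by exists M => // k; rewrite leqn0 => /eqP ->.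
    have [A A0 HA] := test_bounded _ (is_test_partials s _ (DS n.+1).1).
    exists (M + A); first exact: addr_ge0.
    move=> k; rewrite leq_eqVlt => /predU1P[-> X|kn X].
      by rewrite (le_trans (HA X))// lerDr.
    by rewrite (le_trans (HM k kn X))// lerDl.
  exists (M + 2 * e (size s)) => n X.
  have [ns|sn] := leqP n (size s).
    by rewrite (le_trans (HM n ns X))// lerDl mulr_ge0// ltW.
  have := tail' _ _ s X (ltnW sn) (Nge _); have := HM _ (leqnn _) X.
  have := ler_normD (partials s (S n) X - partials s (S (size s)) X) (partials s (S (size s)) X).
  by rewrite subrK; lra.
have DG : DK K G.
  have sK : supported_in K G.
    move=> X nX; rewrite /G; apply/cvg_lim => //.
    rewrite (_ : (fun n => S n X) = fun=> 0); first exact: cvg_cst.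
    by apply/funext => n; rewrite (DS n).2.
  by split=> //; split=> //; exists K.
have [B HB] := bU G DG.
have key n : n%:R < B.
  have [Df bf SE _ [[BS [HBS Hf]] [C [C0 Ce HC]]]] := H n.
  have tS := (DS n.+1).1.
  have tG : DK K (fun X => G X - S n.+1 X).
    split; first by apply: is_test_sub; [case: DG|].
    by move=> X nX; rewrite DG.2// (DS _).2// subrr.
  have bG : bnd (N n.+1) (2 * e n.+1) (fun X => G X - S n.+1 X).
    move=> s sN X; rewrite partials_sub// GE; exact: (lims s X n.+1 sN).2.
  have h1 := le_trans (HC _ _ tG bG) Ce.
  have lU := (dU (j n)).1.
  rewrite linear_sub// in h1; last exact: DG.1.
  rewrite SE linear_add// in h1; [|exact: (DS n).1|exact: Df.1].
  have h2 := HBS (j n); have h3 := HB (j n).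
  have h4 : (n%:R : R) <= (N n)%:R by rewrite ler_nat.
  move: h1 h2 h3 h4 Hf; move: (U _ _) (U _ _) (U _ _) (N n)%:R n%:R => x y z k l.
  rewrite !ler_norml ltr_normr => /andP[a1 a2] /andP[b1 b2] /andP[d1 d2] kl /orP[]; lra.
have := key (Num.truncn B).+1; apply/negP; rewrite -leNgt.
by apply/ltW/truncnS_gt.
Unshelve. all: by end_near. Qed.

End BanachSteinhaus.

Section CurveContinuity.
Context {R : realType}.
Local Notation V := (R * R * R)%type.
Implicit Types (f g psi chi : V -> R) (X Y d h : V) (s : seq 'I_3).

Definition cont_family (U : R -> @functional R) :=
  (forall t, is_distribution (U t)) /\
  forall psi, is_test psi -> continuous (fun t => U t psi).

Lemma cont_family_bound (U : R -> @functional R) (r m : R) : cont_family U ->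
  exists (C : R) (N : nat), 0 <= C /\ forall t f, `|t| <= r -> DK (box m) f ->
    forall M, bnd N M f -> `|U t f| <= C * M.
Proof.
move=> [dU cU].
have [|||C [N HC]] := @banach_steinhaus R {t : R | `|t| <= r} (fun t => U (sval t)) (box m).
- exact: compact_box.
- by move=> t; exact: dU.
- move=> f [tf _].
  have ck : {within `[-r, r]%classic, continuous (fun t => U t f)}.
    by apply: continuous_subspaceT; exact: cU.
  have [M [Mr HM]] := compact_bounded (continuous_compact ck (@segment_compact _ _ _)).
  exists (`|M| + 1) => -[t tr] /=; apply: (HM (`|M| + 1)).
    by rewrite ltr_pwDr// ler_norm.
  by exists t => //; rewrite /= in_itv /= -ler_norml.
- exists `|C|, N; split=> // t f tr Df M Hf.
  have M0 : 0 <= M by apply: le_trans (Hf [::] isT 0).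
  apply: le_trans (HC (exist _ t tr) f Df M Hf) _.
  by rewrite ler_wpM2r// ler_norm.
Qed.

Lemma partials_comm s i f : is_test f ->
  partials s (partial i f) = partial i (partials s f).
Proof.
move=> tf; elim: s => //= j s ->; apply: partial_comm; exact: is_test_partials.
Qed.

Definition rem chi h d : V -> R := fun X =>
  (tr (h + d) chi X - tr h chi X) - \sum_(i < 3) coord d i * tr h (partial i chi) X.

Lemma rem_expand chi h d : rem chi h d = fun X =>
  (((tr (h + d) chi X - tr h chi X) - coord d c0 * tr h (partial c0 chi) X)
   - coord d c1 * tr h (partial c1 chi) X) - coord d c2 * tr h (partial c2 chi) X.
Proof. by apply/funext => X; rewrite /rem sum3 !opprD !addrA. Qed.

Lemma is_test_tr_partial h i f : is_test f -> is_test (tr h (partial i f)).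
Proof. by move=> tf; apply: is_test_tr; exact: (is_test_partials [:: i]). Qed.

Lemma is_test_rem chi h d : is_test chi -> is_test (rem chi h d).
Proof.
move=> tc; rewrite rem_expand.
do 3 (apply: is_test_sub; last by apply: is_test_scale; exact: is_test_tr_partial).
by apply: is_test_sub; exact: is_test_tr.
Qed.

Lemma linear_combination (T : @functional R) f g e0 e1 e2 (k0 k1 k2 : R) :
  linear_on_test T -> is_test f -> is_test g ->
  is_test e0 -> is_test e1 -> is_test e2 ->
  T (fun X => f X - g X - k0 * e0 X - k1 * e1 X - k2 * e2 X) =
  T f - T g - (k0 * T e0 + k1 * T e1 + k2 * T e2).
Proof.
move=> lT tf tg t0 t1 t2.
rewrite -(linear_scale _ k0 _ lT t0) -(linear_scale _ k1 _ lT t1).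
rewrite -(linear_scale _ k2 _ lT t2) -(linear_sub _ _ _ lT tf tg).
have {}t0 := is_test_scale k0 _ t0; have {}t1 := is_test_scale k1 _ t1.
have {}t2 := is_test_scale k2 _ t2; have t3 := is_test_sub _ _ tf tg.
have t4 := is_test_sub _ _ t3 t0; have t5 := is_test_sub _ _ t4 t1.
rewrite (linear_sub _ _ _ lT t5 t2) (linear_sub _ _ _ lT t4 t1).
by rewrite (linear_sub _ _ _ lT t3 t0) !opprD !addrA.
Qed.

Lemma partials_combination s f g e0 e1 e2 (k0 k1 k2 : R) X :
  is_test f -> is_test g -> is_test e0 -> is_test e1 -> is_test e2 ->
  partials s (fun X => f X - g X - k0 * e0 X - k1 * e1 X - k2 * e2 X) X =
  partials s f X - partials s g X -
    (k0 * partials s e0 X + k1 * partials s e1 X + k2 * partials s e2 X).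
Proof.
move=> tf tg t0 t1 t2.
have E0 := partials_scale s k0 _ t0.1; have E1 := partials_scale s k1 _ t1.1.
have E2 := partials_scale s k2 _ t2.1.
have {}t0 := is_test_scale k0 _ t0; have {}t1 := is_test_scale k1 _ t1.
have {}t2 := is_test_scale k2 _ t2; have t3 := is_test_sub _ _ tf tg.
have t4 := is_test_sub _ _ t3 t0; have t5 := is_test_sub _ _ t4 t1.
rewrite (partials_sub s _ _ t5.1 t2.1) (partials_sub s _ _ t4.1 t1.1).
rewrite (partials_sub s _ _ t3.1 t0.1) (partials_sub s _ _ tf.1 tg.1).
by rewrite E0 E1 E2 !opprD !addrA.
Qed.

Lemma linear_rem (T : @functional R) chi h d : linear_on_test T -> is_test chi ->
  T (rem chi h d) = T (tr (h + d) chi) - T (tr h chi)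
    - \sum_(i < 3) coord d i * T (tr h (partial i chi)).
Proof.
move=> lT tc; rewrite rem_expand sum3.
by apply: linear_combination => //; try exact: is_test_tr; exact: is_test_tr_partial.
Qed.

Lemma partials_rem s chi h d X : is_test chi ->
  partials s (rem chi h d) X = partials s chi (X + h + d) - partials s chi (X + h)
    - \sum_(i < 3) coord d i * partials (i :: s) chi (X + h).
Proof.
move=> tc; have E i : partials (i :: s) chi (X + h) = partials s (tr h (partial i chi)) X.
  by rewrite partials_tr partials_comm.
rewrite rem_expand sum3 (E c0) (E c1) (E c2).
have -> : partials s chi (X + h + d) = partials s (tr (h + d) chi) X.
  by rewrite partials_tr /tr addrA.
have -> : partials s chi (X + h) = partials s (tr h chi) X by rewrite partials_tr.
by apply: partials_combination => //; try exact: is_test_tr; exact: is_test_tr_partial.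
Qed.

Lemma rem_bound chi (N : nat) (r m : R) : is_test chi -> supported_in (box m) chi ->
  exists M : R, forall h d, `|h| <= r -> `|h + d| <= r ->
    DK (box (m + r)) (rem chi h d) /\ bnd N (M * norm1 d ^+ 2) (rem chi h d).
Proof.
move=> tc sm; have [M M0 HM] := test_bounded_partials N.+2 _ tc.
exists (3 * M) => h d hr hdr; split; last first.
  move=> s sN X; rewrite partials_rem//; apply: taylor2; first by case: tc.
  by move=> i j Y; exact: HM.
split; first exact: is_test_rem.
move=> X nX; rewrite /rem !(supported_in_tr _ _ _ _ sm hr X nX).
rewrite (supported_in_tr _ _ _ _ sm hdr X nX) subr0 big1 ?subr0// => i _.
have sp : supported_in (box m) (partial i chi).
  by apply: (@supported_in_partials _ (box m) [:: i]) => //; exact: compact_box.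
by rewrite (supported_in_tr _ _ _ _ sp hr X nX) mulr0.
Qed.

Lemma continuous_coord i : continuous (fun X : V => coord X i).
Proof.
move: i; apply: ord3P => -[[x y] z]; rewrite /coord /=.
- by apply: cvg_comp; [exact: cvg_fst|exact: cvg_fst].
- by apply: cvg_comp; [exact: cvg_fst|exact: cvg_snd].
- exact: cvg_snd.
Qed.

Lemma coordB X Y i : coord (X - Y) i = coord X i - coord Y i.
Proof. by rewrite /coord; case: ifP => _ //; case: ifP. Qed.

Lemma continuous_norm1 : continuous (norm1 : V -> R).
Proof.
move=> X; rewrite (_ : norm1 = fun X : V => `|coord X c0| + `|coord X c1| + `|coord X c2|); last first.
  by apply/funext => Y; rewrite /norm1 sum3.
by apply: cvgD; [apply: cvgD|]; apply: cvg_norm; exact: continuous_coord.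
Qed.

End CurveContinuity.

(** * Pairing curves of distributions with moving test functions *)

Section CurveDerivative.
Context {R : realType}.
Local Notation V := (R * R * R)%type.
Implicit Types (f g psi chi : V -> R) (X Y d h : V) (s : seq 'I_3).


Lemma rem_family_bound (U : R -> @functional R) chi (r : R) :
  cont_family U -> is_test chi ->
  exists2 C : R, 0 <= C & forall t h d, `|t| <= r -> `|h| <= r -> `|h + d| <= r ->
    `|U t (rem chi h d)| <= C * norm1 d ^+ 2.
Proof.
move=> cU tc; have [m m0 sm] := is_test_box _ tc.
have [C [N [C0 HC]]] := cont_family_bound U r (m + r) cU.
have [M HM] := rem_bound chi N r m tc sm.
exists (C * `|M|); first exact: mulr_ge0.
move=> t h d tr hr hdr; have [Dr br] := HM h d hr hdr.
apply: (le_trans (HC t _ tr Dr _ br)); rewrite mulrA ler_wpM2r ?exprn_ge0 ?norm1_ge0//.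
by rewrite ler_wpM2l// ler_norm.
Qed.

Lemma continuous_translate (U : R -> @functional R) chi (T : topologicalType)
    (tau : T -> R) (gam : T -> V) (x : T) :
  cont_family U -> is_test chi -> {for x, continuous tau} -> {for x, continuous gam} ->
  {for x, continuous (fun y => U (tau y) (tr (gam y) chi))}.
Proof.
move=> cU tc ctau cgam.
pose r := `|tau x| + `|gam x| + 1.
have [C C0 HC] := rem_family_bound U chi r cU tc.
have [p [q [tp tq E]]] : exists (p : 'I_3 -> V -> R) (q : V -> R),
    [/\ forall i, is_test (p i), is_test q /\ q = tr (gam x) chi &
    forall y, U (tau y) (tr (gam y) chi) = U (tau y) (rem chi (gam x) (gam y - gam x))
      + U (tau y) q + \sum_(i < 3) coord (gam y - gam x) i * U (tau y) (p i)].
  exists (fun i => tr (gam x) (partial i chi)), (tr (gam x) chi); split.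
  - by move=> i; exact: is_test_tr_partial.
  - by split => //; exact: is_test_tr.
  - move=> y; rewrite linear_rem//; last by case: (cU.1 (tau y)).
    by rewrite subrKC; ring.
have cs psi : is_test psi -> U (tau y) psi @[y --> x] --> U (tau x) psi.
  move=> tpsi; apply: (@continuous_cvg _ _ _ _ _ tau (fun t => U t psi)) => //; exact: cU.2.
have cd : gam y - gam x @[y --> x] --> (0 : V).
  by rewrite -(subrr (gam x)); apply: cvgB => //; exact: cvg_cst.
have n10 : norm1 (gam y - gam x) @[y --> x] --> (0 : R).
  have -> : (0 : R) = norm1 (0 : V).
    by apply/esym; rewrite /norm1 big1// => i _; rewrite /coord; case: ifP => _; [|case: ifP => _]; exact: normr0.
  by apply: (@continuous_cvg _ _ _ _ _ (fun y => gam y - gam x) norm1) => //; exact: continuous_norm1.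
have cc i : coord (gam y - gam x) i @[y --> x] --> (0 : R).
  have -> : (0 : R) = coord (0 : V) i.
    by rewrite /coord; case: ifP => _; [|case: ifP => _].
  by apply: (@continuous_cvg _ _ _ _ _ (fun y => gam y - gam x) (coord ^~ i)) => //; exact: continuous_coord.
have Lrem : U (tau y) (rem chi (gam x) (gam y - gam x)) @[y --> x] --> (0 : R).
  apply: norm_cvg0.
  have L : C * (norm1 (gam y - gam x) * norm1 (gam y - gam x)) @[y --> x] --> (C * (0 * 0) : R).
    by apply: cvgM; [exact: cvg_cst|apply: cvgM].
  rewrite !mulr0 in L; apply: (@squeeze_cvgr _ _ _ _ (cst 0) _ _ _ _ _ L); last exact: cvg_cst.
  near=> y; rewrite normr_ge0 /= -expr2; apply: HC; rewrite ?subrKC.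
  - near: y; have := @cvgr_norm_le _ _ _ _ _ _ _ ctau r; apply.
    by rewrite /r -addrA ltrDl ltr_wpDl.
  - by rewrite /r; have := normr_ge0 (tau x); lra.
  - near: y; have := @cvgr_norm_le _ _ _ _ _ _ _ cgam r; apply.
    by rewrite /r; have := normr_ge0 (tau x); lra.
have L : U (tau y) (rem chi (gam x) (gam y - gam x)) + U (tau y) q +
  (coord (gam y - gam x) c0 * U (tau y) (p c0) + coord (gam y - gam x) c1 * U (tau y) (p c1) +
   coord (gam y - gam x) c2 * U (tau y) (p c2)) @[y --> x] -->
  0 + U (tau x) q + (0 * U (tau x) (p c0) + 0 * U (tau x) (p c1) + 0 * U (tau x) (p c2)).
  apply: cvgD; last first.
    by apply: cvgD; [apply: cvgD|]; apply: cvgM; (try exact: cc); exact: cs.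
  by apply: cvgD => //; exact: cs tq.1.
rewrite /prop_for /continuous_at -tq.2.
rewrite (_ : (fun y => U (tau y) (tr (gam y) chi)) = (fun y =>
  U (tau y) (rem chi (gam x) (gam y - gam x)) + U (tau y) q +
  (coord (gam y - gam x) c0 * U (tau y) (p c0) + coord (gam y - gam x) c1 * U (tau y) (p c1) +
   coord (gam y - gam x) c2 * U (tau y) (p c2)))); last first.
  by apply/funext => y; rewrite E sum3.
by rewrite !mul0r !addr0 add0r in L.
Unshelve. all: by end_near. Qed.

Lemma is_derive_quadratic_near (f : R -> R) (x a M : R) :
  (\forall y \near x, `|f y - f x - (y - x) * a| <= M * `|y - x| * `|y - x|) ->
  is_derive x (1 : R) f a.
Proof.
move=> H.
have L : (fun h : R => h^-1 *: ((f \o shift x) (h *: (1 : R)) - f x)) @ 0^' --> a.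
  apply/cvgrPdist_le => e e0.
  near=> h.
  have h0 : h != 0 by near: h; exact: nbhs_dnbhs_neq.
  rewrite /= scaler1 distrC.
  have h0' : 0 < `|h| by rewrite normr_gt0.
  rewrite -(ler_pM2l h0') -normrM mulrBr -[h * (_ *: _)]/(h * (h^-1 * _)) mulrA mulfV// mul1r.
  have Hh : `|f (h + x) - f x - (h + x - x) * a| <= M * `|h + x - x| * `|h + x - x|.
    near: h; apply: nbhs_dnbhs.
    have : (fun h : R => h + x) @ 0 --> x.
      by rewrite -{2}[x]add0r; apply: cvgD; [exact: cvg_id|exact: cvg_cst].
    by move/(_ _ H).
  rewrite addrK in Hh; apply: (le_trans Hh).
  rewrite mulrC ler_pM2l// mulrC; apply: (@le_trans _ _ (`|h| * (`|M| + 1))).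
    by rewrite ler_wpM2l// (le_trans (ler_norm _))// lerDl.
  rewrite -ler_pdivlMr ?ltr_wpDl//; near: h; apply: dnbhs0_le.
  by rewrite divr_gt0// ltr_wpDl.
split; first by apply/cvg_ex; exists a.
exact: cvg_lim.
Unshelve. all: by end_near. Qed.

Lemma is_derive_near_lipschitz (f : R -> R) (x a : R) : is_derive x (1 : R) f a ->
  \forall y \near x, `|f y - f x| <= (`|a| + 1) * `|y - x|.
Proof.
move=> [df Df].
have L : (fun h : R => h^-1 *: ((f \o shift x) (h *: (1 : R)) - f x)) @ 0^' --> a.
  by rewrite -Df.
have L1 : \forall t \near 0^', `|t^-1 *: ((f \o shift x) (t *: (1 : R)) - f x)| <= `|a| + 1.
  by apply: (@cvgr_norm_le _ _ _ _ _ _ _ L); rewrite ltr_pwDr.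
have L2 : (fun y : R => y - x) @ x --> (0 : R).
  by rewrite -(subrr x); apply: cvgB; [exact: cvg_id|exact: cvg_cst].
have := L2 _ L1; rewrite /= nbhs_simpl /=; apply: filterS => y /= Hy.
have [->|yx] := eqVneq y x; first by rewrite !subrr normr0 mulr0.
have yx' : y - x != 0 by rewrite subr_eq0.
have := Hy yx'; rewrite scaler1 subrK -[_ *: _]/(_ * _) normrM normfV.
by rewrite ler_pdivrMl ?normr_gt0// mulrC.
Qed.

Lemma is_derive_translate (U : R -> @functional R) (U' : @functional R) chi
    (gam : R -> V) (dgam : 'I_3 -> R) (x : R) :
  cont_family U -> is_test chi ->
  (forall psi, is_test psi -> is_derive x (1 : R) (fun t => U t psi) (U' psi)) ->
  (forall i, is_derive x (1 : R) (fun t => coord (gam t) i) (dgam i)) ->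
  is_derive x (1 : R) (fun t => U t (tr (gam t) chi))
    (U' (tr (gam x) chi) + \sum_(i < 3) dgam i * U x (tr (gam x) (partial i chi))).
Proof.
move=> cU tc dU dg.
have cg : {for x, continuous gam}.
  have cgi i : (fun t => coord (gam t) i) @ x --> coord (gam x) i.
    exact: (is_derive_continuous _ _ _ (dg i)).
  have -> : gam = fun t => (coord (gam t) c0, coord (gam t) c1, coord (gam t) c2).
    by apply/funext => t; rewrite /coord /=; case: (gam t) => [[]].
  rewrite /prop_for /continuous_at.
  exact: (cvg_pair (cvg_pair (cgi c0) (cgi c1)) (cgi c2)).
pose r := `|x| + `|gam x| + 1.
have [C C0 HC] := rem_family_bound U chi r cU tc.
pose Rm t := U t (rem chi (gam x) (gam t - gam x)).
have [p [q [tp tq E Ep]]] : exists (p : 'I_3 -> V -> R) (q : V -> R),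
    [/\ forall i, is_test (p i), is_test q /\ q = tr (gam x) chi,
    forall t, U t (tr (gam t) chi) = Rm t
      + U t q + \sum_(i < 3) coord (gam t - gam x) i * U t (p i) &
    forall i, p i = tr (gam x) (partial i chi)].
  exists (fun i => tr (gam x) (partial i chi)), (tr (gam x) chi); split => //.
  - by move=> i; exact: is_test_tr_partial.
  - by split => //; exact: is_test_tr.
  - move=> y; rewrite /Rm linear_rem//; last by case: (cU.1 y).
    by rewrite subrKC; ring.
have -> : U' (tr (gam x) chi) + \sum_(i < 3) dgam i * U x (tr (gam x) (partial i chi)) =
   U' q + (dgam c0 * U x (p c0) + dgam c1 * U x (p c1) + dgam c2 * U x (p c2)).
  by rewrite tq.2 sum3 (Ep c0) (Ep c1) (Ep c2).
have -> : (fun t => U t (tr (gam t) chi)) = (fun t => Rm t + U t q +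
   ((coord (gam t) c0 - coord (gam x) c0) * U t (p c0)
   + (coord (gam t) c1 - coord (gam x) c1) * U t (p c1)
   + (coord (gam t) c2 - coord (gam x) c2) * U t (p c2))).
  by apply/funext => t; rewrite E sum3 !coordB.
have dR : is_derive x (1 : R) Rm 0.
  pose L := (`|dgam c0| + 1) + (`|dgam c1| + 1) + (`|dgam c2| + 1).
  have R0 : Rm x = 0.
    have := E x; rewrite -tq.2 sum3 !coordB !subrr !mul0r !addr0.
    by move/eqP; rewrite -subr_eq subrr => /eqP.
  apply: (@is_derive_quadratic_near _ _ _ (C * L ^+ 2)).
  near=> t; rewrite R0 mulr0 !subr0.
  apply: (@le_trans _ _ (C * norm1 (gam t - gam x) ^+ 2)).
    apply: HC; rewrite ?subrKC.
    - near: t; apply: (@cvgr_norm_le _ _ _ _ _ _ _ (@cvg_id _ (nbhs x)) r).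
      by rewrite /r -addrA ltrDl ltr_wpDl.
    - by rewrite /r; have := normr_ge0 x; lra.
    - near: t; apply: (@cvgr_norm_le _ _ _ _ _ _ _ cg r).
      by rewrite /r; have := normr_ge0 x; lra.
  rewrite -!mulrA ler_wpM2l// [leRHS](_ : _ = (L * `|t - x|) ^+ 2); last by move: L `|t - x| => *; ring.
  rewrite lerXn2r ?nnegrE ?norm1_ge0//.
    by rewrite mulr_ge0// /L !addr_ge0.
  rewrite /norm1 sum3 !coordB /L !mulrDl; apply: lerD; first apply: lerD;
    rewrite -mulrDl; near: t; exact: is_derive_near_lipschitz.
have d0 := dg c0; have d1 := dg c1; have d2 := dg c2.
have dp0 := dU _ (tp c0); have dp1 := dU _ (tp c1); have dp2 := dU _ (tp c2).
have dq := dU _ tq.1.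
apply: is_derive_eq.
rewrite !subrr !scale0r !subr0 !add0r.
rewrite -![_ *: _]/(_ * _).
by move: (U' q) (U x (p c0)) (U x (p c1)) (U x (p c2)) => *; ring.
Unshelve. all: by end_near. Qed.
End CurveDerivative.

Section CurveExtension.
Context {R : realType}.
Local Notation V := (R * R * R)%type.
Implicit Types (f g psi chi : V -> R) (X Y d h : V).

Definition ext0 (u : R -> @functional R) : R -> @functional R :=
  fun t => u (Num.max 0 t).

Lemma C1_curve_lipschitz (u u' : R -> @functional R) psi (t : R) :
  C1_curve u u' -> is_test psi -> 0 <= t ->
  \forall s \near t, 0 <= s ->
    `|u s psi - u t psi| <= (`|u' t psi| + 1) * `|s - t|.
Proof.
move=> [_ cu] tp t0; have [/(_ t t0) L _] := cu psi tp.
have L1 : \forall s \near within [set s | 0 <= s] t^',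
    `|(s - t)^-1 * (u s psi - u t psi)| <= `|u' t psi| + 1.
  by apply: (@cvgr_norm_le _ _ _ _ _ _ _ L); rewrite ltr_pwDr.
move: L1; rewrite /within /= => L1.
have L2 : \forall s \near t, s != t -> 0 <= s ->
  `|(s - t)^-1 * (u s psi - u t psi)| <= `|u' t psi| + 1 by exact: L1.
apply: filterS L2 => s Hs s0.
have [->|st] := eqVneq s t; first by rewrite !subrr normr0 mulr0.
have := Hs st s0; rewrite normrM normfV.
by rewrite ler_pdivrMl ?normr_gt0 ?subr_eq0// mulrC.
Qed.

Lemma ext0_cont_family (u u' : R -> @functional R) : C1_curve u u' ->
  cont_family (ext0 u).
Proof.
move=> cu; split; first by move=> t; apply: (cu.1 _ _).1; rewrite le_max lexx.
move=> psi tp t; rewrite /ext0.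
have m0 (s : R) : 0 <= Num.max 0 s by rewrite le_max lexx.
have cm : (fun s : R => Num.max 0 s) @ t --> Num.max 0 t.
  by apply: continuous_max; [exact: cvg_cst|exact: cvg_id].
have H := cm _ (C1_curve_lipschitz _ _ _ _ cu tp (m0 t)).
set L := `|u' _ _| + 1 in H.
have L0 : 0 < L by rewrite /L ltr_pwDr.
have {}H : \forall s \near t, 0 <= Num.max 0 s ->
  `|u (Num.max 0 s) psi - u (Num.max 0 t) psi| <= L * `|Num.max 0 s - Num.max 0 t| by exact: H.
apply/cvgrPdist_le => e e0; near=> s.
have Hs : `|u (Num.max 0 s) psi - u (Num.max 0 t) psi| <= L * `|Num.max 0 s - Num.max 0 t|.
  by near: s; apply: filterS H => s /(_ (m0 s)).
rewrite distrC (le_trans Hs)// -ler_pdivlMl// distrC; near: s.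
by move/cvgrPdist_le : cm; apply; rewrite mulr_gt0// invr_gt0.
Unshelve. all: by end_near. Qed.

Lemma ext0_is_derive (u u' : R -> @functional R) psi (t : R) : C1_curve u u' ->
  is_test psi -> 0 < t -> is_derive t (1 : R) (fun s => ext0 u s psi) (u' t psi).
Proof.
move=> [_ cu] tp t0; have [/(_ t (ltW t0)) L _] := cu psi tp.
have L1 : (fun h : R => h^-1 *: (((fun s => ext0 u s psi) \o shift t) (h *: (1 : R)) - ext0 u t psi)) @ 0^' --> u' t psi.
  apply/cvgrPdist_le => e e0.
  have /cvgrPdist_le/(_ e e0) := L; rewrite /within /= => L2.
  have {}L2 : \forall s \near t, s != t -> 0 <= s ->
    `|u' t psi - (s - t)^-1 * (u s psi - u t psi)| <= e by exact: L2.
  have c : (fun h : R => h + t) @ 0 --> t.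
    by rewrite -{2}[t]add0r; apply: cvgD; [exact: cvg_id|exact: cvg_cst].
  have L3 := c _ L2; have L4 : \forall s \near t, 0 < s by exact: lt_nbhsr.
  have L5 := c _ L4.
  have {}L3 : \forall h \near 0, h + t != t -> 0 <= h + t ->
    `|u' t psi - (h + t - t)^-1 * (u (h + t) psi - u t psi)| <= e by exact: L3.
  have {}L5 : \forall h \near 0, 0 < h + t by exact: L5.
  near=> h.
  have ht : 0 < h + t by near: h; apply: nbhs_dnbhs.
  have h0 : h != 0 by near: h; exact: nbhs_dnbhs_neq.
  rewrite /ext0 !max_r ?(ltW t0)// scaler1; last exact: ltW.
  have : h + t != t by rewrite -subr_eq0 addrK.
  have : (h + t) != t -> 0 <= h + t -> `|u' t psi - (h + t - t)^-1 * (u (h + t) psi - u t psi)| <= e.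
    by near: h; apply: nbhs_dnbhs.
  by move=> /[apply] /(_ (ltW ht)); rewrite addrK.
split; first by apply/cvg_ex; eexists; exact: L1.
exact: cvg_lim.
Unshelve. all: by end_near. Qed.

Lemma cst_cont_family (T : @functional R) : is_distribution T ->
  cont_family (fun _ => T).
Proof. by move=> dT; split => // psi _ t; exact: cvg_cst. Qed.

Lemma is_derive_distr_translate (T : @functional R) chi (gam : R -> V)
    (dgam : 'I_3 -> R) (x : R) :
  is_distribution T -> is_test chi ->
  (forall i, is_derive x (1 : R) (fun t => coord (gam t) i) (dgam i)) ->
  is_derive x (1 : R) (fun t => T (tr (gam t) chi))
    (\sum_(i < 3) dgam i * T (tr (gam x) (partial i chi))).
Proof.
move=> dT tc dg.
have := @is_derive_translate _ (fun _ => T) (fun _ => 0) chi gam dgam x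
  (cst_cont_family _ dT) tc (fun psi _ => is_derive_cst _ _ _) dg.
by rewrite add0r.
Qed.
End CurveExtension.

(** * Integrals depending on a parameter *)

Section Measurability.
Context {R : realType}.

Lemma caratheodory_measurable d (T : measurableType d) (f : T * R -> R) :
  (forall y, measurable_fun setT (fun x => f (x, y))) ->
  (forall x, continuous (fun y => f (x, y))) ->
  measurable_fun setT f.
Proof.
move=> mf cf.
pose q (n : nat) (y : R) : R := (Num.floor (y * n.+1%:R))%:~R / n.+1%:R.
pose g (n : nat) (z : T * R) := f (z.1, q n z.2).
apply/measurable_EFinP; apply: (emeasurable_fun_cvg (fun n z => (g n z)%:E)).
- move=> n; apply/measurable_EFinP => _ A mA; rewrite setTI.
  have -> : g n @^-1` A = \bigcup_(k : int)
     (((fun x => f (x, k%:~R / n.+1%:R)) @^-1` A) `*` [set y | Num.floor (y * n.+1%:R) = k]).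
    apply/seteqP; split => [[x y] /= Axy|[x y] [k _ [/= Ax ky]]].
      by exists (Num.floor (y * n.+1%:R)).
    by rewrite /g /q /= ky.
  apply: countable_bigcupT_measurable => [|k]; [exact: countableP|apply: measurableX].
    by rewrite -[X in measurable X]setTI; exact: mf.
  rewrite (_ : [set y | _] = `[k%:~R / n.+1%:R, (k + 1)%:~R / n.+1%:R[%classic) //.
  apply/seteqP; split => y /=; rewrite in_itv /= ler_pdivrMr// ltr_pdivlMr//.
    by move=> <-; exact: floor_itv.
  exact: floor_def.
- move=> [x y] _; apply: cvg_EFin; first exact: nearW.
  rewrite /g /=.
  apply: (@continuous_cvg _ _ _ _ _ (fun n => q n y) (fun y => f (x, y))) => //; first exact: cf.
  apply/cvgrPdist_le => e e0; near=> n.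
  have /andP[h1 h2] := floor_itv (y * n.+1%:R).
  have n0 : 0 < n.+1%:R :> R by [].
  have ne : n.+1%:R^-1 < e by near: n; exact: near_infty_natSinv_lt (PosNum e0).
  rewrite /q ger0_norm; last by rewrite subr_ge0 ler_pdivrMr.
  rewrite lerBlDr -(ler_pM2r n0) mulrDl divfK ?lt0r_neq0//.
  apply: (le_trans (ltW h2)); rewrite intrD1 addrC lerD2r.
  by rewrite -ler_pdivrMr// div1r ltW.
Unshelve. all: by end_near. Qed.

Lemma continuous_measurable2 (f : R * R -> R) : continuous f -> measurable_fun setT f.
Proof.
move=> cf; apply: caratheodory_measurable.
  move=> y; apply: continuous_measurable_fun => x.
  by apply: (@continuous_cvg _ _ _ _ _ (fun x => (x, y)) f); [exact: cf|exact: (cvg_pair cvg_id (cvg_cst _))].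
move=> x y.
by apply: (@continuous_cvg _ _ _ _ _ (fun y => (x, y)) f); [exact: cf|exact: (cvg_pair (cvg_cst _) cvg_id)].
Qed.

Lemma continuous_measurable3 (f : R * R * R -> R) : continuous f -> measurable_fun setT f.
Proof.
move=> cf; apply: caratheodory_measurable.
  move=> y; apply: continuous_measurable2 => x.
  by apply: (@continuous_cvg _ _ _ _ _ (fun x => (x, y)) f); [exact: cf|exact: (cvg_pair cvg_id (cvg_cst _))].
move=> x y.
by apply: (@continuous_cvg _ _ _ _ _ (fun y => (x, y)) f); [exact: cf|exact: (cvg_pair (cvg_cst _) cvg_id)].
Qed.

Section Fubini.
Context d1 d2 (T1 : measurableType d1) (T2 : measurableType d2).
Variables (m1 : {sigma_finite_measure set T1 -> \bar R}).
Variables (m2 : {sigma_finite_measure set T2 -> \bar R}).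
Variables (A : set T1) (B : set T2).
Hypotheses (mA : measurable A) (mB : measurable B).
Hypotheses (fA : (m1 A < +oo)%E) (fB : (m2 B < +oo)%E).
Variables (f : T1 * T2 -> R) (M : R).
Hypotheses (mf : measurable_fun setT f) (bf : forall z, `|f z| <= M).

Lemma bounded_integrable_section d (T : measurableType d)
    (m : {measure set T -> \bar R}) (C : set T) (g : T -> R) (N : R) :
  measurable C -> (m C < +oo)%E -> measurable_fun C g -> (forall z, `|g z| <= N) ->
  m.-integrable C (EFin \o g).
Proof.
move=> mC fC mg bg; apply: measurable_bounded_integrable => //.
exists N; split; first exact: num_real.
by move=> r Nr z _ /=; rewrite (le_trans (bg z))// ltW.
Qed.

Lemma measurable_section1 x : measurable_fun setT (fun y => f (x, y)).
Proof. exact: measurable_fun_pair2. Qed.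

Lemma measurable_section2 y : measurable_fun setT (fun x => f (x, y)).
Proof. exact: measurable_fun_pair1. Qed.

Lemma measurable_Rintegral_param :
  measurable_fun setT (fun x => \int[m2]_(y in B) f (x, y)).
Proof.
pose g (z : T1 * T2) : \bar R := ((f z + M) * \1_B z.2)%:E.
have g0 z : (0 <= g z)%E.
  by rewrite lee_fin mulr_ge0// -lerBlDr sub0r; have := bf z; rewrite ler_norml => /andP[].
have mg : measurable_fun setT g.
  apply/measurable_EFinP; apply: measurable_funM.
    by apply: measurable_funD => //; exact: measurable_cst.
  by apply: measurableT_comp => //; exact: measurable_indic.
have H := measurable_fun_fubini_tonelli_F (m2 := m2) g mg g0.
have E : (fun x => \int[m2]_(y in B) f (x, y)) =
    (fun x => fine (\int[m2]_y g (x, y))%E - M * fine (m2 B)).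
  apply/funext => x.
  have -> : (\int[m2]_y g (x, y) = \int[m2]_(y in B) (f (x, y) + M)%:E)%E.
    rewrite [RHS]integral_mkcond; apply: eq_integral => y _.
    by rewrite /g patchE indicE; case: (y \in B); rewrite ?mulr1 ?mulr0.
  rewrite -[fine _]/(Rintegral m2 B (fun y => f (x, y) + M)).
  rewrite RintegralD//; last 2 first.
  - apply: (@bounded_integrable_section _ _ _ _ _ M) => //.
    by apply: measurable_funTS; exact: measurable_section1.
  - by apply: (@bounded_integrable_section _ _ _ _ (cst M) `|M|).
  by rewrite Rintegral_cst// addrK.
rewrite E; apply: measurable_funB; last exact: measurable_cst.
by apply: measurableT_comp H; exact: fine_measurable.
Qed.

Lemma Rintegral_swap :
  \int[m1]_(x in A) \int[m2]_(y in B) f (x, y) =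
  \int[m2]_(y in B) \int[m1]_(x in A) f (x, y).
Proof.
pose g := ((EFin \o f) \_ (A `*` B))%E.
have ig : (m1 \x m2)%E.-integrable setT g.
  apply/(integrable_mkcond (EFin \o f) (measurableX mA mB)).
  apply: (@bounded_integrable_section _ _ _ _ _ M) => //.
  - exact: measurableX.
  - by rewrite /= product_measure1E// lte_mul_pinfty// ge0_fin_numE.
  - exact: measurable_funTS.
have H := Fubini ig.
have gE x y : g (x, y) = if (x \in A) && (y \in B) then (f (x, y))%:E else 0%E.
  rewrite /g patchE; congr (if _ then _ else _).
  by apply/idP/andP; rewrite !inE.
have int1 x : m2.-integrable B (EFin \o (fun y => f (x, y))).
  apply: (@bounded_integrable_section _ _ _ _ _ M) => //.
  by apply: measurable_funTS; exact: measurable_section1.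
have int2 y : m1.-integrable A (EFin \o (fun x => f (x, y))).
  apply: (@bounded_integrable_section _ _ _ _ _ M) => //.
  by apply: measurable_funTS; exact: measurable_section2.
have E1 : (\int[m1]_x \int[m2]_y g (x, y) =
    \int[m1]_(x in A) (\int[m2]_(y in B) f (x, y))%R%:E)%E.
  rewrite [RHS]integral_mkcond; apply: eq_integral => x _; rewrite patchE.
  case: ifPn => xA; last first.
    by under eq_integral do rewrite gE (negbTE xA); rewrite integral0.
  rewrite /Rintegral fineK; last exact: (integrable_fin_num mB (int1 x)).
  rewrite [RHS]integral_mkcond; apply: eq_integral => y _.
  by rewrite patchE gE xA.
have E2 : (\int[m2]_y \int[m1]_x g (x, y) =
    \int[m2]_(y in B) (\int[m1]_(x in A) f (x, y))%R%:E)%E.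
  rewrite [RHS]integral_mkcond; apply: eq_integral => y _; rewrite patchE.
  case: ifPn => yB; last first.
    by under eq_integral do rewrite gE (negbTE yB) andbF; rewrite integral0.
  rewrite /Rintegral fineK; last exact: (integrable_fin_num mA (int2 y)).
  rewrite [RHS]integral_mkcond; apply: eq_integral => x _.
  by rewrite patchE gE yB andbT.
by rewrite {1}/Rintegral [RHS]/Rintegral -E1 -E2 H.
Qed.
End Fubini.
End Measurability.

Section ParametricIntegrals.
Context {R : realType}.
Notation mu := (@lebesgue_measure R).
Notation integ a b f := (\int[mu]_(x in `[a, b]) f x).

Lemma lebesgue_itv_fin (a b : R) : (mu `[a, b]%classic < +oo)%E.
Proof. by rewrite lebesgue_measure_itv /=; case: ifP => _; rewrite ?ltry. Qed.

Lemma lebesgue_itv_length (a b : R) : a <= b -> fine (mu `[a, b]%classic) = b - a.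
Proof.
move=> ab; rewrite lebesgue_measure_itv /= lte_fin; case: ifPn => //=.
by rewrite -leNgt => ba; apply/eqP; rewrite eq_sym subr_eq0 eq_le ab ba.
Qed.

Lemma continuous_itv_integrable (a b : R) (f : R -> R) : continuous f ->
  mu.-integrable `[a, b] (EFin \o f).
Proof.
move=> cf; apply: continuous_compact_integrable; first exact: segment_compact.
exact: continuous_subspaceT.
Qed.

Lemma continuous_slice2 (T U W : topologicalType) (F : T -> U -> W) t :
  continuous (fun z : T * U => F z.1 z.2) -> continuous (F t).
Proof.
move=> cF x; have H : (fun y => (t, y)) @ x --> (t, x).
  exact: (cvg_pair (cvg_cst _) cvg_id).
exact: (@continuous_comp _ _ _ (fun y => (t, y)) (fun z : T * U => F z.1 z.2) x H (cF (t, x))).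
Qed.

Lemma continuous_slice1 (T U W : topologicalType) (F : T -> U -> W) x :
  continuous (fun z : T * U => F z.1 z.2) -> continuous (F ^~ x).
Proof.
move=> cF t; have H : (fun y => (y, x)) @ t --> (t, x).
  exact: (cvg_pair cvg_id (cvg_cst _)).
exact: (@continuous_comp _ _ _ (fun y => (y, x)) (fun z : T * U => F z.1 z.2) t H (cF (t, x))).
Qed.

Lemma continuous_Rintegral_param (T : topologicalType) (F : T -> R -> R) (a b : R) :
  a <= b -> continuous (fun z : T * R => F z.1 z.2) ->
  continuous (fun t => integ a b (F t)).
Proof.
move=> ab cF t.
have ba0 : 0 < b - a + 1 by rewrite ltr_wpDl ?subr_ge0.
apply/cvgrPdist_le => e e0.
pose e' := e / (b - a + 1).
have e'0 : 0 < e' by rewrite divr_gt0.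
have H : \forall s \near t, `[a, b] `<=` [set x | `|F t x - F s x| <= e'].
  have /compact_near_coveringP cK := @segment_compact R a b.
  apply: (cK _ _ (fun s x => `|F t x - F s x| <= e')) => x xK.
  have e2 : 0 < e' / 2 by rewrite divr_gt0.
  have h1 : \forall y \near x, `|F t x - F t y| <= e' / 2.
    by have /cvgrPdist_le := continuous_slice2 _ _ _ F t cF x; apply.
  have h2 : \forall z \near (t, x), `|F t x - F z.1 z.2| <= e' / 2.
    by have /cvgrPdist_le := cF (t, x); apply.
  case: h2 => -[P Q] [/= Pt Qx] PQ.
  exists (Q `&` [set y | `|F t x - F t y| <= e' / 2], P) => /=.
    by split => //; exact: filterI.
  move=> [y s] [/= [Qy hy] Ps].
  have := PQ (s, y) (conj Ps Qy); rewrite /= => h3.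
  rewrite (_ : F t y - F s y = (F t x - F s y) - (F t x - F t y)); last by ring.
  apply: (le_trans (ler_normB _ _)); apply: (le_trans (lerD h3 hy)); lra.
near=> s.
have Hs : forall x, a <= x <= b -> `|F t x - F s x| <= e'.
  have : `[a, b] `<=` [set x | `|F t x - F s x| <= e'] by near: s.
  by move=> h x xab; apply: h; rewrite /= in_itv.
have it u := continuous_itv_integrable a b _ (continuous_slice2 _ _ _ F u cF).
rewrite -RintegralB//.
have cB : continuous (fun x => F t x - F s x).
  by move=> x; apply: cvgB; exact: continuous_slice2.
have iB := continuous_itv_integrable a b _ cB.
apply: (le_trans (le_normr_Rintegral _ iB)) => //.
apply: (@le_trans _ _ (integ a b (cst e'))).
  apply: le_Rintegral => //.
  - by apply: continuous_itv_integrable => x; apply: cvg_norm; exact: cB.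
  - by apply: continuous_itv_integrable => x; exact: cvg_cst.
rewrite Rintegral_cst// [X in e' * X](_ : _ = b - a); last exact: lebesgue_itv_length.
rewrite /e' mulrAC ler_pdivrMr// ler_wpM2l// ?ltW//; lra.
Unshelve. all: by end_near. Qed.

Lemma rectangle_bounded (F : R -> R -> R) (a b c d : R) :
  continuous (fun z : R * R => F z.1 z.2) ->
  exists2 M : R, 0 <= M & forall x y, a <= x <= b -> c <= y <= d -> `|F x y| <= M.
Proof.
move=> cF; pose K := (`[a, b] `*` `[c, d])%classic : set (R * R).
have cK : compact K by apply: compact_setX; exact: segment_compact.
have ck : {within K, continuous (fun z : R * R => F z.1 z.2)}.
  exact: continuous_subspaceT.
have [M [Mr HM]] := compact_bounded (continuous_compact ck cK).
exists (`|M| + 1); first by rewrite addr_ge0.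
move=> x y xab ycd; apply: (HM (`|M| + 1)).
  by rewrite ltr_pwDr// ler_norm.
by exists (x, y) => //; split; rewrite /= in_itv.
Qed.

Lemma is_derive_Rintegral_param (F F' : R -> R -> R) (a b s l u : R) :
  l < s < u ->
  continuous (fun z : R * R => F z.1 z.2) -> continuous (fun z : R * R => F' z.1 z.2) ->
  (forall t x, l < t < u -> is_derive t (1 : R) (F ^~ x) (F' t x)) ->
  is_derive s (1 : R) (fun t => integ a b (F t)) (integ a b (F' s)).
Proof.
move=> sI cF cF' dF.
have [M M0 HM] := rectangle_bounded F' l u a b cF'.
have Is : (`]l, u[%classic : set R) s by rewrite /= in_itv.
have d1E t x : (`]l, u[%classic : set R) t -> partial1of2 F t x = F' t x.
  rewrite /= in_itv /= => tI; have := dF t x tI => -[_].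
  by rewrite -derive1E.
have it t := continuous_itv_integrable a b _ (continuous_slice2 _ _ _ F t cF).
have dr t x : (`]l, u[%classic : set R) t -> (`[a, b]%classic : set R) x -> derivable (F ^~ x) t 1.
  by rewrite /= in_itv /= => tI _; exact: (@ex_derive _ _ _ _ _ _ _ (dF t x tI)).
have bd t x : (`]l, u[%classic : set R) t -> (`[a, b]%classic : set R) x ->
    `|partial1of2 F t x| <= M.
  move=> tI xI; rewrite d1E//; move: tI xI; rewrite /= !in_itv /= => /andP[lt tu] xI.
  by apply: HM => //; rewrite !ltW.
have L := @cvg_differentiation_under_integral R _ _ mu F `[a, b] (measurable_itv _) s l u Is
  (fun t _ => it t) dr (cst M) (fun _ => M0)
  (continuous_itv_integrable a b _ (fun x => cvg_cst _)) bd.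
have E : \int[mu]_(y in `[a, b]) partial1of2 F s y = integ a b (F' s).
  by apply: eq_Rintegral => x _; rewrite d1E.
rewrite E in L.
have L' : h^-1 *: (((fun t => integ a b (F t)) \o shift s) (h *: (1 : R)) - integ a b (F s))
   @[h --> 0^'] --> integ a b (F' s).
  rewrite (_ : (fun h : R => h^-1 *: _) = (fun h => h^-1 *: (integ a b (F (h + s)) - integ a b (F s)))).
    exact: L.
  by apply/funext => h /=; rewrite scaler1.
split; first by apply/cvg_ex; eexists; exact: L'.
exact: cvg_lim.
Qed.

Lemma Rintegral_FTC_oo (f F : R -> R) (a b : R) : a < b -> continuous f ->
  continuous F -> (forall x, a < x < b -> is_derive x (1 : R) F (f x)) ->
  integ a b f = F b - F a.
Proof.
move=> ab cf cF dF; rewrite /Rintegral (@continuous_FTC2 _ f F)//.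
- exact: continuous_subspaceT.
- split; first by move=> x; rewrite in_itv /= => xI; exact: (@ex_derive _ _ _ _ _ _ _ (dF x xI)).
  + by apply: cvg_at_right_filter; exact: cF.
  + by apply: cvg_at_left_filter; exact: cF.
- by move=> x; rewrite in_itv /= => xI; rewrite derive1E; have [_ ->] := dF x xI.
Qed.

Lemma Rintegral_FTC (f F : R -> R) (a b : R) : a < b -> continuous f ->
  (forall x, is_derive x (1 : R) F (f x)) ->
  integ a b f = F b - F a.
Proof.
move=> ab cf dF; apply: Rintegral_FTC_oo => // x.
exact: is_derive_continuous (dF x).
Qed.

Definition clip (a b x : R) := Num.max a (Num.min x b).

Lemma clip_id (a b x : R) : a <= x <= b -> clip a b x = x.
Proof. by move=> /andP[ax xb]; rewrite /clip min_l// max_r. Qed.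

Lemma clip_itv (a b x : R) : a <= b -> a <= clip a b x <= b.
Proof. by move=> ab; rewrite /clip le_max lexx ge_max ab ge_min lexx orbT. Qed.

Lemma continuous_clip (a b : R) : continuous (clip a b).
Proof.
move=> x.
have H1 : {for x, continuous ((idfun : R -> R) \min cst b)}.
  by apply: continuous_min; [exact: cvg_id|exact: cvg_cst].
have H2 : {for x, continuous (cst a \max ((idfun : R -> R) \min cst b))}.
  by apply: continuous_max; [exact: cvg_cst|exact: H1].
have H3 : (fun y => Num.max a (Num.min y b)) @ x --> Num.max a (Num.min x b) by exact: H2.
exact: H3.
Qed.

Lemma Rintegral_swap_continuous (F : R -> R -> R) (a b c d : R) :
  a <= b -> c <= d -> continuous (fun z : R * R => F z.1 z.2) ->
  \int[mu]_(x in `[a, b]) \int[mu]_(y in `[c, d]) F x y =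
  \int[mu]_(y in `[c, d]) \int[mu]_(x in `[a, b]) F x y.
Proof.
move=> ab cd cF.
pose f (z : R * R) := F (clip a b z.1) (clip c d z.2).
have cf : continuous f.
  move=> z.
  have h1 : {for z, continuous (fun z : R * R => clip a b z.1)}.
    by apply: (@continuous_comp _ _ _ fst (clip a b)); [exact: cvg_fst|exact: continuous_clip].
  have h2 : {for z, continuous (fun z : R * R => clip c d z.2)}.
    by apply: (@continuous_comp _ _ _ snd (clip c d)); [exact: cvg_snd|exact: continuous_clip].
  have h3 : {for z, continuous (fun z : R * R => (clip a b z.1, clip c d z.2))}.
    exact: (cvg_pair h1 h2).
  exact: (@continuous_comp _ _ _ _ (fun z : R * R => F z.1 z.2) z h3 (cF _)).
have [M M0 HM] := rectangle_bounded F a b c d cF.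
have H := @Rintegral_swap R _ _ _ _ mu mu `[a, b]%classic `[c, d]%classic
  (measurable_itv _) (measurable_itv _) (lebesgue_itv_fin _ _) (lebesgue_itv_fin _ _) f M
  (continuous_measurable2 _ cf) (fun z => HM _ _ (clip_itv _ _ _ ab) (clip_itv _ _ _ cd)).
transitivity (\int[mu]_(x in `[a, b]) \int[mu]_(y in `[c, d]) f (x, y)).
  apply: eq_Rintegral => x; rewrite inE /= in_itv /= => xI.
  apply: eq_Rintegral => y; rewrite inE /= in_itv /= => yI.
  by rewrite /f /= !clip_id.
rewrite H.
apply: eq_Rintegral => y; rewrite inE /= in_itv /= => yI.
apply: eq_Rintegral => x; rewrite inE /= in_itv /= => xI.
by rewrite /f /= !clip_id.
Qed.
End ParametricIntegrals.

(** * Integrals over the sphere *)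

Section Sphere.
Context {R : realType}.
Local Notation V := (R * R * R)%type.

Definition Aint (f : R -> R -> R) : R :=
  \int[leb1 R]_(a in `[0, pi]) \int[leb1 R]_(b in `[0, pi *+ 2]) f a b.

Definition om (i : 'I_3) (a b : R) : R :=
  if i == 0 :> nat then sin a * cos b else if i == 1 :> nat then sin a * sin b else cos a.

Definition sp (r a b : R) : V :=
  (r * (sin a * cos b), r * (sin a * sin b), r * cos a).

Lemma pi0 : 0 <= pi :> R. Proof. exact: pi_ge0. Qed.
Lemma pi20 : 0 <= pi *+ 2 :> R. Proof. by rewrite mulrn_wge0// pi_ge0. Qed.

Lemma continuous_inner (T : topologicalType) (F : T -> R -> R -> R) :
  continuous (fun z : T * R * R => F z.1.1 z.1.2 z.2) ->
  continuous (fun z : T * R => \int[leb1 R]_(b in `[0, pi *+ 2]) F z.1 z.2 b).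
Proof.
move=> cF; exact: (continuous_Rintegral_param (T * R)%type (fun z b => F z.1 z.2 b) _ _ pi20 cF).
Qed.

Lemma continuous_Aint (T : topologicalType) (F : T -> R -> R -> R) :
  continuous (fun z : T * R * R => F z.1.1 z.1.2 z.2) ->
  continuous (fun t => Aint (F t)).
Proof.
move=> cF; exact: (continuous_Rintegral_param T (fun t a => \int[leb1 R]_(b in `[0, pi *+ 2]) F t a b) _ _ pi0 (continuous_inner _ _ cF)).
Qed.

Lemma is_derive_Aint (F F' : R -> R -> R -> R) (s l u : R) : l < s < u ->
  continuous (fun z : R * R * R => F z.1.1 z.1.2 z.2) ->
  continuous (fun z : R * R * R => F' z.1.1 z.1.2 z.2) ->
  (forall t a b, l < t < u -> is_derive t (1 : R) (fun t => F t a b) (F' t a b)) ->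
  is_derive s (1 : R) (fun t => Aint (F t)) (Aint (F' s)).
Proof.
move=> sI cF cF' dF.
apply: (is_derive_Rintegral_param (fun t a => \int[leb1 R]_(b in `[0, pi *+ 2]) F t a b)
  (fun t a => \int[leb1 R]_(b in `[0, pi *+ 2]) F' t a b) _ _ _ _ _ sI).
- exact: continuous_inner.
- exact: continuous_inner.
move=> t a tI.
have sl (G : R -> R -> R -> R) : continuous (fun z : R * R * R => G z.1.1 z.1.2 z.2) ->
    continuous (fun z : R * R => G z.1 a z.2).
  move=> cG z.
  have h : (fun z : R * R => (z.1, a, z.2)) @ z --> (z.1, a, z.2).
    have h1 : (fun z : R * R => z.1) @ z --> z.1 by exact: cvg_fst.
    have h2 : (fun z : R * R => z.2) @ z --> z.2 by exact: cvg_snd.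
    have h3 : (fun z : R * R => a) @ z --> a by exact: cvg_cst.
    exact: (cvg_pair (cvg_pair h1 h3) h2).
  exact: (@continuous_comp _ _ _ (fun z : R * R => (z.1, a, z.2)) (fun z : R * R * R => G z.1.1 z.1.2 z.2) z h (cG _)).
apply: (is_derive_Rintegral_param (fun t b => F t a b) (fun t b => F' t a b) _ _ _ _ _ tI).
- exact: sl.
- exact: sl.
Qed.

Lemma is_derive_Aint_global (F F' : R -> R -> R -> R) (s : R) :
  continuous (fun z : R * R * R => F z.1.1 z.1.2 z.2) ->
  continuous (fun z : R * R * R => F' z.1.1 z.1.2 z.2) ->
  (forall t a b, is_derive t (1 : R) (fun t => F t a b) (F' t a b)) ->
  is_derive s (1 : R) (fun t => Aint (F t)) (Aint (F' s)).
Proof.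
move=> cF cF' dF; apply: (@is_derive_Aint _ _ s (s - 1) (s + 1)) => //.
by apply/andP; split; lra.
Qed.

Definition cont2 (f : R -> R -> R) := continuous (fun z : R * R => f z.1 z.2).

Lemma cont2_inner f : cont2 f -> continuous (fun a => \int[leb1 R]_(b in `[0, pi *+ 2]) f a b).
Proof. by move=> cf; apply: continuous_Rintegral_param => //; exact: pi20. Qed.

Lemma AintD f g : cont2 f -> cont2 g ->
  Aint (fun a b => f a b + g a b) = Aint f + Aint g.
Proof.
move=> cf cg; rewrite /Aint -RintegralD//; last 2 first.
- by apply: continuous_itv_integrable; exact: cont2_inner.
- by apply: continuous_itv_integrable; exact: cont2_inner.
apply: eq_Rintegral => a _; rewrite RintegralD//.
- by apply: continuous_itv_integrable; exact: continuous_slice2 cf.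
- by apply: continuous_itv_integrable; exact: continuous_slice2 cg.
Qed.

Lemma AintZ (k : R) f : cont2 f -> Aint (fun a b => k * f a b) = k * Aint f.
Proof.
move=> cf; rewrite /Aint -RintegralZl//; last first.
  by apply: continuous_itv_integrable; exact: cont2_inner.
apply: eq_Rintegral => a _; rewrite RintegralZl//.
by apply: continuous_itv_integrable; exact: continuous_slice2 cf.
Qed.

Lemma cont2D f g : cont2 f -> cont2 g -> cont2 (fun a b => f a b + g a b).
Proof. by move=> cf cg z; apply: cvgD; [exact: cf|exact: cg]. Qed.

Lemma eq_Aint f g : (forall a b, f a b = g a b) -> Aint f = Aint g.
Proof. by move=> fg; congr Aint; apply/funext => a; apply/funext => b. Qed.

Lemma Aint_derive_b (Q q : R -> R -> R) : cont2 q ->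
  (forall a b, is_derive b (1 : R) (Q a) (q a b)) ->
  (forall a, Q a (pi *+ 2) = Q a 0) -> Aint q = 0.
Proof.
move=> cq dQ Qp.
rewrite /Aint (_ : (fun a => _) = cst 0) ?Rintegral_cst ?mul0r//.
apply/funext => a; rewrite (@Rintegral_FTC _ (q a) (Q a)) ?Qp ?subrr//.
- by rewrite mulrn_wgt0// pi_gt0.
- exact: continuous_slice2 cq.
Qed.

Lemma Aint_derive_a (Q q : R -> R -> R) : cont2 q ->
  (forall a b, is_derive a (1 : R) (Q ^~ b) (q a b)) ->
  (forall b, Q pi b = Q 0 b) -> Aint q = 0.
Proof.
move=> cq dQ Qp.
rewrite /Aint Rintegral_swap_continuous ?pi_ge0 ?pi20//.
rewrite (_ : (fun b => _) = cst 0) ?Rintegral_cst ?mul0r//.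
apply/funext => b; rewrite (@Rintegral_FTC _ (q ^~ b) (Q ^~ b)) ?Qp ?subrr//.
- exact: pi_gt0.
- exact: continuous_slice1 cq.
Qed.

Lemma cvg_sin (T : Type) (F : set_system T) (FF : Filter F) (f : T -> R) (l : R) :
  f @ F --> l -> (fun x => sin (f x)) @ F --> sin l.
Proof. by move=> fl; apply: (@continuous_cvg _ _ _ F FF f sin) => //; exact: continuous_sin. Qed.

Lemma cvg_cos (T : Type) (F : set_system T) (FF : Filter F) (f : T -> R) (l : R) :
  f @ F --> l -> (fun x => cos (f x)) @ F --> cos l.
Proof. by move=> fl; apply: (@continuous_cvg _ _ _ F FF f cos) => //; exact: continuous_cos. Qed.

Lemma cvg_sp (T : Type) (F : set_system T) (FF : Filter F) (r a b : T -> R) (r0 a0 b0 : R) :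
  r @ F --> r0 -> a @ F --> a0 -> b @ F --> b0 ->
  (fun x => sp (r x) (a x) (b x)) @ F --> sp r0 a0 b0.
Proof.
move=> hr ha hb.
have h1 : (fun x => r x * (sin (a x) * cos (b x))) @ F --> r0 * (sin a0 * cos b0).
  by apply: cvgM => //; apply: cvgM; [exact: cvg_sin|exact: cvg_cos].
have h2 : (fun x => r x * (sin (a x) * sin (b x))) @ F --> r0 * (sin a0 * sin b0).
  by apply: cvgM => //; apply: cvgM; exact: cvg_sin.
have h3 : (fun x => r x * cos (a x)) @ F --> r0 * cos a0.
  by apply: cvgM => //; exact: cvg_cos.
exact: (cvg_pair (cvg_pair h1 h2) h3).
Qed.

Lemma cvg_om (T : Type) (F : set_system T) (FF : Filter F) i (a b : T -> R) (a0 b0 : R) :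
  a @ F --> a0 -> b @ F --> b0 ->
  (fun x => om i (a x) (b x)) @ F --> om i a0 b0.
Proof.
move=> ha hb; move: i; apply: ord3P; rewrite /om /=.
- by apply: cvgM; [exact: cvg_sin|exact: cvg_cos].
- by apply: cvgM; exact: cvg_sin.
- exact: cvg_cos.
Qed.

Definition has_grad (g : V -> R) (g_ : 'I_3 -> V -> R) :=
  [/\ continuous g, forall i, continuous (g_ i) &
   forall (gam : R -> V) (dgam : 'I_3 -> R) (x : R),
    (forall i, is_derive x (1 : R) (fun t => coord (gam t) i) (dgam i)) ->
    is_derive x (1 : R) (fun t => g (gam t)) (\sum_(i < 3) dgam i * g_ i (gam x))].

End Sphere.

(* A head symbol for the tactic [rc] to match on. *)
Definition rcont {R : realType} {T : topologicalType} (f : T -> R) : Prop :=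
  continuous f.

Section Rcont.
Context {R : realType} {T : topologicalType}.
Implicit Types f g : T -> R.

Lemma rcontD f g : rcont f -> rcont g -> rcont (fun x => f x + g x).
Proof. by move=> cf cg x; apply: cvgD; [exact: cf|exact: cg]. Qed.

Lemma rcontM f g : rcont f -> rcont g -> rcont (fun x => f x * g x).
Proof. by move=> cf cg x; apply: cvgM; [exact: cf|exact: cg]. Qed.

Lemma rcontN f : rcont f -> rcont (fun x => - f x).
Proof. by move=> cf x; apply: cvgN; exact: cf. Qed.

Lemma rcont_cst (k : R) : rcont (fun _ : T => k).
Proof. by move=> x; exact: cvg_cst. Qed.

Lemma rcont_sin f : rcont f -> rcont (fun x => sin (f x)).
Proof. by move=> cf x; apply: cvg_sin; exact: cf. Qed.

Lemma rcont_cos f : rcont f -> rcont (fun x => cos (f x)).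
Proof. by move=> cf x; apply: cvg_cos; exact: cf. Qed.

Lemma rcont_om i f g : rcont f -> rcont g -> rcont (fun x => om i (f x) (g x)).
Proof. by move=> cf cg x; apply: cvg_om; [exact: cf|exact: cg]. Qed.

End Rcont.

Lemma rcont_fst {R : realType} {U : topologicalType} : rcont (fun z : R * U => z.1).
Proof. by move=> z; exact: cvg_fst. Qed.

Lemma rcont_snd {R : realType} {U : topologicalType} : rcont (fun z : U * R => z.2).
Proof. by move=> z; exact: cvg_snd. Qed.

Lemma rcont_id {R : realType} : rcont (fun z : R => z).
Proof. by move=> z; exact: cvg_id. Qed.

Lemma rcont_fst1 {R : realType} {U : topologicalType} : rcont (fun z : R * R * U => z.1.1).
Proof. by move=> z; apply: (@continuous_comp _ _ _ fst fst); exact: cvg_fst. Qed.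

Lemma rcont_fst2 {R : realType} {U : topologicalType} : rcont (fun z : R * R * U => z.1.2).
Proof.
by move=> z; apply: (@continuous_comp _ _ _ fst snd); [exact: cvg_fst|exact: cvg_snd].
Qed.

Ltac rc := lazymatch goal with
  | |- rcont (fun _ => ?k) => exact (rcont_cst k)
  | |- rcont (fun z => fst (fst z)) => exact rcont_fst1
  | |- rcont (fun z => snd (fst z)) => exact rcont_fst2
  | |- rcont (fun z => fst z) => exact rcont_fst
  | |- rcont (fun z => snd z) => exact rcont_snd
  | |- rcont (fun z => z) => exact rcont_id
  | |- rcont (fun z => @GRing.add _ (@?f z) (@?g z)) => apply (@rcontD _ _ f g); cbv beta; rc
  | |- rcont (fun z => @GRing.mul _ (@?f z) (@?g z)) => apply (@rcontM _ _ f g); cbv beta; rc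
  | |- rcont (fun z => @GRing.opp _ (@?f z)) => apply (@rcontN _ _ f); cbv beta; rc
  | |- rcont (fun z => sin (@?f z)) => apply (@rcont_sin _ _ f); cbv beta; rc
  | |- rcont (fun z => cos (@?f z)) => apply (@rcont_cos _ _ f); cbv beta; rc
  | |- rcont (fun z => om ?i (@?f z) (@?g z)) => apply (@rcont_om _ _ i f g); cbv beta; rc
  | _ => match goal with H : ?P |- ?P => exact H | H : forall j, _ |- _ => exact (H _) end
  end.

Section TangentialDivergence.
Context {R : realType}.
Local Notation V := (R * R * R)%type.

Lemma has_grad_distr (T : @functional R) chi : is_distribution T -> is_test chi ->
  has_grad (fun h => T (tr h chi)) (fun i h => T (tr h (partial i chi))).
Proof.
move=> dT tc.
have cT f : is_test f -> continuous (fun h => T (tr h f)).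
  move=> tf h.
  have h1 : {for h, continuous (fun _ : V => 0 : R)} by exact: cvg_cst.
  have h2 : {for h, continuous (fun k : V => k)} by exact: cvg_id.
  exact: (continuous_translate (fun _ => T) f _ _ _ h (cst_cont_family _ dT) tf h1 h2).
split; first exact: cT.
- by move=> i; apply: cT; exact: (is_test_partials [:: i]).
- by move=> gam dgam x dg; exact: is_derive_distr_translate.
Qed.

Lemma has_grad_zmul (g : V -> R) (g_ : 'I_3 -> V -> R) : has_grad g g_ ->
  has_grad (fun h => h.2 * g h)
    (fun i h => h.2 * g_ i h + (if i == 2 :> nat then g h else 0)).
Proof.
move=> [cg cg_ dg]; split.
- by move=> h; apply: cvgM; [exact: cvg_snd|exact: cg].
- move=> i h; apply: cvgD.
    by apply: cvgM; [exact: cvg_snd|exact: cg_].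
  by case: ifP => _; [exact: cg|exact: cvg_cst].
move=> gam dgam x d.
have d2 : is_derive x (1 : R) (fun t => (gam t).2) (dgam c2) := d c2.
have dG := dg gam dgam x d.
apply: (is_derive_eq (is_deriveMf _ _ _ _ _ d2 dG)).
rewrite !sum3 /=.
by move: (gam x).2 (g_ _ _) (g_ _ _) (g_ _ _) (g _) => *; ring.
Qed.

Definition da (r a b : R) (i : 'I_3) : R :=
  if i == 0 :> nat then r * (cos a * cos b)
  else if i == 1 :> nat then r * (cos a * sin b) else - (r * sin a).

Definition db (r a b : R) (i : 'I_3) : R :=
  if i == 0 :> nat then - (r * (sin a * sin b))
  else if i == 1 :> nat then r * (sin a * cos b) else 0.

Lemma is_derive_sp_a r b (a : R) i :
  is_derive a (1 : R) (fun t => coord (sp r t b) i) (da r a b i).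
Proof.
move: i; apply: ord3P; rewrite /coord /sp /da /=;
  apply: is_derive_eq; rewrite -!/(_ *: _) /GRing.scale /=; ring.
Qed.

Lemma is_derive_sp_b r a (b : R) i :
  is_derive b (1 : R) (fun t => coord (sp r a t) i) (db r a b i).
Proof.
move: i; apply: ord3P; rewrite /coord /sp /db /=;
  apply: is_derive_eq; rewrite -!/(_ *: _) /GRing.scale /=; ring.
Qed.

Lemma is_derive_sp_r (r a b : R) i :
  is_derive r (1 : R) (fun t => coord (sp t a b) i) (om i a b).
Proof.
move: i; apply: ord3P; rewrite /coord /sp /om /=;
  apply: is_derive_eq; rewrite -!/(_ *: _) /GRing.scale /=; ring.
Qed.

Lemma continuous_sp_comp (g : V -> R) (T : topologicalType) (r a b : T -> R) (z : T) :
  continuous g -> r x @[x --> z] --> r z -> a x @[x --> z] --> a z ->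
  b x @[x --> z] --> b z ->
  g (sp (r x) (a x) (b x)) @[x --> z] --> g (sp (r z) (a z) (b z)).
Proof.
move=> cg cr ca cb.
exact: (@continuous_comp _ _ _ (fun x => sp (r x) (a x) (b x)) g z (cvg_sp _ _ _ _ _ _ _ _ _ cr ca cb) (cg _)).
Qed.

Definition tangential (g : V -> R) (g_ : 'I_3 -> V -> R) i (r a b : R) : R :=
  sin a * (r * (g_ i (sp r a b) - om i a b * \sum_(j < 3) om j a b * g_ j (sp r a b))
    - 2 * om i a b * g (sp r a b)).

(* In spherical coordinates the integrand is d/da P + d/db Q for explicit P, Q:
   the divergence on the sphere of the tangential part of g e_i. *)
Lemma Aint_tangential (g : V -> R) (g_ : 'I_3 -> V -> R) i (r : R) : has_grad g g_ ->
  Aint (tangential g g_ i r) = 0.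
Proof.
move=> [cg cg_ dg].
have ga a b := dg (fun t => sp r t b) (da r a b) a (is_derive_sp_a r b a).
have gb a b := dg (fun t => sp r a t) (db r a b) b (is_derive_sp_b r a b).
pose G a b := g (sp r a b); pose H j a b := g_ j (sp r a b).
have cG : cont2 G.
  move=> z; apply: (continuous_sp_comp g _ (fun _ => r) fst snd z cg);
   [exact: cvg_cst|exact: cvg_fst|exact: cvg_snd].
have cH j : cont2 (H j).
  move=> z; apply: (continuous_sp_comp (g_ j) _ (fun _ => r) fst snd z (cg_ j));
   [exact: cvg_cst|exact: cvg_fst|exact: cvg_snd].
have trig1 a : cos a * cos a + sin a * sin a - 1 = 0 :> R.
  by rewrite -!expr2 cos2Dsin2 subrr.
have hG : rcont (fun z : R * R => G z.1 z.2) by exact: cG.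
have hH j : rcont (fun z : R * R => H j z.1 z.2) by exact: cH.
pose SH a b := r * (cos a * cos b) * H c0 a b + r * (cos a * sin b) * H c1 a b
  + (- (r * sin a)) * H c2 a b.
have {}ga a b : is_derive a (1 : R) (fun t => G t b) (SH a b).
  by have := ga a b; rewrite sum3.
pose SB a b := (- (r * (sin a * sin b))) * H c0 a b + r * (sin a * cos b) * H c1 a b.
have {}gb a b : is_derive b (1 : R) (fun t => G a t) (SB a b).
  by have := gb a b; rewrite sum3 /db /= mul0r addr0.
have hSH : rcont (fun z : R * R => SH z.1 z.2) by rewrite /SH; rc.
have hSB : rcont (fun z : R * R => SB z.1 z.2) by rewrite /SB; rc.
have step (q1 q2 Q1 Q2 : R -> R -> R) : cont2 q1 -> cont2 q2 ->
    (forall a b, is_derive a (1 : R) (Q1 ^~ b) (q1 a b)) ->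
    (forall a b, is_derive b (1 : R) (Q2 a) (q2 a b)) ->
    (forall b, Q1 pi b = Q1 0 b) -> (forall a, Q2 a (pi *+ 2) = Q2 a 0) ->
    (forall a b, tangential g g_ i r a b = q1 a b + q2 a b) -> Aint (tangential g g_ i r) = 0.
  move=> h1 h2 d1 d2 e1 e2 E; rewrite (eq_Aint _ _ E) AintD//.
  by rewrite (Aint_derive_a _ _ h1 d1 e1) (Aint_derive_b _ _ h2 d2 e2) addr0.
have Gper a : G a (pi *+ 2) = G a 0 by rewrite /G /sp cos2pi sin2pi cos0 sin0.
have TE k a b : k a b = om i a b -> tangential g g_ i r a b = sin a * (r * (H i a b - k a b *
   (sin a * cos b * H c0 a b + sin a * sin b * H c1 a b + cos a * H c2 a b)) - 2 * k a b * G a b).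
  by move=> ->; rewrite /tangential sum3.
move: i step TE; apply: ord3P => step TE.
- apply: (step (fun a b => (cos a * cos a - sin a * sin a) * cos b * G a b + sin a * cos a * cos b * SH a b)
    (fun a b => - (cos b * G a b + sin b * SB a b))
    (fun a b => sin a * cos a * cos b * G a b) (fun a b => - (sin b * G a b))).
  + by rewrite /cont2 -/(rcont _); rc.
  + by rewrite /cont2 -/(rcont _); rc.
  + move=> a b; have d := ga a b; apply: is_derive_eq; rewrite /GRing.scale /=; ring.
  + move=> a b; have d := gb a b; apply: is_derive_eq; rewrite /GRing.scale /=; ring.
  + by move=> b; rewrite sinpi sin0 !mul0r.
  + by move=> a; rewrite sin2pi sin0 !mul0r.
  + move=> a b; rewrite (TE (fun a b => sin a * cos b))// /SH /SB.
    have t1 := trig1 a; have t2 := trig1 b.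
    rewrite -[LHS](addr0) -(mulr0 (cos b * G a b + r * sin a * cos b * cos b * H c0 a b + r * sin a * cos b * sin b * H c1 a b)) -t1.
    rewrite -[LHS](addr0) -(mulr0 (r * sin a * H c0 a b)) -t2.
    by move: (G a b) (H c0 a b) (H c1 a b) (H c2 a b) (sin a) (cos a) (sin b) (cos b) => *; ring.
- apply: (step (fun a b => (cos a * cos a - sin a * sin a) * sin b * G a b + sin a * cos a * sin b * SH a b)
    (fun a b => - sin b * G a b + cos b * SB a b)
    (fun a b => sin a * cos a * sin b * G a b) (fun a b => cos b * G a b)).
  + by rewrite /cont2 -/(rcont _); rc.
  + by rewrite /cont2 -/(rcont _); rc.
  + move=> a b; have d := ga a b; apply: is_derive_eq; rewrite /GRing.scale /=; ring.
  + move=> a b; have d := gb a b; apply: is_derive_eq; rewrite /GRing.scale /=; ring.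
  + by move=> b; rewrite sinpi sin0 !mul0r.
  + by move=> a; rewrite cos2pi cos0 Gper.
  + move=> a b; rewrite (TE (fun a b => sin a * sin b))// /SH /SB.
    have t1 := trig1 a; have t2 := trig1 b.
    rewrite -[LHS](addr0) -(mulr0 (sin b * G a b + r * sin a * sin b * cos b * H c0 a b + r * sin a * sin b * sin b * H c1 a b)) -t1.
    rewrite -[LHS](addr0) -(mulr0 (r * sin a * H c1 a b)) -t2.
    by move: (G a b) (H c0 a b) (H c1 a b) (H c2 a b) (sin a) (cos a) (sin b) (cos b) => *; ring.
- apply: (step (fun a b => - (2 * (sin a * cos a) * G a b + sin a * sin a * SH a b))
    (fun a b => 0)
    (fun a b => - (sin a * sin a * G a b)) (fun a b => 0)).
  + by rewrite /cont2 -/(rcont _); rc.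
  + by move=> z; exact: cvg_cst.
  + move=> a b; have d := ga a b; apply: is_derive_eq; rewrite /GRing.scale /=; ring.
  + by move=> b /=; rewrite sinpi sin0 !mul0r.
  + by [].
  + move=> a b; rewrite (TE (fun a b => cos a))// /SH addr0.
    have t1 := trig1 a.
    rewrite -[LHS](addr0) -(mulr0 (r * sin a * H c2 a b)) -t1.
    by move: (G a b) (H c0 a b) (H c1 a b) (H c2 a b) (sin a) (cos a) (sin b) (cos b) => *; ring.
Qed.
End TangentialDivergence.

Section Flux.
Context {R : realType}.
Local Notation V := (R * R * R)%type.

Lemma rcont_sp3 (g : V -> R) : continuous g ->
  rcont (fun z : R * R * R => g (sp z.1.1 z.1.2 z.2)).
Proof.
move=> cg z; apply: (continuous_sp_comp g _ (fun z : R * R * R => z.1.1)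
  (fun z : R * R * R => z.1.2) (fun z : R * R * R => z.2) z cg).
- exact: rcont_fst1.
- exact: rcont_fst2.
- exact: cvg_snd.
Qed.

Lemma rcont_sp2 (g : V -> R) (r : R) : continuous g ->
  rcont (fun z : R * R => g (sp r z.1 z.2)).
Proof.
move=> cg z; apply: (continuous_sp_comp g _ (fun _ => r) fst snd z cg).
- exact: cvg_cst.
- exact: cvg_fst.
- exact: cvg_snd.
Qed.

Lemma is_derive_flux (g : V -> R) (g_ : 'I_3 -> V -> R) i (r : R) : has_grad g g_ ->
  is_derive r (1 : R) (fun r => r ^+ 2 * Aint (fun a b => sin a * (om i a b * g (sp r a b))))
    (r ^+ 2 * Aint (fun a b => sin a * g_ i (sp r a b))).
Proof.
move=> hg; have [cg cg_ dg] := hg.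
have hG : rcont (fun z : R * R * R => g (sp z.1.1 z.1.2 z.2)) by exact: rcont_sp3.
have hH j : rcont (fun z : R * R * R => g_ j (sp z.1.1 z.1.2 z.2)) by exact: rcont_sp3.
have hG2 : rcont (fun z : R * R => g (sp r z.1 z.2)) by exact: rcont_sp2.
have hH2 j : rcont (fun z : R * R => g_ j (sp r z.1 z.2)) by exact: rcont_sp2.
pose F (r a b : R) := sin a * (om i a b * g (sp r a b)).
pose F' (r a b : R) := sin a * (om i a b * (om c0 a b * g_ c0 (sp r a b)
  + om c1 a b * g_ c1 (sp r a b) + om c2 a b * g_ c2 (sp r a b))).
have dF : is_derive r (1 : R) (fun t => Aint (F t)) (Aint (F' r)).
  apply: (is_derive_Aint_global F F' r).
  - by rewrite -/(rcont _) /F; rc.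
  - by rewrite -/(rcont _) /F'; rc.
  - move=> t a b; have d := dg (fun s => sp s a b) _ t (is_derive_sp_r t a b).
    rewrite sum3 in d.
    by rewrite /F /F'; apply: is_derive_eq; rewrite -![_ *: _]/(_ * _).
have d2 : is_derive r (1 : R) (fun t : R => t ^+ 2) (2 * r).
  by apply: is_derive_eq; rewrite /GRing.scale /=; ring.
apply: (is_derive_eq (is_deriveMf _ _ _ _ _ d2 dF)).
have T0 := Aint_tangential g g_ i r hg.
have cF : cont2 (F r) by rewrite /cont2 -/(rcont _) /F; rc.
have cF' : cont2 (F' r) by rewrite /cont2 -/(rcont _) /F'; rc.
pose S (a b : R) := sin a * g_ i (sp r a b).
have cS : cont2 S by rewrite /cont2 -/(rcont _) /S; rc.
have cZ (k : R) f : cont2 f -> cont2 (fun a b => k * f a b).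
  by move=> cf; rewrite /cont2 -/(rcont _); apply: rcontM => //; exact: rcont_cst.
have E a b : tangential g g_ i r a b = r * S a b + ((- r) * F' r a b + (- 2) * F r a b).
  rewrite /tangential sum3 /S /F /F'.
  move: (g_ i _) (g_ c0 _) (g_ c1 _) (g_ c2 _) (g _) (om i a b) (om c0 a b) (om c1 a b) (om c2 a b) => *.
  by ring.
move: T0; rewrite (eq_Aint _ _ E) AintD; [|exact: cZ|by apply: cont2D; exact: cZ].
rewrite AintD; [|exact: cZ|exact: cZ]; rewrite !AintZ// -/S.
move: (Aint S) (Aint (F' r)) (Aint (F r)) => x y z h.
rewrite -[LHS]addr0 -(mulr0 r) -h; ring.
Qed.

Lemma Aint_sin : Aint (fun a b => sin a) = 4 * pi :> R.
Proof.
rewrite /Aint.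
have E (a : R) : \int[leb1 R]_(b in `[0, pi *+ 2]) sin a = sin a * (pi *+ 2).
  rewrite Rintegral_cst// [X in _ * X](_ : _ = pi *+ 2)//.
  by rewrite -[RHS]subr0; apply: lebesgue_itv_length; exact: pi20.
under eq_Rintegral do rewrite E.
have c : continuous (fun a : R => sin a * (pi *+ 2)) by rewrite -/(rcont _); rc.
have d (x : R) : is_derive x (1 : R) (fun a => - cos a * (pi *+ 2)) (sin x * (pi *+ 2)).
  by apply: is_derive_eq; rewrite /GRing.scale /=; ring.
rewrite (Rintegral_FTC _ _ _ _ (pi_gt0 R) c d) cospi cos0 -mulr_natl; ring.
Qed.
End Flux.

(** * Kirchhoff's formula for the pressure *)

Section Kirchhoff.
Context {R : realType}.
Local Notation V := (R * R * R)%type.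
Variables (c : R) (hc : 0 < c).
Variables (v v' : 'I_3 -> R -> @functional R) (p p' : R -> @functional R).
Hypotheses (Cv : forall i, C1_curve (v i) (v' i)) (Cp : C1_curve p p').
Hypothesis eqv : forall t, 0 <= t -> forall psi, is_test psi -> forall i,
  v' i t psi + c * distr_partial i (p t) psi = 0.
Hypothesis eqp : forall t, 0 <= t -> forall psi, is_test psi ->
  p' t psi + c * \sum_(i < 3) distr_partial i (v i t) psi = 0.

Lemma is_derive_pressure (t : R) psi : 0 < t -> is_test psi ->
  is_derive t (1 : R) (fun s => ext0 p s psi)
    (c * \sum_(i < 3) ext0 (v i) t (partial i psi)).
Proof.
move=> t0 tp; apply: (is_derive_eq (ext0_is_derive _ _ _ _ Cp tp t0)).
have /eqP := eqp t (ltW t0) psi tp; rewrite addr_eq0 => /eqP ->.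
rewrite -mulrN; congr (_ * _); rewrite -sumrN; apply: eq_bigr => i _.
by rewrite /distr_partial opprK /ext0 max_r// ltW.
Qed.

Lemma is_derive_velocity i (t : R) psi : 0 < t -> is_test psi ->
  is_derive t (1 : R) (fun s => ext0 (v i) s psi) (c * ext0 p t (partial i psi)).
Proof.
move=> t0 tp; apply: (is_derive_eq (ext0_is_derive _ _ _ _ (Cv i) tp t0)).
have /eqP := eqv t (ltW t0) psi tp i; rewrite addr_eq0 => /eqP ->.
by rewrite -mulrN /distr_partial opprK /ext0 max_r// ltW.
Qed.

Variables (T : R) (hT : 0 < T).

(* The value at time s on the backward characteristic from the vertex (T, 0), in
   the direction (a, b). *)
Definition along (U : R -> @functional R) (f : V -> R) (s a b : R) : R :=
  U s (tr (sp (c * (T - s)) a b) f).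

Lemma along_rcont (U : R -> @functional R) f : cont_family U -> is_test f ->
  rcont (fun z : R * R * R => along U f z.1.1 z.1.2 z.2).
Proof.
move=> cU tf z.
have h0 : (fun z : R * R * R => z.1.1) @ z --> z.1.1 by exact: rcont_fst1.
have h1 : (fun z : R * R * R => z.1.2) @ z --> z.1.2 by exact: rcont_fst2.
have h2 : (fun z : R * R * R => z.2) @ z --> z.2 by exact: cvg_snd.
have hr : rcont (fun z : R * R * R => c * (T - z.1.1)) by rc.
have h3 : {for z, continuous (fun z : R * R * R => sp (c * (T - z.1.1)) z.1.2 z.2)}.
  exact: (cvg_sp _ _ _ _ _ _ _ _ _ (hr z) h1 h2).
exact: (continuous_translate U f _ _ _ z cU tf h0 h3).
Qed.

Lemma is_derive_along (U : R -> @functional R) (U' : @functional R) f (s a b : R) :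
  cont_family U -> is_test f ->
  (forall psi, is_test psi -> is_derive s (1 : R) (fun t => U t psi) (U' psi)) ->
  is_derive s (1 : R) (fun t => along U f t a b)
    (U' (tr (sp (c * (T - s)) a b) f)
     - c * \sum_(i < 3) om i a b * along U (partial i f) s a b).
Proof.
move=> cU tf dU.
have dg i : is_derive s (1 : R) (fun t => coord (sp (c * (T - t)) a b) i) (- c * om i a b).
  move: i; apply: ord3P; rewrite /coord /sp /om /=;
   apply: is_derive_eq; rewrite /GRing.scale /=; ring.
have := is_derive_translate U U' f (fun t => sp (c * (T - t)) a b) _ s cU tf dU dg.
move=> /is_derive_eq; apply; congr (_ + _).
by rewrite mulr_sumr -sumrN; apply: eq_bigr => i _; rewrite /along mulNr mulrA mulNr.
Qed.

Lemma is_derive_along_pressure f (s a b : R) : 0 < s -> is_test f ->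
  is_derive s (1 : R) (fun t => along (ext0 p) f t a b)
    (c * \sum_(i < 3) along (ext0 (v i)) (partial i f) s a b
     - c * \sum_(i < 3) om i a b * along (ext0 p) (partial i f) s a b).
Proof.
move=> s0 tf.
have := is_derive_along (ext0 p) _ f s a b (ext0_cont_family _ _ Cp) tf
  (fun psi tp => is_derive_pressure s psi s0 tp).
by move=> /is_derive_eq; apply; congr (c * _ - _); apply: eq_bigr => i _; rewrite partial_tr.
Qed.

Lemma is_derive_along_velocity i f (s a b : R) : 0 < s -> is_test f ->
  is_derive s (1 : R) (fun t => along (ext0 (v i)) f t a b)
    (c * along (ext0 p) (partial i f) s a b
     - c * \sum_(j < 3) om j a b * along (ext0 (v i)) (partial j f) s a b).
Proof.
move=> s0 tf.
have := is_derive_along (ext0 (v i)) _ f s a b (ext0_cont_family _ _ (Cv i)) tf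
  (fun psi tp => is_derive_velocity i s psi s0 tp).
by move=> /is_derive_eq; apply; rewrite partial_tr.
Qed.

Lemma is_derive_characteristic (s S o0 o1 o2 : R) (q p0 p1 p2 f0 f1 f2 : R -> R)
   (dq dp0 dp1 dp2 df0 df1 df2 : R) :
  is_derive s (1 : R) q dq -> is_derive s (1 : R) p0 dp0 ->
  is_derive s (1 : R) p1 dp1 -> is_derive s (1 : R) p2 dp2 ->
  is_derive s (1 : R) f0 df0 -> is_derive s (1 : R) f1 df1 ->
  is_derive s (1 : R) f2 df2 ->
  is_derive s (1 : R) (fun s => S * (c * (T - s) * (c * (f0 s + f1 s + f2 s)) + c * q s
      + c * (c * (T - s)) * (o0 * p0 s + o1 * p1 s + o2 * p2 s)))
    (S * (- (c * c * (f0 s + f1 s + f2 s)) + c * (T - s) * (c * (df0 + df1 + df2)) + c * dq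
      - c * c * (o0 * p0 s + o1 * p1 s + o2 * p2 s)
      + c * (c * (T - s)) * (o0 * dp0 + o1 * dp1 + o2 * dp2))).
Proof.
move=> *; apply: is_derive_eq; rewrite /GRing.scale /=.
ring.
Qed.

Lemma characteristic_identity (s a b : R) (q : R -> R) (P F : 'I_3 -> R -> R)
    (M N : 'I_3 -> 'I_3 -> R) :
  is_derive s (1 : R) q
    (c * \sum_(i < 3) F i s - c * \sum_(i < 3) om i a b * P i s) ->
  (forall j, is_derive s (1 : R) (P j)
    (c * \sum_(i < 3) N j i - c * \sum_(k < 3) om k a b * M k j)) ->
  (forall i, is_derive s (1 : R) (F i)
    (c * M i i - c * \sum_(j < 3) om j a b * N j i)) ->
  is_derive s (1 : R) (fun t => sin a * (c * (T - t) * (c * (F c0 t + F c1 t + F c2 t))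
      + c * q t + c * (c * (T - t)) *
        (om c0 a b * P c0 t + om c1 a b * P c1 t + om c2 a b * P c2 t)))
    (c * c * \sum_(i < 3) sin a * (c * (T - s) *
        (M i i - om i a b * \sum_(j < 3) om j a b * M j i) - 2 * om i a b * P i s)).
Proof.
move=> dq dP dF.
have E := is_derive_characteristic s (sin a) (om c0 a b) (om c1 a b) (om c2 a b)
  _ _ _ _ _ _ _ _ _ _ _ _ _ _ dq (dP c0) (dP c1) (dP c2) (dF c0) (dF c1) (dF c2).
apply: (is_derive_eq E); rewrite !sum3.
move: (M c0 c0) (M c0 c1) (M c0 c2) (M c1 c0) (M c1 c1) (M c1 c2) (M c2 c0) (M c2 c1) (M c2 c2).
move: (N c0 c0) (N c0 c1) (N c0 c2) (N c1 c0) (N c1 c1) (N c1 c2) (N c2 c0) (N c2 c1) (N c2 c2).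
move: (P c0 s) (P c1 s) (P c2 s) (F c0 s) (F c1 s) (F c2 s).
by move: (om c0 a b) (om c1 a b) (om c2 a b) (sin a) => *; ring.
Qed.

Variables (chi : V -> R) (tc : is_test chi).
(* The derivatives of chi are named by variables, since unifying two distinct
   [partial] terms unfolds them without end. *)
Variables (f1 : 'I_3 -> V -> R) (f2 : 'I_3 -> 'I_3 -> V -> R).
Hypotheses (hf1 : forall i, f1 i = partial i chi) (hf2 : forall i j, f2 i j = partial i (f1 j)).

Let tf1 i : is_test (f1 i).
Proof. by rewrite hf1; exact: (is_test_partials [:: i] _ tc). Qed.

Let tf2 i j : is_test (f2 i j).
Proof. by rewrite hf2; exact: (is_test_partials [:: i] _ (tf1 j)). Qed.

Let f2C i j : f2 i j = f2 j i.
Proof. by rewrite !hf2 !hf1 partial_comm. Qed.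

Definition cfun (s a b : R) : R :=
  sin a * (c * (T - s) * (c * (along (ext0 (v c0)) (f1 c0) s a b
     + along (ext0 (v c1)) (f1 c1) s a b
     + along (ext0 (v c2)) (f1 c2) s a b)) + c * along (ext0 p) chi s a b
   + c * (c * (T - s)) * (om c0 a b * along (ext0 p) (f1 c0) s a b
     + om c1 a b * along (ext0 p) (f1 c1) s a b
     + om c2 a b * along (ext0 p) (f1 c2) s a b)).

Definition ptang (i : 'I_3) (s : R) : R -> R -> R :=
  tangential (fun h => ext0 p s (tr h (f1 i)))
    (fun j h => ext0 p s (tr h (f2 j i))) i (c * (T - s)).

Definition dcfun (s a b : R) : R :=
  c * c * \sum_(i < 3) sin a * (c * (T - s) *
        (along (ext0 p) (f2 i i) s a b
         - om i a b * \sum_(j < 3) om j a b * along (ext0 p) (f2 j i) s a b)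
         - 2 * om i a b * along (ext0 p) (f1 i) s a b).

Lemma is_derive_cfun (s a b : R) : 0 < s ->
  is_derive s (1 : R) (fun t => cfun t a b) (dcfun s a b).
Proof.
move=> s0.
have dq : is_derive s (1 : R) (fun t => along (ext0 p) chi t a b)
    (c * \sum_(i < 3) along (ext0 (v i)) (f1 i) s a b
     - c * \sum_(i < 3) om i a b * along (ext0 p) (f1 i) s a b).
  apply: (is_derive_eq (is_derive_along_pressure chi s a b s0 tc)).
  by congr (c * _ - c * _); apply: eq_bigr => i _; rewrite hf1.
have dp j : is_derive s (1 : R) (fun t => along (ext0 p) (f1 j) t a b)
    (c * \sum_(i < 3) along (ext0 (v i)) (f2 j i) s a b
     - c * \sum_(k < 3) om k a b * along (ext0 p) (f2 k j) s a b).
  apply: (is_derive_eq (is_derive_along_pressure (f1 j) s a b s0 (tf1 j))).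
  by congr (c * _ - c * _); apply: eq_bigr => i _; rewrite -hf2// f2C.
have df i : is_derive s (1 : R) (fun t => along (ext0 (v i)) (f1 i) t a b)
    (c * along (ext0 p) (f2 i i) s a b
     - c * \sum_(j < 3) om j a b * along (ext0 (v i)) (f2 j i) s a b).
  apply: (is_derive_eq (is_derive_along_velocity i (f1 i) s a b s0 (tf1 i))).
  by rewrite -hf2; congr (_ - c * _); apply: eq_bigr => j _; rewrite -hf2.
exact: (characteristic_identity s a b (fun t => along (ext0 p) chi t a b)
  (fun j t => along (ext0 p) (f1 j) t a b) (fun i t => along (ext0 (v i)) (f1 i) t a b)
  (fun k j => along (ext0 p) (f2 k j) s a b) (fun j i => along (ext0 (v i)) (f2 j i) s a b) dq dp df).
Qed.

Let cP := ext0_cont_family _ _ Cp.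
Let cV i := ext0_cont_family _ _ (Cv i).

Lemma rcont_cfun : rcont (fun z : R * R * R => cfun z.1.1 z.1.2 z.2).
Proof.
have hq := along_rcont _ chi cP tc.
have h0 := along_rcont _ _ cP (tf1 c0); have h1 := along_rcont _ _ cP (tf1 c1).
have h2 := along_rcont _ _ cP (tf1 c2).
have h3 := along_rcont _ _ (cV c0) (tf1 c0); have h4 := along_rcont _ _ (cV c1) (tf1 c1).
have h5 := along_rcont _ _ (cV c2) (tf1 c2).
by rewrite /cfun; rc.
Qed.

Lemma rcont_dcfun_term i : rcont (fun z : R * R * R => sin z.1.2 * (c * (T - z.1.1) *
        (along (ext0 p) (f2 i i) z.1.1 z.1.2 z.2
         - om i z.1.2 z.2 * (om c0 z.1.2 z.2 * along (ext0 p) (f2 c0 i) z.1.1 z.1.2 z.2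
            + om c1 z.1.2 z.2 * along (ext0 p) (f2 c1 i) z.1.1 z.1.2 z.2
            + om c2 z.1.2 z.2 * along (ext0 p) (f2 c2 i) z.1.1 z.1.2 z.2))
         - 2 * om i z.1.2 z.2 * along (ext0 p) (f1 i) z.1.1 z.1.2 z.2)).
Proof.
have g0 := along_rcont _ _ cP (tf2 c0 i); have g1 := along_rcont _ _ cP (tf2 c1 i).
have g2 := along_rcont _ _ cP (tf2 c2 i); have gi := along_rcont _ _ cP (tf2 i i).
have h := along_rcont _ _ cP (tf1 i).
by rc.
Qed.

Lemma rcont_dcfun : rcont (fun z : R * R * R => dcfun z.1.1 z.1.2 z.2).
Proof.
have t0 := rcont_dcfun_term c0; have t1 := rcont_dcfun_term c1; have t2 := rcont_dcfun_term c2.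
have h := rcontM _ _ (rcont_cst (c * c)) (rcontD _ _ (rcontD _ _ t0 t1) t2).
move: h; congr (rcont _); apply/funext => z.
by rewrite /dcfun !sum3.
Qed.

Lemma Aint_dcfun (s : R) : Aint (dcfun s) = 0.
Proof.
have dP := cP.1 s.
have ht i : Aint (ptang i s) = 0.
  apply: Aint_tangential.
  have [h1 h2 h3] := has_grad_distr (ext0 p s) (f1 i) dP (tf1 i).
  split => //; first by move=> j; rewrite hf2; exact: h2.
  by move=> gam dgam x /h3 h; apply: (is_derive_eq h); apply: eq_bigr => j _; rewrite hf2.
have cpt i : cont2 (ptang i s).
  have ct f : is_test f -> rcont (fun z : R * R => ext0 p s (tr (sp (c * (T - s)) z.1 z.2) f)).
    by move=> tf; apply: (rcont_sp2 (fun h => ext0 p s (tr h f))); have [] := has_grad_distr _ _ dP tf.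
  have h1 := ct _ (tf1 i); have g0 := ct _ (tf2 c0 i); have g1 := ct _ (tf2 c1 i).
  have g2 := ct _ (tf2 c2 i); have gi := ct _ (tf2 i i).
  have : rcont (fun z : R * R => sin z.1 * (c * (T - s) * (ext0 p s (tr (sp (c * (T - s)) z.1 z.2) (f2 i i))
     - om i z.1 z.2 * (om c0 z.1 z.2 * ext0 p s (tr (sp (c * (T - s)) z.1 z.2) (f2 c0 i))
       + om c1 z.1 z.2 * ext0 p s (tr (sp (c * (T - s)) z.1 z.2) (f2 c1 i))
       + om c2 z.1 z.2 * ext0 p s (tr (sp (c * (T - s)) z.1 z.2) (f2 c2 i))))
      - 2 * om i z.1 z.2 * ext0 p s (tr (sp (c * (T - s)) z.1 z.2) (f1 i)))) by rc.
  rewrite /cont2 -/(rcont _); congr (rcont _); apply/funext => y.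
  by rewrite /ptang /tangential sum3.
have -> : dcfun s = fun a b => c * c * (ptang c0 s a b + ptang c1 s a b + ptang c2 s a b).
  by apply/funext => a; apply/funext => b; rewrite /dcfun sum3.
rewrite AintZ ?AintD ?ht ?addr0 ?mulr0//; do ?exact: cont2D.
by apply: cont2D => //; exact: cont2D.
Qed.

Lemma Aint_cfun_const : Aint (cfun T) = Aint (cfun 0).
Proof.
have cA : continuous (fun s => Aint (cfun s)) by exact: continuous_Aint rcont_cfun.
have d s : s \in `]0, T[ -> is_derive s (1 : R) (fun s => Aint (cfun s)) 0.
  rewrite in_itv /= => /andP[s0 sT]; rewrite -(Aint_dcfun s).
  apply: (is_derive_Aint cfun dcfun s 0 (T + T)).
  - by rewrite s0 ltr_wpDr// ltW.
  - exact: rcont_cfun.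
  - exact: rcont_dcfun.
  - by move=> t a b /andP[t0 _]; exact: is_derive_cfun.
have [x _] := MVT_segment (ltW hT) d (continuous_subspaceT cA).
by rewrite mul0r => /eqP; rewrite subr_eq0 => /eqP.
Qed.

End Kirchhoff.

Section Solution.
Context {R : realType}.
Local Notation V := (R * R * R)%type.

Lemma tr_sp0 (a b : R) (f : V -> R) : tr (sp 0 a b) f = f.
Proof.
apply/funext => -[[x y] z]; rewrite /tr /sp !mul0r.
by congr f; rewrite -[RHS]addr0.
Qed.

Lemma ext0_nneg (u : R -> @functional R) (t : R) : 0 <= t -> ext0 u t = u t.
Proof. by move=> t0; rewrite /ext0 max_r. Qed.

Lemma along_tip (c t : R) (U : R -> @functional R) f a b : along c t U f t a b = U t f.
Proof. by rewrite /along subrr mulr0 tr_sp0. Qed.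

Lemma along0 (c t : R) (u : R -> @functional R) f a b :
  along c t (ext0 u) f 0 a b = u 0 (tr (sp (c * t) a b) f).
Proof. by rewrite /along subr0 (ext0_nneg _ _ (lexx 0)). Qed.

Lemma regular_distr_zero (f : V -> R) psi : (forall X, f X = 0) -> regular_distr f psi = 0.
Proof.
move=> f0; rewrite /regular_distr (_ : (fun x => f x * psi x) = cst 0); last first.
  by apply/funext => X; rewrite f0 mul0r.
by rewrite Rintegral_cst// mul0r.
Qed.

Lemma distr_solution_pressure (c : R) (v v' : 'I_3 -> R -> @functional R)
    (p p' : R -> @functional R) (t : R) chi :
  0 < c -> (forall i, C1_curve (v i) (v' i)) -> C1_curve p p' ->
  (forall t, 0 <= t -> forall psi, is_test psi -> forall i,
    v' i t psi + c * distr_partial i (p t) psi = 0) ->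
  (forall t, 0 <= t -> forall psi, is_test psi ->
    p' t psi + c * \sum_(i < 3) distr_partial i (v i t) psi = 0) ->
  (forall psi, is_test psi -> p 0 psi = 0) ->
  (forall psi, is_test psi -> v c0 0 psi = 0) ->
  (forall psi, is_test psi -> v c1 0 psi = 0) ->
  0 < t -> is_test chi ->
  p t chi = c * t / (4 * pi) *
    Aint (fun a b => sin a * v c2 0 (tr (sp (c * t) a b) (partial c2 chi))).
Proof.
move=> hc Cv Cp eqv eqp p0 v0 v1 t0 tc.
pose f1 i := partial i chi.
have [f [hf tf]] : exists f : 'I_3 -> V -> R, (forall i, f i = partial i chi) /\ forall i, is_test (f i).
  by exists (fun i => partial i chi); split=> // i; exact: (is_test_partials [:: i] _ tc).
have E := Aint_cfun_const c v v' p p' Cv Cp eqv eqp t t0 chi tc f _ hf (fun i j => erefl).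
have tt s a b g : is_test g -> is_test (tr (sp s a b) g) by move=> tg; exact: is_test_tr.
have E1 : Aint (cfun c v p t chi f t) = c * p t chi * (4 * pi).
  rewrite -Aint_sin -AintZ; last by rewrite /cont2 -/(rcont _); rc.
  apply: eq_Aint => a b; rewrite /cfun.
  set X := along c t (ext0 (v c0)) _ _ _ _ + _ + _; set Y := om c0 a b * _ + _ + _.
  have -> : along c t (ext0 p) chi t a b = p t chi.
    by rewrite along_tip (ext0_nneg _ _ (ltW t0)).
  by move: X Y (sin a) => X Y S; rewrite subrr; ring.
have d2 : is_distribution (v c2 0) by exact: ((Cv c2).1 0 (lexx _)).1.
have E2 : Aint (cfun c v p t chi f 0) = c * t * c *
    Aint (fun a b => sin a * v c2 0 (tr (sp (c * t) a b) (partial c2 chi))).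
  rewrite -AintZ; last first.
    rewrite -hf /cont2 -/(rcont _).
    have h := rcont_sp2 (fun h => v c2 0 (tr h (f c2))) (c * t).
    have {}h := h _; have [h1 _ _] := has_grad_distr _ _ d2 (tf c2).
    by have {}h := h h1; rc.
  apply: eq_Aint => a b; rewrite /cfun.
  have zp g : is_test g -> along c t (ext0 p) g 0 a b = 0.
    by move=> tg; rewrite along0; apply: p0; exact: tt.
  have z0 : along c t (ext0 (v c0)) (f c0) 0 a b = 0.
    by rewrite along0; apply: v0; exact: tt.
  have z1 : along c t (ext0 (v c1)) (f c1) 0 a b = 0.
    by rewrite along0; apply: v1; exact: tt.
  have z2 : along c t (ext0 (v c2)) (f c2) 0 a b = v c2 0 (tr (sp (c * t) a b) (partial c2 chi)).
    by rewrite along0 hf.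
  rewrite z0 z1 z2 (zp _ tc) (zp _ (tf c0)) (zp _ (tf c1)) (zp _ (tf c2)) subr0.
  by move: (v _ _ _) (sin a) (om _ _ _) (om _ _ _) (om _ _ _) => *; ring.
move: E; rewrite E1 E2.
have pi_neq : (4 * pi) != 0 :> R by rewrite mulf_neq0// lt0r_neq0// pi_gt0.
have c_neq : c != 0 by rewrite lt0r_neq0.
move: (Aint _) => A H.
apply: (mulfI c_neq); apply: (mulIf pi_neq); rewrite H.
by move: (4 * pi) pi_neq => q q_neq; field.
Qed.

Lemma distr_solution_velocity (c : R) (v v' : 'I_3 -> R -> @functional R)
    (p p' : R -> @functional R) (t : R) psi :
  0 < c -> (forall i, C1_curve (v i) (v' i)) -> C1_curve p p' ->
  (forall t, 0 <= t -> forall psi, is_test psi -> forall i,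
    v' i t psi + c * distr_partial i (p t) psi = 0) ->
  (forall t, 0 <= t -> forall psi, is_test psi ->
    p' t psi + c * \sum_(i < 3) distr_partial i (v i t) psi = 0) ->
  (forall psi, is_test psi -> p 0 psi = 0) ->
  (forall psi, is_test psi -> v c0 0 psi = 0) ->
  (forall psi, is_test psi -> v c1 0 psi = 0) ->
  0 < t -> is_test psi ->
  v c0 t psi = (4 * pi)^-1 * \int[leb1 R]_(r in `[0, c * t]) (r *
    Aint (fun a b => sin a * v c2 0 (tr (sp r a b) (partial c2 (partial c0 psi))))).
Proof.
move=> hc Cv Cp eqv eqp p0 v0 v1 t0 tp.
have [f [hf tf]] : exists f, f = partial c0 psi /\ is_test f.
  by eexists; split; first reflexivity; exact: (is_test_partials [:: c0] _ tp).
have [g [hg tg]] : exists g, g = partial c2 f /\ is_test g.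
  by eexists; split; first reflexivity; exact: (is_test_partials [:: c2] _ tf).
rewrite -hf -hg.
have pi_neq : (4 * pi) != 0 :> R by rewrite mulf_neq0// lt0r_neq0// pi_gt0.
have c_neq : c != 0 by rewrite lt0r_neq0.
pose B r := Aint (fun a b => sin a * v c2 0 (tr (sp r a b) g)).
pose F r := 4 * pi * ext0 (v c0) (c^-1 * r) psi.
have d2 : is_distribution (v c2 0) by exact: ((Cv c2).1 0 (lexx _)).1.
have cB : continuous B.
  have [h1 _ _] := has_grad_distr _ _ d2 tg.
  have h := rcont_sp3 _ h1.
  apply: (continuous_Aint R (fun r a b => sin a * v c2 0 (tr (sp r a b) g))).
  by rewrite -/(rcont _); rc.
have cU := ext0_cont_family _ _ (Cv c0).
have cF : continuous F.
  move=> r; apply: cvgM; first exact: cvg_cst.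
  have h : (fun r : R => c^-1 * r) @ r --> c^-1 * r.
    by apply: cvgM; [exact: cvg_cst|exact: cvg_id].
  exact: (@continuous_comp _ _ _ (fun r => c^-1 * r) (fun t => ext0 (v c0) t psi) r h (cU.2 _ tp _)).
have dF r : 0 < r < c * t -> is_derive r (1 : R) F (r * B r).
  move=> /andP[r0 _].
  have s0 : 0 < c^-1 * r by rewrite mulr_gt0// invr_gt0.
  have d := is_derive_velocity c v v' p Cv eqv c0 _ psi s0 tp.
  have dl : is_derive r (1 : R) (fun r => c^-1 * r) c^-1.
    by apply: is_derive_eq; rewrite /GRing.scale /=; ring.
  have dc : is_derive r (1 : R) (fun r => ext0 (v c0) (c^-1 * r) psi)
      (c * ext0 p (c^-1 * r) (partial c0 psi) * c^-1).
    exact: (@is_derive1_comp _ (fun t => ext0 (v c0) t psi) (fun r => c^-1 * r)).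
  apply: (is_derive_eq (is_deriveMf _ _ _ _ _ (is_derive_cst _ _ _) dc)).
  rewrite mul0r add0r [cst _ _](_ : _ = 4 * pi)// -hf (ext0_nneg _ _ (ltW s0)).
  rewrite (distr_solution_pressure c v v' p p' _ f hc Cv Cp eqv eqp p0 v0 v1 s0 tf) -hg.
  rewrite mulVKf// -/(B r).
  by move: (B r) (4 * pi) pi_neq => x q q_neq; field; rewrite c_neq q_neq.
have ct0 : 0 < c * t by rewrite mulr_gt0.
have cf : continuous (fun r : R => r * B r).
  exact: (rcontM _ _ rcont_id cB).
rewrite (Rintegral_FTC_oo _ F _ _ ct0 cf cF dF) /F mulr0 mulKf//.
rewrite (ext0_nneg _ _ (lexx 0)) (ext0_nneg _ _ (ltW t0)) (v0 _ tp) mulr0 subr0.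
by rewrite mulKf.
Qed.

End Solution.

(** * The pairing with I(r, x) *)

Section SigmaFinite.
Context d1 d2 (T1 : measurableType d1) (T2 : measurableType d2) (R : realType).
Variables (m1 : {sigma_finite_measure set T1 -> \bar R})
  (m2 : {sigma_finite_measure set T2 -> \bar R}).

Lemma sigma_finite_product : sigma_finite setT (m1 \x m2)%E.
Proof.
have /sigma_finiteP[F [TF ndF Foo]] := sigma_finiteT m1.
have /sigma_finiteP[G [TG ndG Goo]] := sigma_finiteT m2.
exists (fun n => F n `*` G n); last first.
  move=> n; have [mF F1] := Foo n; have [mG G1] := Goo n.
  split; first exact: measurableX.
  by rewrite product_measure1E// lte_mul_pinfty// ge0_fin_numE.
apply/seteqP; split=> // -[x y] _.
have [n _ Fx] : (\bigcup_n F n) x by rewrite -TF.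
have [k _ Gy] : (\bigcup_n G n) y by rewrite -TG.
exists (n + k)%N => //; split => /=.
  by move: x Fx; apply/subsetPset/ndF; exact: leq_addr.
by move: y Gy; apply/subsetPset/ndG; exact: leq_addl.
Qed.

Lemma product_translate (f1 : T1 -> T1) (f2 : T2 -> T2) :
  measurable_fun setT f1 -> measurable_fun setT f2 ->
  (forall A, measurable A -> m1 (f1 @^-1` A) = m1 A) ->
  (forall A, measurable A -> m2 (f2 @^-1` A) = m2 A) ->
  forall A : set (T1 * T2), measurable A ->
    (m1 \x m2)%E ((fun z => (f1 z.1, f2 z.2)) @^-1` A) = (m1 \x m2)%E A.
Proof.
move=> mf1 mf2 h1 h2 A mA.
pose f (z : T1 * T2) := (f1 z.1, f2 z.2).
have mf : measurable_fun setT f.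
  by apply: measurable_fun_pair; apply: measurableT_comp.
pose m' : {measure set (T1 * T2)%type -> \bar R} :=
  measure_function_pushforward__canonical__measure_function_Measure (m1 \x m2)%E mf.
have H := @product_measure_unique _ _ T1 T2 R m1 m2 m' _ A mA.
rewrite H//= => B C mB mC.
rewrite /m' /= /pushforward.
have -> : f @^-1` (B `*` C) = (f1 @^-1` B) `*` (f2 @^-1` C) by [].
have p1 : measurable (f1 @^-1` B) by rewrite -[X in measurable X]setTI; exact: mf1.
have p2 : measurable (f2 @^-1` C) by rewrite -[X in measurable X]setTI; exact: mf2.
rewrite product_measure1E//; congr (_ * _)%E; [exact: h1|exact: h2].
Qed.
End SigmaFinite.

Section Leb3.
Context {R : realType}.

Definition leb2s : set (measurableTypeR R * measurableTypeR R)%type -> \bar R :=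
  (leb1 R \x leb1 R)%E.
HB.instance Definition _ := Measure.on leb2s.
HB.instance Definition _ := @Measure_isSigmaFinite.Build _ _ _ leb2s
  (sigma_finite_product _ _ _ _ _ (leb1 R) (leb1 R)).

Definition leb3s : set (measurableTypeR R * measurableTypeR R * measurableTypeR R)%type -> \bar R :=
  (leb2s \x leb1 R)%E.
HB.instance Definition _ := Measure.on leb3s.
HB.instance Definition _ := @Measure_isSigmaFinite.Build _ _ _ leb3s
  (sigma_finite_product _ _ _ _ _ leb2s (leb1 R)).

Lemma lebesgue_translate (h : R) (A : set (measurableTypeR R)) : measurable A ->
  leb1 R ((fun x => x + h) @^-1` A) = leb1 R A.
Proof.
move=> mA.
have mf : measurable_fun setT (fun x : measurableTypeR R => x + h : measurableTypeR R).
  by apply: measurable_funD => //; exact: measurable_cst.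
pose m' : {measure set (measurableTypeR R) -> \bar R} :=
  measure_function_pushforward__canonical__measure_function_Measure (leb1 R) mf.
have H := @lebesgue_measure_unique R m' _ A mA.
rewrite H// => _ [[a b] _ <-] /=.
rewrite /pushforward.
have -> : (fun x : R => x + h) @^-1` `]a, b] = `]a - h, b - h]%classic.
  by apply/seteqP; split => x /=; rewrite !in_itv /= ltrBlDr lerBrDr.
rewrite !lebesgue_measure_itv /= !lte_fin ltrD2r; case: ifP => // _.
by rewrite -!EFinB; congr EFin; ring.
Qed.

Lemma leb3_translate (h : R * R * R) (A : set (measurableTypeR R * measurableTypeR R * measurableTypeR R)%type) :
  measurable A ->
  leb3 R ((fun X => X + h) @^-1` A) = leb3 R A.
Proof.
move=> mA.
have mf (k : R) : measurable_fun setT (fun x : measurableTypeR R => x + k : measurableTypeR R).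
  by apply: measurable_funD => //; exact: measurable_cst.
have H2 := product_translate _ _ _ _ _ (leb1 R) (leb1 R) _ _ (mf h.1.1) (mf h.1.2) (lebesgue_translate _) (lebesgue_translate _).
have m2 : measurable_fun setT (fun z : measurableTypeR R * measurableTypeR R => (z.1 + h.1.1, z.2 + h.1.2)).
  by apply: measurable_fun_pair; apply: measurable_funD => //; exact: measurable_cst.
exact: (product_translate _ _ _ _ _ leb2s (leb1 R) _ _ m2 (mf h.2) H2 (lebesgue_translate _) A mA).
Qed.

Lemma Rintegral_translate (h : R * R * R) (f : R * R * R -> R) :
  measurable_fun setT f -> (leb3 R).-integrable setT (EFin \o (fun X => f (X + h))) ->
  \int[leb3 R]_X f (X + h) = \int[leb3 R]_X f X.
Proof.
move=> mf intf.
have mphi : measurable_fun setT (fun X : measurableTypeR R * measurableTypeR R * measurableTypeR R =>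
    (X + h : measurableTypeR R * measurableTypeR R * measurableTypeR R)).
  rewrite (_ : (fun X => _) = (fun X => ((X.1.1 + h.1.1, X.1.2 + h.1.2), X.2 + h.2))).
    apply: measurable_fun_pair; [apply: measurable_fun_pair|];
      apply: measurable_funD => //; try exact: measurable_cst; exact: measurableT_comp.
  by apply/funext => X.
have me : measurable_fun setT (EFin \o f) by exact/measurable_EFinP.
have H := @integral_pushforward _ _ _ _ _ _ mphi (leb3 R) setT (EFin \o f) me intf measurableT.
rewrite preimage_setT in H; rewrite /Rintegral; congr fine; apply: (etrans (esym H)).
pose m' : {measure set (measurableTypeR R * measurableTypeR R * measurableTypeR R)%type -> \bar R} :=
  measure_function_pushforward__canonical__measure_function_Measure (leb3 R) mphi.
exact: (@eq_measure_integral _ _ R setT (leb3 R) m' (EFin \o f) (fun A mA _ => leb3_translate h A mA)).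
Qed.
End Leb3.

Section Swap3.
Context {R : realType} d1 (T1 : measurableType d1).
Variables (m1 : {sigma_finite_measure set T1 -> \bar R}) (A : set T1).
Hypotheses (mA : measurable A) (fA : (m1 A < +oo)%E).

Lemma Rintegral_bound d (T : measurableType d) (m : {measure set T -> \bar R})
    (C : set T) (g : T -> R) (N : R) :
  measurable C -> (m C < +oo)%E -> measurable_fun setT g -> (forall z, `|g z| <= N) ->
  `|\int[m]_(x in C) g x| <= N * fine (m C).
Proof.
move=> mC fC mg bg.
have mg' : measurable_fun C g by exact: measurable_funTS.
have ig := bounded_integrable_section _ _ m C g N mC fC mg' bg.
apply: (le_trans (le_normr_Rintegral mC ig)).
rewrite -Rintegral_cst//; apply: le_Rintegral => //.
- apply: (@bounded_integrable_section _ _ _ _ _ _ N) => //; last by move=> z; rewrite normr_id.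
  exact: measurableT_comp.
- by apply: (@bounded_integrable_section _ _ _ _ _ (cst N) `|N|).
Qed.

Variables (f : T1 * measurableTypeR R * measurableTypeR R -> R) (M : R).
Hypotheses (mf : measurable_fun setT f) (bf : forall z, `|f z| <= M).

Let fin2pi : (leb1 R `[0%R, (pi *+ 2)%R]%classic < +oo)%E.
Proof. exact: lebesgue_itv_fin. Qed.

Lemma measurable_inner_integral :
  measurable_fun setT (fun z : T1 * measurableTypeR R => \int[leb1 R]_(b in `[0, pi *+ 2]) f (z, b)).
Proof. by apply: (@measurable_Rintegral_param _ _ _ _ _ (leb1 R) _ _ _ f M). Qed.

Lemma inner_integral_bound (z : T1 * measurableTypeR R) :
  `|\int[leb1 R]_(b in `[0, pi *+ 2]) f (z, b)| <= M * fine (leb1 R `[0%R, (pi *+ 2)%R]%classic).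
Proof.
by apply: Rintegral_bound => //; exact: measurable_fun_pair2.
Qed.

Lemma Rintegral_swap_Aint :
  \int[m1]_(x in A) Aint (fun a b => f (x, a, b)) = Aint (fun a b => \int[m1]_(x in A) f (x, a, b)).
Proof.
have pfin : (leb1 R `[0%R, pi]%classic < +oo)%E by exact: lebesgue_itv_fin.
have H := @Rintegral_swap R _ _ T1 (measurableTypeR R) m1 (leb1 R) A `[0, pi]%classic mA
  (measurable_itv _) fA pfin (fun z => \int[leb1 R]_(b in `[0, pi *+ 2]) f (z, b)) _
  measurable_inner_integral inner_integral_bound.
rewrite /Aint [LHS]H; apply: eq_Rintegral => a _.
have ma : measurable_fun setT (fun z : T1 * measurableTypeR R => f (z.1, a, z.2)).
  apply: (measurableT_comp mf); apply: measurable_fun_pair => //.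
  by apply: measurable_fun_pair => //; exact: measurable_cst.
exact: (@Rintegral_swap R _ _ T1 (measurableTypeR R) m1 (leb1 R) A `[0, pi *+ 2]%classic mA
  (measurable_itv _) fA fin2pi (fun z => f (z.1, a, z.2)) M ma (fun z => bf _)).
Qed.

Lemma AintZl_bounded (k : R) (x : T1) : k * Aint (fun a b => f (x, a, b)) = Aint (fun a b => k * f (x, a, b)).
Proof.
rewrite /Aint -RintegralZl//; last first.
  apply: (@bounded_integrable_section _ _ _ _ _ _ (M * fine (leb1 R `[0%R, (pi *+ 2)%R]%classic))) => //.
  - exact: lebesgue_itv_fin.
  - apply: measurable_funTS.
    apply: (@measurableT_comp _ _ _ _ _ _ _ _ (fun a => (x, a)) measurable_inner_integral).
    by apply: measurable_fun_pair => //; exact: measurable_cst.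
  - by move=> a; exact: inner_integral_bound.
apply: eq_Rintegral => a _; rewrite RintegralZl//.
apply: (@bounded_integrable_section _ _ _ _ _ _ M) => //.
by apply: measurable_funTS; exact: measurable_fun_pair2.
Qed.

Lemma measurable_Aint : measurable_fun setT (fun x => Aint (fun a b => f (x, a, b))).
Proof.
have pfin : (leb1 R `[0%R, pi]%classic < +oo)%E by exact: lebesgue_itv_fin.
by apply: (@measurable_Rintegral_param _ _ _ _ _ (leb1 R) _ _ pfin
 (fun z => \int[leb1 R]_(b in `[0, pi *+ 2]) f (z, b)) _ measurable_inner_integral inner_integral_bound).
Qed.

Lemma Aint_bound (x : T1) : `|Aint (fun a b => f (x, a, b))| <=
  M * fine (leb1 R `[0%R, (pi *+ 2)%R]%classic) * fine (leb1 R `[0%R, pi]%classic).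
Proof.
have pfin : (leb1 R `[0%R, pi]%classic < +oo)%E by exact: lebesgue_itv_fin.
apply: (@Rintegral_bound _ (measurableTypeR R) (leb1 R) `[0%R, pi]%classic
  (fun a => \int[leb1 R]_(b in `[0, pi *+ 2]) f (x, a, b))) => //.
- apply: (@measurableT_comp _ _ _ _ _ _ _ _ (fun a => (x, a)) measurable_inner_integral).
  by apply: measurable_fun_pair => //; exact: measurable_cst.
- by move=> a; exact: inner_integral_bound.
Qed.

End Swap3.

Section Pairing.
Context {R : realType}.
Local Notation V := (R * R * R)%type.
Local Notation T3 := (measurableTypeR R * measurableTypeR R * measurableTypeR R)%type.

Definition cube (m : R) : set T3 := ((`[-m, m] `*` `[-m, m]) `*` `[-m, m])%classic.

Lemma measurable_cube (m : R) : measurable (cube m).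
Proof. by apply: measurableX; [apply: measurableX|]; exact: measurable_itv. Qed.

Lemma cube_finite (m : R) : (leb3 R (cube m) < +oo)%E.
Proof.
have h := lebesgue_itv_fin (-m) m.
rewrite /= product_measure1E; [|by apply: measurableX; exact: measurable_itv|exact: measurable_itv].
pose I : set (measurableTypeR R) := `[-m, m]%classic.
have h2 : ((leb1 R \x leb1 R)%E (I `*` I)%classic < +oo)%E.
  rewrite product_measure1E; [|exact: measurable_itv|exact: measurable_itv].
  by apply: lte_mul_pinfty => //; rewrite ge0_fin_numE.
by apply: lte_mul_pinfty => //; rewrite ge0_fin_numE.
Qed.

Lemma box_cube (m : R) (X : V) : box m X <-> cube m X.
Proof.
case: X => [[x y] z]; rewrite /box /cube /= !in_itv /= !prod_normE /= !ge_max !ler_norml.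
by split=> [/andP[/andP[-> ->] ->]|[[-> ->] ->]].
Qed.

Lemma bounded_support_integrable (f : V -> R) (m M : R) :
  measurable_fun setT f -> (forall X, `|f X| <= M) -> supported_in (box m) f ->
  (leb3 R).-integrable setT (EFin \o f).
Proof.
move=> mf bf sf.
have h : (leb3 R).-integrable (cube m) (EFin \o f).
  refine (@bounded_integrable_section R _ T3 (leb3 R) (cube m) f M (measurable_cube m) (cube_finite m) _ bf).
  exact: measurable_funTS.
have := (@integrable_mkcond _ T3 R (leb3 R) (cube m) (EFin \o f) (measurable_cube m)).1 h.
congr (_.-integrable _ _); apply/funext => X; rewrite patchE.
case: ifPn => //; rewrite notin_setE => nX /=; congr EFin; apply/esym/sf.
by move=> /box_cube.
Qed.

Lemma Rintegral_cube (f : V -> R) (m : R) : supported_in (box m) f ->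
  \int[leb3 R]_X f X = \int[leb3 R]_(X in cube m) f X.
Proof.
move=> sf; rewrite [RHS]Rintegral_mkcond; congr Rintegral.
apply/funext => X; rewrite patchE.
by case: ifPn => //; rewrite notin_setE => nX; apply: sf => /box_cube.
Qed.

Lemma measurable_Theta : measurable_fun setT (@Theta R).
Proof.
rewrite (_ : Theta = \1_(`[0, +oo[%classic)).
  by apply: measurable_indic; exact: measurable_itv.
apply/funext => s; rewrite /Theta indicE.
have -> : (s \in (`[0, +oo[%classic : set R)) = (0 <= s).
  by apply/idP/idP; rewrite inE /= in_itv /= andbT.
by case: ifP.
Qed.

Lemma Theta_bound (s : R) : `|Theta s| <= 1.
Proof. by rewrite /Theta; case: ifP => _; rewrite ?normr1 ?normr0. Qed.

Lemma measurable_test (psi : V -> R) : is_test psi -> measurable_fun setT psi.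
Proof. by move=> [sp _]; apply: continuous_measurable3; exact: (sp [::]).1. Qed.

Lemma measurable_Theta_shift (g : T3 -> R) (k : R) : measurable_fun setT g ->
  measurable_fun setT (fun X => Theta (g X - k)).
Proof.
move=> mg; apply: (measurableT_comp measurable_Theta).
by apply: measurable_funB => //; exact: measurable_cst.
Qed.

Lemma regular_translate (psi : V -> R) (h : V) : is_test psi ->
  regular_distr (riemann_v0 c2) (tr h psi) =
  \int[leb3 R]_X (Theta (X.1.1 - h.1.1) * Theta (X.2 - h.2) * psi X).
Proof.
move=> tp.
pose f (X : V) := Theta (X.1.1 - h.1.1) * Theta (X.2 - h.2) * psi X.
have mf : measurable_fun setT f.
  apply: measurable_funM; last exact: measurable_test.
  by apply: measurable_funM; apply: measurable_Theta_shift => //; exact: measurableT_comp.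
have E X : f (X + h) = riemann_v0 c2 X * tr h psi X.
  case: X => [[x y] z]; rewrite /f /tr /riemann_v0 /=.
  by congr (Theta _ * Theta _ * _); rewrite addrK.
rewrite -[RHS]/(\int[leb3 R]_X f X) -(Rintegral_translate h f mf).
  by congr Rintegral; apply/funext => X; rewrite E.
have tth := is_test_tr h _ tp.
have [m m0 sm] := is_test_box _ tth; have [M M0 HM] := test_bounded _ tth.
apply: (@bounded_support_integrable _ m M).
- rewrite (_ : (fun X => f (X + h)) = (fun X => Theta (X.1.1 - 0) * Theta (X.2 - 0) * tr h psi X)).
    apply: measurable_funM; last exact: measurable_test.
    by apply: measurable_funM; apply: measurable_Theta_shift => //; exact: measurableT_comp.
  by apply/funext => -[[x y] z]; rewrite E /riemann_v0 /= !subr0.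
- case=> [[x y] z]; rewrite E /riemann_v0 /= !normrM -[leRHS]mul1r.
  by apply: ler_pM => //; rewrite -[leRHS]mul1r; apply: ler_pM => //; exact: Theta_bound.
- by move=> X nX; rewrite E sm// mulr0.
Qed.

Definition Ikern (r : R) (X : V) (a b : R) : R :=
  sin a * (om c0 a b * om c2 a b) * Theta (X.1.1 - r * (sin a * cos b))
    * Theta (X.2 - r * cos a).

Lemma measurable_Ikern (r : R) (g : T3 -> R) : measurable_fun setT g ->
  measurable_fun setT
    (fun z : T3 * measurableTypeR R * measurableTypeR R => Ikern r z.1.1 z.1.2 z.2 * g z.1.1).
Proof.
move=> mg.
have m11 : measurable_fun setT (fun z : T3 * measurableTypeR R * measurableTypeR R => z.1.1).
  exact: measurableT_comp.
have ma : measurable_fun setT (fun z : T3 * measurableTypeR R * measurableTypeR R => z.1.2).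
  exact: measurableT_comp.
have mb : measurable_fun setT (fun z : T3 * measurableTypeR R * measurableTypeR R => z.2).
  exact: measurable_snd.
have mx : measurable_fun setT (fun z : T3 * measurableTypeR R * measurableTypeR R => z.1.1.1.1).
  apply: (measurableT_comp measurable_fst).
  by apply: (measurableT_comp measurable_fst); exact: m11.
have mz : measurable_fun setT (fun z : T3 * measurableTypeR R * measurableTypeR R => z.1.1.2).
  by apply: (measurableT_comp measurable_snd); exact: m11.
have msin (h : _ -> R) : measurable_fun setT h -> measurable_fun setT (fun z : T3 * measurableTypeR R * measurableTypeR R => sin (h z)).
  by move=> mh; apply: measurableT_comp mh; apply: continuous_measurable_fun; exact: continuous_sin.
have mcos (h : _ -> R) : measurable_fun setT h -> measurable_fun setT (fun z : T3 * measurableTypeR R * measurableTypeR R => cos (h z)).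
  by move=> mh; apply: measurableT_comp mh; apply: continuous_measurable_fun; exact: continuous_cos.
have sa := msin _ ma; have ca := mcos _ ma; have cb := mcos _ mb.
apply: measurable_funM; last exact: (measurableT_comp mg).
apply: measurable_funM; last first.
  apply: (measurableT_comp measurable_Theta); apply: measurable_funB => //.
  by apply: measurable_funM => //; exact: measurable_cst.
apply: measurable_funM; last first.
  apply: (measurableT_comp measurable_Theta); apply: measurable_funB => //.
  apply: measurable_funM; first exact: measurable_cst.
  exact: measurable_funM.
apply: measurable_funM => //; rewrite /om /=.
by apply: measurable_funM => //; exact: measurable_funM.
Qed.

Lemma Ikern_bound (r : R) X a b : `|Ikern r X a b| <= 1.
Proof.
have h (x y : R) : `|x| <= 1 -> `|y| <= 1 -> `|x * y| <= 1.
  by move=> hx hy; rewrite normrM -[leRHS]mul1r; exact: ler_pM.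
rewrite /Ikern /om /=; do 2 (apply: (h); last exact: Theta_bound).
apply: (h); first exact: sin_max.
by apply: (h); [apply: (h); [exact: sin_max|exact: cos_max]|exact: cos_max].
Qed.

Lemma I_sphE (r : R) X : I_sph r X = Aint (fun a b => r ^+ 2 * Ikern r X a b).
Proof.
case: X => [[x y] z]; rewrite /I_sph /sphere_int -/(Aint _); apply: eq_Aint => a b.
rewrite /Ikern /om /=.
have [->|r0] := eqVneq r 0; first by rewrite expr0n /= !mul0r.
by move: (sin a) (cos a) (cos b) (Theta _) (Theta _) => *; field.
Qed.

Lemma I_sph_pairing (psi : V -> R) (r : R) : is_test psi ->
  \int[leb3 R]_X (I_sph r X * psi X) =
  r ^+ 2 * Aint (fun a b => sin a * (om c0 a b * (om c2 a b *
    regular_distr (riemann_v0 c2) (tr (sp r a b) psi)))).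
Proof.
move=> tp.
have [m m0 sm] := is_test_box _ tp; have [M M0 HM] := test_bounded _ tp.
have mp := measurable_test _ tp.
pose f (z : T3 * measurableTypeR R * measurableTypeR R) := Ikern r z.1.1 z.1.2 z.2 * psi z.1.1.
have mf : measurable_fun setT f by exact: measurable_Ikern.
have bf z : `|f z| <= M.
  by rewrite normrM -[leRHS]mul1r; apply: ler_pM => //; exact: Ikern_bound.
pose k (z : T3 * measurableTypeR R * measurableTypeR R) := Ikern r z.1.1 z.1.2 z.2 * 1.
have mk : measurable_fun setT k by apply: (measurable_Ikern r (cst 1)); exact: measurable_cst.
have bk z : `|k z| <= 1 by rewrite /k mulr1; exact: Ikern_bound.
rewrite (Rintegral_cube _ m); last by move=> X nX; rewrite sm// mulr0.
have E X : I_sph r X * psi X = r ^+ 2 * Aint (fun a b => f (X, a, b)).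
  rewrite I_sphE.
  have -> : Aint (fun a b => r ^+ 2 * Ikern r X a b) = r ^+ 2 * Aint (fun a b => k (X, a, b)).
    rewrite (AintZl_bounded _ _ k 1 mk bk (r ^+ 2) X); apply: eq_Aint => a b.
    by rewrite /k mulr1.
  rewrite -mulrA; congr (_ * _); rewrite mulrC (AintZl_bounded _ _ k 1 mk bk (psi X) X).
  by apply: eq_Aint => a b; rewrite /k /f mulr1 mulrC.
under eq_Rintegral do rewrite E.
rewrite RintegralZl; last 2 first.
- exact: measurable_cube.
- apply: (bounded_integrable_section _ _ _ _ _ _ (measurable_cube m) (cube_finite m)).
    by apply: measurable_funTS; exact: (measurable_Aint _ _ f M mf bf).
  by move=> X; exact: (Aint_bound _ _ f M mf bf X).
congr (_ * _).
have H := Rintegral_swap_Aint _ _ (leb3s : {sigma_finite_measure set T3 -> \bar R}) (cube m) (measurable_cube m) (cube_finite m) f M mf bf.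
rewrite [LHS]H; apply: eq_Aint => a b.
rewrite regular_translate//.
rewrite (Rintegral_cube _ m); last by move=> X nX; rewrite sm// mulr0.
pose G := (fun X : V => Theta (X.1.1 - (sp r a b).1.1) * Theta (X.2 - (sp r a b).2) * psi X).
have EG : \int[leb3 R]_(X in cube m) (sin a * om c0 a b * om c2 a b * G X) =
   sin a * om c0 a b * om c2 a b * \int[leb3 R]_(X in cube m) G X.
  apply: (@RintegralZl _ T3 R (leb3 R) (cube m) G _ (measurable_cube m)).
  refine (@bounded_integrable_section R _ T3 (leb3 R) (cube m) G M (measurable_cube m) (cube_finite m) _ _).
    apply: measurable_funTS; apply: measurable_funM => //.
    by apply: measurable_funM; apply: measurable_Theta_shift => //; exact: measurableT_comp.
  move=> X; rewrite /G !normrM -[leRHS]mul1r; apply: ler_pM => //.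
  by rewrite -[leRHS]mul1r; apply: ler_pM => //; exact: Theta_bound.
rewrite [RHS]mulrA [RHS]mulrA; apply: (etrans _ EG).
apply: eq_Rintegral => X _; rewrite /f /Ikern /G /sp /=.
by move: (psi X) (sin a) (om c0 a b) (om c2 a b) (Theta _) (Theta _) => *; ring.
Qed.

End Pairing.

Section Formula.
Context {R : realType}.
Local Notation V := (R * R * R)%type.

Lemma radial_op_flux (g : V -> R) (g_ k_ : 'I_3 -> V -> R) (F : R -> R) (r : R) :
  has_grad g g_ -> has_grad (g_ c0) k_ ->
  (forall q, F q = q ^+ 2 * Aint (fun a b => sin a * (om c0 a b * (om c2 a b * g (sp q a b))))) ->
  r^-1 * derive1 (fun s => s^-1 * derive1 (fun q => q * F q) s) r =
  r * Aint (fun a b => sin a * k_ c2 (sp r a b)).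
Proof.
move=> hg hk FE.
have [cg cg_ _] := hg; have [_ ck_ _] := hk.
have hG s : rcont (fun z : R * R => g (sp s z.1 z.2)) by exact: rcont_sp2.
have hG_ s j : rcont (fun z : R * R => g_ j (sp s z.1 z.2)) by exact: rcont_sp2.
have qF q : q * F q = q ^+ 2 * Aint (fun a b => sin a * (om c0 a b * ((sp q a b).2 * g (sp q a b)))).
  rewrite FE mulrCA -(AintZ q); last by rewrite /cont2 -/(rcont _); have h := hG q; rc.
  apply: (congr1 (fun A => q ^+ 2 * A)); apply: eq_Aint => a b.
  rewrite (_ : (sp q a b).2 = q * om c2 a b)//.
  by move: (g _) (sin a) (om c0 a b) (om c2 a b) => *; ring.
rewrite (_ : (fun q => q * F q) = fun q => q ^+ 2 *
    Aint (fun a b => sin a * (om c0 a b * ((sp q a b).2 * g (sp q a b))))); last first.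
  by apply/funext => q; exact: qF.
have d1 s := is_derive_flux (fun h => h.2 * g h) _ c0 s (has_grad_zmul _ _ hg).
rewrite [X in derive1 X r](_ : _ = fun s => s ^+ 2 *
    Aint (fun a b => sin a * (om c2 a b * g_ c0 (sp s a b)))); last first.
  apply/funext => s; rewrite derive1E (@derive_val _ _ _ _ _ _ _ (d1 s)).
  rewrite (_ : Aint _ = s * Aint (fun a b => sin a * (om c2 a b * g_ c0 (sp s a b)))).
    have [->|s0] := eqVneq s 0; first by rewrite invr0 expr0n /= !mul0r.
    by move: (Aint _) => A; field.
  rewrite -(AintZ s); last by rewrite /cont2 -/(rcont _); have h := hG_ s; rc.
  apply: eq_Aint => a b; rewrite (_ : (sp s a b).2 = s * om c2 a b)//= addr0.
  by move: (g_ _ _) (sin a) (om c2 a b) => *; ring.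
have d2 := is_derive_flux (g_ c0) _ c2 r hk.
rewrite derive1E (@derive_val _ _ _ _ _ _ _ d2).
have [->|r0] := eqVneq r 0; first by rewrite invr0 !mul0r.
by move: (Aint _) => A; field.
Qed.

Lemma distr_solution_vx_formula (c : R) (v : 'I_3 -> R -> @functional R)
    (p : R -> @functional R) (t : R) psi :
  0 < c -> distr_solution c riemann_v0 riemann_p0 v p -> 0 < t -> is_test psi ->
  v c0 t psi = vx_formula c t psi.
Proof.
move=> hc [v' [p' [[Cv Cp] eqv eqp v0E p0E]]] t0 tp.
have d2 : is_distribution (v c2 0) by exact: ((Cv c2).1 0 (lexx _)).1.
have z p0 : is_test p0 -> p 0 p0 = 0 by move=> tp0; rewrite p0E// regular_distr_zero.
have z0 p0 : is_test p0 -> v c0 0 p0 = 0.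
  by move=> tp0; rewrite v0E// regular_distr_zero// => -[[]].
have z1 p0 : is_test p0 -> v c1 0 p0 = 0.
  by move=> tp0; rewrite v0E// regular_distr_zero// => -[[]].
rewrite (distr_solution_velocity c v v' p p' t psi hc Cv Cp eqv eqp z z0 z1 t0 tp).
rewrite /vx_formula /radial_op.
have tf : is_test (partial c0 psi) by exact: (is_test_partials [:: c0] _ tp).
have hg := has_grad_distr _ _ d2 tp.
have hk := has_grad_distr _ _ d2 tf.
congr (_ * _); apply: eq_Rintegral => r _.
rewrite (radial_op_flux _ _ _ _ r hg hk)// => q.
rewrite (I_sph_pairing _ _ tp); apply: (congr1 (fun A => q ^+ 2 * A)).
apply: eq_Aint => a b.
have -> : regular_distr (riemann_v0 c2) (tr (sp q a b) psi) = v c2 0 (tr (sp q a b) psi).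
  by apply: esym; apply: v0E; exact: is_test_tr.
by [].
Qed.

End Formula.

(** * An improper integral *)

Section Improper.
Context {R : realType}.
Implicit Types (f F : R -> R) (a b : R).

Lemma integral_left_singularity f F a b : a < b ->
  (forall x, a < x -> 0 <= f x) ->
  (forall x, a < x -> {for x, continuous f}) ->
  (forall x, a < x -> is_derive x (1 : R) F (f x)) ->
  {for a, continuous F} ->
  (\int[leb1 R]_(x in `]a, b]) (f x)%:E = (F b - F a)%:E)%E.
Proof.
move=> ab f0 cf dF cF.
pose h n : R := (b - a) * n.+2%:R^-1.
pose A n : set R := `[a + h n, b]%classic.
have ba0 : 0 < b - a by rewrite subr_gt0.
have h0 n : 0 < h n by rewrite /h mulr_gt0// invr_gt0.
have hb n : a + h n < b.
  rewrite -ltrBrDl /h gtr_pMr// invf_lt1 ?ltr0n//; by rewrite ltr1n.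
have hle m n : (m <= n)%N -> h n <= h m.
  move=> mn; rewrite /h ler_pM2l// lef_pV2 ?posrE ?ltr0n//.
  by rewrite ler_nat.
have h_0 : h n @[n --> \oo] --> 0.
  rewrite -(mulr0 (b - a)); apply: cvgM; first exact: cvg_cst.
  have H : (fun n => (n.+1%:R : R)^-1) @ \oo --> 0 by exact: cvg_harmonic.
  by have := H; rewrite -(cvg_shiftn 1) => G; under eq_fun do rewrite -addn1; exact: G.
have AE : \bigcup_n A n = `]a, b]%classic.
  apply/seteqP; split=> x.
    move=> [n _]; rewrite /A /= !in_itv /= => /andP[hx ->]; rewrite andbT.
    by apply: lt_le_trans hx; rewrite ltrDl.
  rewrite /= in_itv /= => /andP[ax xb].
  have xa0 : 0 < x - a by rewrite subr_gt0.
  have /cvgrPdist_le /(_ _ xa0) [N _ HN] := h_0.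
  exists N => //; rewrite /A /= in_itv /= xb andbT -lerBrDl.
  have := HN N (leqnn _); rewrite /= sub0r normrN; apply: le_trans; exact: ler_norm.
have cfA n : {within A n, continuous f}.
  apply: continuous_in_subspaceT => x; rewrite inE /A /= in_itv /= => /andP[hx _].
  by apply: cf; apply: lt_le_trans hx; rewrite ltrDl.
have mf n : measurable_fun (A n) (EFin \o f).
  by apply/measurable_EFinP; apply: subspace_continuous_measurable_fun; [exact: measurable_itv|exact: cfA].
have := @ge0_nondecreasing_set_cvg_integral _ (measurableTypeR R) R A (EFin \o f) (leb1 R) _ (fun n => measurable_itv _) mf _.
rewrite AE => H.
have IE n : (\int[leb1 R]_(x in A n) (f x)%:E = (F b - F (a + h n))%:E)%E.
  have pos x : a + h n <= x -> a < x by apply: lt_le_trans; rewrite ltrDl.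
  rewrite /A (@continuous_FTC2 _ f F) ?EFinB//.
  - exact: cfA.
  - split.
    + move=> x; rewrite in_itv /= => /andP[/ltW/pos hx _].
      exact: (@ex_derive _ _ _ _ _ _ _ (dF x hx)).
    + apply: cvg_at_right_filter.
      have d := dF _ (pos _ (lexx _)).
      by apply: differentiable_continuous; apply/derivable1_diffP; exact: (@ex_derive _ _ _ _ _ _ _ d).
    + apply: cvg_at_left_filter.
      have d := dF _ ab.
      by apply: differentiable_continuous; apply/derivable1_diffP; exact: (@ex_derive _ _ _ _ _ _ _ d).
  - move=> x; rewrite in_itv /= => /andP[/ltW/pos hx _].
    by rewrite derive1E (@derive_val _ _ _ _ _ _ _ (dF x hx)).
have nnd : nondecreasing_seq A.
  move=> m n mn; rewrite subsetEset => x; rewrite /A /= !in_itv /= => /andP[hx ->].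
  by rewrite andbT; apply: le_trans hx; rewrite lerD2l; exact: hle.
have Af0 i x : A i x -> (0 <= (EFin \o f) x)%E.
  rewrite /A /= in_itv /= lee_fin => /andP[hx _].
  by apply: f0; apply: lt_le_trans hx; rewrite ltrDl.
have {}H := H nnd Af0.
suff H2 : (\int[leb1 R]_(x in A n) (EFin \o f) x)%E @[n --> \oo] --> (F b - F a)%:E.
  exact: (cvg_unique _ H H2).
under eq_fun do rewrite IE.
apply: cvg_EFin; first exact: nearW.
apply: cvgB; first exact: cvg_cst.
have hh : (fun n => a + h n) @ \oo --> a.
  by rewrite -[X in _ --> X]addr0; apply: cvgD; [exact: cvg_cst|exact: h_0].
by apply: (@continuous_cvg _ _ _ \oo _ _ F); [exact: cF|exact: hh].
Qed.

Lemma measurable_continuous_itv_oc f a b :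
  (forall x, a < x -> {for x, continuous f}) -> measurable_fun `]a, b] f.
Proof.
move=> cf; apply: (@measurable_funS _ _ _ _ `]a, +oo[%classic) => //.
  by move=> x; rewrite /= !in_itv /= => /andP[->].
apply: open_continuous_measurable_fun => // x; rewrite inE /= in_itv /= andbT.
exact: cf.
Qed.

Lemma Rintegral_left_singularity f F a b : a < b ->
  (forall x, a < x -> 0 <= f x) ->
  (forall x, a < x -> {for x, continuous f}) ->
  (forall x, a < x -> is_derive x (1 : R) F (f x)) ->
  {for a, continuous F} ->
  \int[leb1 R]_(x in `[a, b]) f x = F b - F a.
Proof.
move=> ab f0 cf dF cF.
rewrite /Rintegral -integral_itv_obnd_cbnd ?(integral_left_singularity f F)//.
by apply/measurable_EFinP; exact: measurable_continuous_itv_oc.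
Qed.

Lemma continuous_sqrt_sqrB (m x : R) :
  {for x, continuous (fun r : R => Num.sqrt (r ^+ 2 - m))}.
Proof.
apply: (@continuous_cvg _ _ _ _ _ (fun r : R => r ^+ 2 - m) Num.sqrt).
  exact: sqrt_continuous.
by apply: cvgB; [exact: exprn_continuous|exact: cvg_cst].
Qed.

Lemma continuous_inv_sqrt_sqrB (m x : R) : 0 < x ^+ 2 - m ->
  {for x, continuous (fun r : R => (Num.sqrt (r ^+ 2 - m))^-1)}.
Proof.
move=> h; apply: cvgV; last exact: continuous_sqrt_sqrB.
by rewrite lt0r_neq0// sqrtr_gt0.
Qed.

Lemma is_derive_sqrt_sqrB (m x : R) : 0 < x ^+ 2 - m ->
  is_derive x (1 : R) (fun r : R => Num.sqrt (r ^+ 2 - m)) (x / Num.sqrt (x ^+ 2 - m)).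
Proof.
move=> h.
have d1 : is_derive x (1 : R) (fun r : R => r ^+ 2 - m) (2 * x).
  by apply: is_derive_eq; rewrite /GRing.scale /=; ring.
have d2 : is_derive x (1 : R) (fun r : R => Num.sqrt (r ^+ 2 - m)) _ :=
  @is_derive1_comp _ Num.sqrt (fun r : R => r ^+ 2 - m) x _ _ (is_derive1_sqrt h) d1.
apply: (is_derive_eq d2).
have w0 : 0 < Num.sqrt (x ^+ 2 - m) by rewrite sqrtr_gt0.
by move: (Num.sqrt _) w0 => w w0; field; rewrite lt0r_neq0.
Qed.

Lemma Rintegral_inv_sqrt a b : 0 < a <= b ->
  \int[leb1 R]_(r in `[a, b]) (Num.sqrt (r ^+ 2 - a ^+ 2))^-1 = Lfun (a / b).
Proof.
move=> /andP[a0]; rewrite le_eqVlt => /predU1P[<-|ab].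
  rewrite set_itv1 Rintegral_set1 /Lfun divff ?lt0r_neq0//.
  by rewrite expr1n subrr sqrtr0 addr0 divr1 ln1.
have sq_gt0 r : a < r -> 0 < r ^+ 2 - a ^+ 2.
  by move=> ar; rewrite subr_gt0 ltr_pXn2r// nnegrE ltW// (lt_trans a0).
pose F (r : R) := ln (r + Num.sqrt (r ^+ 2 - a ^+ 2)).
have dF x : a < x -> is_derive x (1 : R) F (Num.sqrt (x ^+ 2 - a ^+ 2))^-1.
  move=> ax; have s0 := sq_gt0 x ax.
  have x0 : 0 < x by exact: lt_trans ax.
  have w0 : 0 < Num.sqrt (x ^+ 2 - a ^+ 2) by rewrite sqrtr_gt0.
  have d2 := is_derive_sqrt_sqrB _ _ s0.
  have d3 : is_derive x (1 : R) (fun r : R => r + Num.sqrt (r ^+ 2 - a ^+ 2)) _ :=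
    is_deriveD (is_derive_id _ _) d2.
  have xw0 : 0 < x + Num.sqrt (x ^+ 2 - a ^+ 2) by rewrite addr_gt0.
  have d4 : is_derive x (1 : R) F _ :=
    (@is_derive1_comp _ (@ln R) (fun r : R => r + Num.sqrt (r ^+ 2 - a ^+ 2)) x _ _ (is_derive1_ln xw0) d3).
  apply: (is_derive_eq d4).
  move: (Num.sqrt _) w0 xw0 => w w0 xw0.
  by rewrite /GRing.scale /=; field; rewrite !lt0r_neq0.
have cF : {for a, continuous F}.
  apply: (@continuous_cvg _ _ _ _ _ (fun r : R => r + Num.sqrt (r ^+ 2 - a ^+ 2)) (@ln R)).
    by apply: continuous_ln; rewrite ltr_wpDr ?sqrtr_ge0.
  by apply: cvgD; [exact: cvg_id|exact: continuous_sqrt_sqrB].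
have f0 x : a < x -> 0 <= (Num.sqrt (x ^+ 2 - a ^+ 2))^-1.
  by move=> _; rewrite invr_ge0 sqrtr_ge0.
have cf x : a < x -> {for x, continuous (fun r : R => (Num.sqrt (r ^+ 2 - a ^+ 2))^-1)}.
  by move=> ax; apply: continuous_inv_sqrt_sqrB; exact: sq_gt0.
rewrite (Rintegral_left_singularity _ F _ _ ab f0 cf dF cF).
have b0 : 0 < b by exact: lt_trans ab.
rewrite /F subrr sqrtr0 addr0 -ln_div ?posrE ?ltr_wpDr ?sqrtr_ge0// /Lfun.
congr ln.
have -> : Num.sqrt (b ^+ 2 - a ^+ 2) = b * Num.sqrt (1 - (a / b) ^+ 2).
  rewrite [X in X * _](_ : b = Num.sqrt (b ^+ 2)); last by rewrite sqrtr_sqr gtr0_norm.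
  rewrite -sqrtrM ?sqr_ge0//; congr Num.sqrt.
  by field; rewrite lt0r_neq0.
by move: (Num.sqrt _) => w; field; rewrite !lt0r_neq0.
Qed.

End Improper.

(** * Values on the plane x = 0 *)

Section Plane.
Context {R : realType}.

Lemma Rintegral_split (f : R -> R) (a m b : R) : a <= m <= b ->
  (leb1 R).-integrable `[a, b] (EFin \o f) ->
  \int[leb1 R]_(x in `[a, b]) f x =
  \int[leb1 R]_(x in `[a, m[) f x + \int[leb1 R]_(x in `[m, b]) f x.
Proof.
move=> /andP[am mb].
rewrite (@itv_bndbnd_setU _ _ (BLeft a) (BLeft m) (BRight b)) ?bnd_simp// => itf.
rewrite Rintegral_setU//.
apply/disj_setPS => y [/=]; rewrite 2!in_itv/= => /andP[_ ym] /andP[my _].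
by move: ym; rewrite ltNge my.
Qed.

Lemma Rintegral_eq0 (A : set R) (f : R -> R) : measurable A ->
  (forall x, A x -> f x = 0) -> \int[leb1 R]_(x in A) f x = 0.
Proof.
move=> mA f0; rewrite (@eq_Rintegral _ (measurableTypeR R) R (leb1 R) _ (cst 0)).
  by rewrite Rintegral_cst// mul0r.
by move=> x; rewrite inE => /f0.
Qed.

Lemma Rintegral_min_cos :
  \int[leb1 R]_(b in `[0, pi *+ 2]) Num.min (cos b) 0 = - 2.
Proof.
have p0 : 0 < pi :> R := pi_gt0 R.
have p2 : pi / 2 *+ 2 = pi :> R by rewrite -mulr_natr divfK.
have cm : continuous (fun b : R => Num.min (cos b) 0).
  move=> x.
  have H : {for x, continuous ((@cos R) \min cst 0)}.
    by apply: continuous_min; [exact: continuous_cos|exact: cvg_cst].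
  exact: H.
have itf (a b : R) := continuous_itv_integrable a b _ cm.
rewrite (Rintegral_split _ _ (pi / 2) _ _ (itf _ _)); last first.
  by rewrite -p2; move: (pi / 2) (divr_gt0 p0 (ltr0n R 2)) => q q0; apply/andP; split; lra.
rewrite (Rintegral_split _ _ (pi / 2 + pi) _ _ (itf _ _)); last first.
  by rewrite -p2; move: (pi / 2) (divr_gt0 p0 (ltr0n R 2)) => q q0; apply/andP; split; lra.
rewrite [X in X + _]Rintegral_eq0; [|exact: measurable_itv|]; last first.
  move=> x; rewrite /= in_itv /= => /andP[x0 xp]; rewrite min_r//.
  by apply: cos_ge0_pihalf; move: (pi / 2) xp => q xp; apply/andP; split; lra.
rewrite [X in _ + (_ + X)]Rintegral_eq0; [|exact: measurable_itv|]; last first.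
  move=> x; rewrite /= in_itv /= => /andP[x0 xp]; rewrite min_r//.
  rewrite -[x](subrK (pi *+ 2)) cosD2pi.
  apply: cos_ge0_pihalf; rewrite -p2 in x0 xp *; move: (pi / 2) x0 xp => q x0 xp.
  by apply/andP; split; lra.
rewrite add0r addr0 Rintegral_itv_bndo_bndc; last first.
  by apply: (integrableS _ _ _ (itf (pi / 2) (pi / 2 + pi))) => //; move=> x; rewrite /= !in_itv /= => /andP[-> /ltW ->].
rewrite (@eq_Rintegral _ (measurableTypeR R) R (leb1 R) _ (@cos R)); last first.
  move=> x; rewrite inE /= in_itv /= => /andP[x0 xp]; rewrite min_l//.
  rewrite -[x](subrK pi) cosDpi oppr_le0; apply: cos_ge0_pihalf.
  by rewrite -p2 in x0 xp *; move: (pi / 2) x0 xp => q x0 xp; apply/andP; split; lra.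
rewrite (Rintegral_FTC _ (@sin R)).
- by rewrite sinDpi sin_pihalf; ring.
- by rewrite ltrDl.
- exact: continuous_cos.
Qed.

Lemma mulr_Theta_opp (k x : R) : 0 < k -> x * Theta (0 - k * x) = Num.min x 0.
Proof.
move=> k0; rewrite /Theta sub0r oppr_ge0 pmulr_rle0//.
by case: leP; rewrite ?mulr1 ?mulr0.
Qed.

Lemma I_sph_plane (r y z : R) : 0 < r ->
  I_sph r (0, y, z) = \int[leb1 R]_(a in `[0, pi])
    (- 2 * r ^+ 2 * (sin a ^+ 2 * cos a) * Theta (z - r * cos a)).
Proof.
move=> r0; rewrite I_sphE /Aint; apply: eq_Rintegral => a.
rewrite inE /= in_itv /= => aI.
pose K := r ^+ 2 * (sin a ^+ 2 * cos a) * Theta (z - r * cos a).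
have cm : continuous (fun b : R => Num.min (cos b) 0).
  move=> x.
  have H : {for x, continuous ((@cos R) \min cst 0)}.
    by apply: continuous_min; [exact: continuous_cos|exact: cvg_cst].
  exact: H.
rewrite (@eq_Rintegral _ (measurableTypeR R) R (leb1 R) _ (fun b => K * Num.min (cos b) 0)).
  rewrite RintegralZl//; last exact: continuous_itv_integrable.
  by rewrite Rintegral_min_cos /K; move: (Theta _) => w; ring.
move=> b _; rewrite /Ikern /om /= /K.
have := sin_ge0_pi aI; rewrite le_eqVlt => /predU1P[<-|s0].
  by rewrite expr0n /= !(mul0r, mulr0).
rewrite -(mulr_Theta_opp (r * sin a)) ?mulr_gt0//.
rewrite (mulrA r (sin a)).
by move: (Theta _) (Theta _) => *; ring.
Qed.

Lemma Rintegral_sin2cos (k a b : R) : a < b ->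
  \int[leb1 R]_(x in `[a, b]) (- 2 * k * (sin x ^+ 2 * cos x)) =
  - 2 * k * (sin b ^+ 3 - sin a ^+ 3) / 3.
Proof.
move=> ab.
have c : continuous (fun x : R => - 2 * k * (sin x ^+ 2 * cos x)).
  have H : rcont (fun x : R => - 2 * k * (sin x * sin x * cos x)) by rc.
  exact: H.
have d (x : R) : is_derive x (1 : R) (fun x => - 2 * k * sin x ^+ 3 / 3)
    (- 2 * k * (sin x ^+ 2 * cos x)).
  by apply: is_derive_eq; rewrite /GRing.scale /=; field.
by rewrite (Rintegral_FTC _ _ _ _ ab c d); field.
Qed.

Lemma I_sph_plane_out (r y z : R) : 0 < r < `|z| -> I_sph r (0, y, z) = 0.
Proof.
move=> /andP[r0 rz]; rewrite I_sph_plane//.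
have cr (a : R) : `|r * cos a| < `|z|.
  apply: le_lt_trans rz; rewrite normrM (gtr0_norm r0) ger_pMr//.
  by rewrite ler_norml cos_geN1 cos_le1.
have [z0|z0] := leP 0 z.
  rewrite (@eq_Rintegral _ (measurableTypeR R) R (leb1 R) _ (fun a => - 2 * r ^+ 2 * (sin a ^+ 2 * cos a))).
    by rewrite Rintegral_sin2cos ?pi_gt0// sinpi sin0 subrr mulr0 mul0r.
  move=> a _; rewrite /Theta; have := cr a; rewrite (ger0_norm z0) => /ltr_normlW h.
  by rewrite subr_ge0 ltW// mulr1.
apply: Rintegral_eq0; first exact: measurable_itv.
move=> a _; rewrite /Theta; have := cr a; rewrite (ltr0_norm z0) ltr_norml opprK => /andP[h _].
by rewrite subr_ge0 leNgt h mulr0.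
Qed.

Lemma I_sph_plane_in (r y z : R) : `|z| < r ->
  r * I_sph r (0, y, z) = 2 / 3 * Num.sqrt (r ^+ 2 - z ^+ 2) ^+ 3.
Proof.
move=> zr; have r0 : 0 < r by exact: le_lt_trans zr.
have zr1 : -1 < z / r < 1.
  by rewrite -ltr_norml normrM normfV (gtr0_norm r0) ltr_pdivrMr// mul1r.
have zr1' : -1 <= z / r <= 1 by case/andP: zr1 => h1 h2; rewrite !ltW.
pose a0 := acos (z / r).
have a0I : 0 <= a0 <= pi by rewrite acos_ge0// acos_lepi.
have a0pi : a0 < pi by apply: acos_ltpi; case/andP: zr1 => -> /ltW ->.
have ca0 : r * cos a0 = z by rewrite /a0 acosK ?in_itv//= mulrC divfK// lt0r_neq0.
have ThE a : 0 <= a <= pi -> Theta (z - r * cos a) = if a0 <= a then 1 else 0.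
  move=> aI; rewrite /Theta subr_ge0 -ca0 ler_pM2l// !leNgt.
  by rewrite (@ltr_cos R a a0) ?in_itv.
pose f (a : R) := - 2 * r ^+ 2 * (sin a ^+ 2 * cos a) * Theta (z - r * cos a).
have itf : (leb1 R).-integrable `[0, pi] (EFin \o f).
  apply: (@bounded_integrable_section R _ (measurableTypeR R) (leb1 R) `[0, pi]%classic f (2 * r ^+ 2)).
  - exact: measurable_itv.
  - exact: lebesgue_itv_fin.
  - apply: measurable_funTS; apply: measurable_funM.
      have H : rcont (fun x : R => - 2 * r ^+ 2 * (sin x * sin x * cos x)) by rc.
      exact: (continuous_measurable_fun H).
    apply: (measurableT_comp measurable_Theta).
    by apply: continuous_measurable_fun; rewrite -/(rcont _); rc.
  - move=> a; rewrite /f normrM -[leRHS]mulr1; apply: ler_pM => //; last exact: Theta_bound.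
    rewrite normrM -[leRHS]mulr1; apply: ler_pM => //.
      by rewrite normrM normrN normr_nat (ger0_norm (sqr_ge0 r)).
    rewrite normrM -[leRHS]mulr1; apply: ler_pM => //; last exact: cos_max.
    by rewrite normrX exprn_ile1// sin_max.
rewrite I_sph_plane// (Rintegral_split f _ _ _ a0I itf).
rewrite Rintegral_eq0; [|exact: measurable_itv|]; last first.
  move=> a; rewrite /= in_itv /= => /andP[h0 h1]; rewrite /f ThE ?h0 /=.
    by rewrite leNgt h1 mulr0.
  by rewrite ltW// (lt_trans h1).
rewrite add0r (@eq_Rintegral _ (measurableTypeR R) R (leb1 R) _ (fun a => - 2 * r ^+ 2 * (sin a ^+ 2 * cos a))).
  rewrite Rintegral_sin2cos// sinpi sin_acos//.
  have -> : Num.sqrt (r ^+ 2 - z ^+ 2) = r * Num.sqrt (1 - (z / r) ^+ 2).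
    rewrite [X in X * _](_ : r = Num.sqrt (r ^+ 2)); last by rewrite sqrtr_sqr gtr0_norm.
    rewrite -sqrtrM ?sqr_ge0//; congr Num.sqrt.
    by field; rewrite lt0r_neq0.
  by move: (Num.sqrt _) => w; field.
move=> a; rewrite inE /= in_itv /= => /andP[h0 h1]; rewrite /f ThE ?h0 ?mulr1//.
by rewrite h1 (le_trans _ h0)//; case/andP: a0I.
Qed.

End Plane.

Section PointValues.
Context {R : realType}.
Implicit Types (r y z c t : R).

Definition radial_integrand (F : R -> R) (r : R) : R :=
  r^-1 * derive1 (fun s => s^-1 * derive1 (fun q => q * F q) s) r.

Lemma near_eq_derive1 (f g : R -> R) (x : R) :
  (\near x, f x = g x) -> derive1 f x = derive1 g x.
Proof. by move=> fg; rewrite !derive1E; apply: near_eq_derive. Qed.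

Lemma near_eq_derive1_near (f g : R -> R) (A : set R) (x : R) : open A -> A x ->
  (forall y, A y -> f y = g y) -> derive1 f x = derive1 g x.
Proof.
move=> oA Ax fg; apply: near_eq_derive1.
by apply: filterS (open_nbhs_nbhs (conj oA Ax)).
Qed.

Lemma radial_integrand_out r y z : 0 < r < `|z| ->
  radial_integrand (fun r => I_sph r (0, y, z)) r = 0.
Proof.
move=> rI; pose A : set R := `]0, `|z|[%classic.
have oA : open A by exact: interval_open.
rewrite /radial_integrand (near_eq_derive1_near _ (cst 0) A)//.
- by rewrite derive1_cst mulr0.
move=> s As; rewrite (near_eq_derive1_near _ (cst 0) A)//.
  by rewrite derive1_cst mulr0.
move=> q Aq; have qI : 0 < q < `|z| by move: Aq; rewrite /A /= in_itv.
by rewrite (I_sph_plane_out q y z qI) mulr0.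
Qed.

Lemma radial_integrand_in r y z : `|z| < r ->
  radial_integrand (fun r => I_sph r (0, y, z)) r = 2 * (Num.sqrt (r ^+ 2 - z ^+ 2))^-1.
Proof.
move=> zr; pose A : set R := `]`|z|, +oo[%classic.
have oA : open A by exact: interval_open.
have pA q : `|z| < q -> 0 < q by apply: le_lt_trans.
have sA q : `|z| < q -> 0 < q ^+ 2 - z ^+ 2.
  move=> zq; rewrite subr_gt0 -(real_normK (num_real z)) ltr_pXn2r//.
  by rewrite nnegrE ltW// pA.
have step s : `|z| < s ->
    s^-1 * derive1 (fun q => q * I_sph q (0, y, z)) s = 2 * Num.sqrt (s ^+ 2 - z ^+ 2).
  move=> zs.
  rewrite (near_eq_derive1_near _ (fun q => 2 / 3 * Num.sqrt (q ^+ 2 - z ^+ 2) ^+ 3) A)//.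
  - have d1 := is_derive_sqrt_sqrB _ _ (sA _ zs).
    have d2 : is_derive s (1 : R) (fun q => 2 / 3 * Num.sqrt (q ^+ 2 - z ^+ 2) ^+ 3)
        (2 * s * Num.sqrt (s ^+ 2 - z ^+ 2)).
      apply: is_derive_eq; rewrite /GRing.scale /=.
      have w0 : 0 < Num.sqrt (s ^+ 2 - z ^+ 2) by rewrite sqrtr_gt0 sA.
      by move: (Num.sqrt _) w0 => w w0; field; rewrite lt0r_neq0.
    rewrite derive1E (@derive_val _ _ _ _ _ _ _ d2).
    by move: (Num.sqrt _) => w; field; rewrite lt0r_neq0// pA.
  - by rewrite /A /= in_itv /= zs.
  - move=> q Aq; have qI : `|z| < q by move: Aq; rewrite /A /= in_itv /= andbT.
    by rewrite I_sph_plane_in.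
rewrite /radial_integrand (near_eq_derive1_near _ (fun s => 2 * Num.sqrt (s ^+ 2 - z ^+ 2)) A)//.
- have d1 := is_derive_sqrt_sqrB _ _ (sA _ zr).
  have d2 : is_derive r (1 : R) (fun q => 2 * Num.sqrt (q ^+ 2 - z ^+ 2))
      (2 * r / Num.sqrt (r ^+ 2 - z ^+ 2)).
    by apply: is_derive_eq; rewrite /GRing.scale /=; ring.
  rewrite derive1E (@derive_val _ _ _ _ _ _ _ d2).
  have w0 : 0 < Num.sqrt (r ^+ 2 - z ^+ 2) by rewrite sqrtr_gt0 sA.
  by move: (Num.sqrt _) w0 => w w0; field; rewrite !lt0r_neq0// pA.
- by rewrite /A /= in_itv /= zr.
- by move=> q Aq; apply: step; move: Aq; rewrite /A /= in_itv /= andbT.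
Qed.

Lemma Rintegral_itv_split (f g : R -> R) (a b : R) : 0 < a <= b ->
  (forall x, 0 < x < a -> f x = 0) -> (forall x, a < x -> f x = g x) ->
  measurable_fun `]a, b] g ->
  \int[leb1 R]_(x in `[0, b]) f x = \int[leb1 R]_(x in `[a, b]) g x.
Proof.
move=> /andP[a0 ab] f0 fg mg.
have mf1 : measurable_fun `]0, a[ f.
  apply: (@eq_measurable_fun _ _ (measurableTypeR R) (measurableTypeR R) _ (fun=> 0 : R)); last exact: measurable_cst.
  by move=> x; rewrite inE /= in_itv /= => /f0.
have mf2 : measurable_fun `]a, b] f.
  apply: (@eq_measurable_fun _ _ (measurableTypeR R) (measurableTypeR R) _ g) => //.
  by move=> x; rewrite inE /= in_itv /= => /andP[/fg].
have mf1' : measurable_fun `[0, a] f by exact: measurable_fun_itv_cc mf1.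
rewrite /Rintegral; congr fine.
rewrite (@itv_bndbnd_setU _ _ (BLeft 0) (BRight a) (BRight b)) ?bnd_simp ?(ltW a0)//.
rewrite integral_setU//.
- rewrite integral_itv_bndoo; last by apply/measurable_EFinP.
  have -> : (\int[leb1 R]_(x in `]0%R, a[) (f x)%:E = 0)%E.
    by apply: integral0_eq => x; rewrite /= in_itv /= => xI; rewrite (f0 x xI).
  rewrite add0e.
  rewrite -[RHS]integral_itv_obnd_cbnd; last by apply/measurable_EFinP.
  by apply: eq_integral => x; rewrite inE /= in_itv /= => /andP[/fg ->].
- by apply/measurable_EFinP; apply/measurable_funU.
- apply/disj_setPS => x [/=]; rewrite 2!in_itv/= => /andP[_ xa] /andP[ax _].
  by move: xa; rewrite leNgt ax.
Qed.

Lemma vx_at_inside c t y z : 0 < `|z| <= c * t ->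
  vx_at c t (0, y, z) = (2 * pi)^-1 *
    \int[leb1 R]_(r in `[`|z|, c * t]) (Num.sqrt (r ^+ 2 - z ^+ 2))^-1.
Proof.
move=> zI; have /andP[z0 zct] := zI.
have sA q : `|z| < q -> 0 < q ^+ 2 - z ^+ 2.
  move=> zq; rewrite subr_gt0 -(real_normK (num_real z)) ltr_pXn2r//.
  by rewrite nnegrE ltW// (le_lt_trans _ zq).
pose g (r : R) := (Num.sqrt (r ^+ 2 - z ^+ 2))^-1.
have mg : measurable_fun `]`|z|, c * t] g.
  by apply: measurable_continuous_itv_oc => x zx; apply: continuous_inv_sqrt_sqrB; exact: sA.
have mg' : measurable_fun `[`|z|, c * t] (EFin \o g).
  by apply/measurable_EFinP/measurable_fun_itv_obnd_cbndP.
have g0 x : 0 <= g x by rewrite invr_ge0 sqrtr_ge0.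
pose D : set R := `[`|z|, c * t]%classic.
have E : \int[leb1 R]_(r in D) (2 * g r) = 2 * \int[leb1 R]_(r in D) g r.
  have E0 : (\int[leb1 R]_(r in D) (2 * g r)%:E = 2%:E * \int[leb1 R]_(r in D) (g r)%:E)%E.
    have mD : measurable D by exact: measurable_itv.
    rewrite -(@ge0_integralZl_EFin _ (measurableTypeR R) R (leb1 R) D mD (EFin \o g) _ mg')//.
    by move=> x _; rewrite lee_fin.
  rewrite /Rintegral E0; case: (\int[leb1 R]_(r in D) _)%E => [x||] //=.
  - by rewrite mulry gtr0_sg// mul1e mulr0.
  - by rewrite mulrNy gtr0_sg// mul1e mulr0.
rewrite /vx_at /radial_op -/(radial_integrand _).
rewrite (Rintegral_itv_split (radial_integrand (fun r => I_sph r (0, y, z))) (fun r => 2 * g r) _ _ zI).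
- rewrite E; move: (\int[leb1 R]_(r in _) _) => x.
  have := lt0r_neq0 (pi_gt0 R); move: (pi) => p p0; field; exact: p0.
- by move=> x; exact: radial_integrand_out.
- by move=> x; exact: radial_integrand_in.
- by apply: measurable_funM.
Qed.

Lemma vx_at_outside c t y z : 0 < c * t -> c * t < `|z| -> vx_at c t (0, y, z) = 0.
Proof.
move=> ct0 ctz; rewrite /vx_at /radial_op.
rewrite -/(radial_integrand _).
have J0 x : 0 < x < c * t -> radial_integrand (fun r => I_sph r (0, y, z)) x = 0.
  by move=> /andP[x0 xct]; apply: radial_integrand_out; rewrite x0 (lt_trans xct).
rewrite /Rintegral integral_itv_bndoo.
  rewrite integral0_eq ?mulr0//= => x.
  by rewrite /= in_itv /= => /J0 ->.
apply/measurable_EFinP; apply: (@eq_measurable_fun _ _ (measurableTypeR R) (measurableTypeR R) _ (fun=> 0 : R)) => //.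
by move=> x; rewrite inE /= in_itv /= => /J0.
Qed.

End PointValues.

(** * The function L *)

Section Logarithm.
Context {R : realType}.
Implicit Types (s c t y z : R).

Lemma sqrt_1Bsqr s : 0 < s <= 1 ->
  0 <= Num.sqrt (1 - s ^+ 2) <= 1 /\ Num.sqrt (1 - s ^+ 2) ^+ 2 = 1 - s ^+ 2.
Proof.
move=> /andP[s0 s1]; have s2 : 0 <= 1 - s ^+ 2 by rewrite subr_ge0 expr_le1// ltW.
split; last by rewrite sqr_sqrtr.
rewrite sqrtr_ge0/= -[leRHS]sqrtr1 ler_sqrt// lerBlDr lerDl; exact: sqr_ge0.
Qed.

Lemma LfunE s : 0 < s <= 1 -> Lfun s = ln (1 + Num.sqrt (1 - s ^+ 2)) - ln s.
Proof.
move=> sI; have [/andP[w0 w1] _] := sqrt_1Bsqr _ sI; case/andP: sI => s0 _.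
by rewrite /Lfun ln_div// posrE ltr_pwDl.
Qed.

Lemma ln1B_bounds (u : R) : 0 <= u <= 2^-1 -> - u - 2 * u ^+ 2 <= ln (1 - u) <= - u.
Proof.
move=> /andP[u0 u1].
have v0 : 0 < 1 - u by lra.
apply/andP; split; last by apply: le_ln1Dx; lra.
have E : ln (1 - u) = - ln (1 + u / (1 - u)).
  rewrite -lnV ?posrE; last by rewrite ltr_pwDl// divr_ge0// ltW.
  by congr ln; field; rewrite lt0r_neq0//; lra.
have h : ln (1 + u / (1 - u)) <= u / (1 - u).
  by apply: le_ln1Dx; apply: lt_le_trans (divr_ge0 u0 (ltW v0)); rewrite ltrN10.
rewrite E lerNr; apply: (le_trans h).
rewrite ler_pdivrMr// -subr_ge0 (_ : _ - u = u ^+ 2 * (1 - 2 * u)); last by ring.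
by apply: mulr_ge0; [exact: sqr_ge0|lra].
Qed.

(* With [u = (1 - sqrt(1 - s^2)) / 2] one has [s^2 / 4 = u - u^2], so the
   remainder is [ln(1 - u) + u - u^2], and [u <= s^2 / 2]. *)
Lemma Lfun_expansion s : 0 < s <= 1 ->
  `|Lfun s - (- ln (s / 2) - s ^+ 2 / 4)| <= s ^+ 4.
Proof.
move=> sI; have [/andP[w0 w1] w2] := sqrt_1Bsqr _ sI.
rewrite LfunE//; case/andP: sI => s0 s1.
move: (Num.sqrt _) w0 w1 w2 => w w0 w1 w2.
pose u := (1 - w) / 2.
have s2 : s ^+ 2 = 4 * (u - u ^+ 2).
  have e : s ^+ 2 = 1 - w ^+ 2 by rewrite w2; ring.
  by rewrite e /u; field.
have uI : 0 <= u <= 2^-1 by rewrite /u; apply/andP; split; lra.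
have E : ln (1 + w) = ln 2 + ln (1 - u).
  by rewrite -lnM ?posrE//; [congr ln; rewrite /u; field|rewrite /u; lra].
have /andP[l1 l2] := ln1B_bounds _ uI; case/andP: uI => u0 u1.
rewrite ln_div ?posrE// E (_ : s ^+ 4 = (s ^+ 2) ^+ 2); last by rewrite -exprM.
rewrite s2; move: (ln (1 - u)) (ln 2) (ln s) l1 l2 => a b d l1 l2.
have hu : u ^+ 2 <= u / 2 by rewrite expr2; nra.
rewrite ler_norml; apply/andP; split; nra.
Qed.

Lemma Lfun_bigO :
  (fun s : R => Lfun s - (- ln (s / 2) - s ^+ 2 / 4)) =O_ (0^'+) (fun s : R => s ^+ 4).
Proof.
apply/eqO_exP; exists 1 => //; near=> s.
have s0 : 0 < s by near: s; exact: nbhs_right_gt.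
have s1 : s <= 1 by near: s; exact: nbhs_right_le.
rewrite mul1r [leRHS]ger0_norm; last exact: exprn_ge0 (ltW s0).
by apply: Lfun_expansion; rewrite s0.
Unshelve. all: by end_near. Qed.

Lemma expR_Lfun s : 0 < s <= 1 -> expR (- Lfun s) = tan (asin s / 2).
Proof.
move=> sI; have [/andP[w0 w1] w2] := sqrt_1Bsqr _ sI.
have [s0 s1] := andP sI.
have sI' : -1 <= s <= 1 by rewrite s1 andbT (le_trans _ (ltW s0)).
have w1' : 0 < 1 + Num.sqrt (1 - s ^+ 2) by rewrite ltr_pwDl.
rewrite expRN /Lfun lnK ?posrE ?divr_gt0// invf_div.
pose h := asin s / 2.
have hh : asin s = h + h by rewrite /h; field.
have sh : s = 2 * (sin h * cos h).
  by rewrite -[LHS]asinK ?in_itv//= hh sinD; ring.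
have ch : Num.sqrt (1 - s ^+ 2) = 2 * cos h ^+ 2 - 1.
  rewrite -cos_asin// hh cosD; have := cos2Dsin2 h.
  by move: (cos h) (sin h) => a b e; lra.
have c0 : cos h != 0.
  apply/negP => /eqP c0; move: w1'; rewrite ch c0 expr0n /= mulr0 sub0r subrr.
  by rewrite ltxx.
rewrite -/h /tan {1}sh ch (_ : 1 + _ = 2 * cos h ^+ 2); last by ring.
by move: (cos h) (sin h) c0 => a b a0; field.
Qed.

Lemma vx_at_Lfun c t y z : 0 < `|z| <= c * t ->
  vx_at c t (0, y, z) = (2 * pi)^-1 * Lfun (`|z| / (c * t)).
Proof.
move=> zI; rewrite vx_at_inside// -(real_normK (num_real z)).
by rewrite Rintegral_inv_sqrt.
Qed.

Lemma vx_at_log_singularity c t y : 0 < c * t ->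
  log_singularity (fun z => vx_at c t (0, y, z)) 0.
Proof.
move=> ct0; have pi0 : 0 < (2 * pi)^-1 :> R by rewrite invr_gt0 mulr_gt0// pi_gt0.
exists (- (2 * pi)^-1); first by rewrite oppr_eq0 lt0r_neq0.
apply/eqO_exP; exists ((2 * pi)^-1 * (1 + `|ln (c * t)|)).
  by rewrite mulr_gt0// ltr_pwDl.
near=> z.
have z0 : z != 0 by near: z; exact: nbhs_dnbhs_neq.
have zct : `|z| <= c * t.
  near: z; apply: nbhs_dnbhs.
  by exists (c * t) => //= x /=; rewrite sub0r normrN => /ltW.
have nz : 0 < `|z| by rewrite normr_gt0.
have sI : 0 < `|z| / (c * t) <= 1 by rewrite divr_gt0// ler_pdivrMr// mul1r.
rewrite vx_at_Lfun ?nz// LfunE// ln_div ?posrE// subr0 [`|cst 1 z|]normr1 mulr1.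
have [/andP[w0 w1] _] := sqrt_1Bsqr _ sI.
move: (Num.sqrt _) w0 w1 => w w0 w1.
rewrite (_ : _ - _ = (2 * pi)^-1 * (ln (1 + w) + ln (c * t))); last first.
  by move: (2 * pi)^-1 (ln _) (ln _) (ln _) => *; ring.
rewrite normrM (gtr0_norm pi0) ler_pM2l//; apply: (le_trans (ler_normD _ _)).
rewrite lerD2r ger0_norm; last by apply: ln_ge0; rewrite lerDl.
by apply: le_trans w1; apply: le_ln1Dx; apply: lt_le_trans w0; rewrite ltrN10.
Unshelve. all: by end_near. Qed.

End Logarithm.

Theorem mainTheorem4 (R : realType) (c : R) (hc : 0 < c)
    (v : 'I_3 -> R -> @functional R) (p : R -> @functional R)
    (hsol : distr_solution c riemann_v0 riemann_p0 v p) :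
  (forall t : R, 0 < t ->
    [/\ forall psi : R * R * R -> R, is_test psi ->
          v 0 t psi = vx_formula c t psi,
        forall y z : R, 0 < `|z| <= c * t ->
          vx_at c t (0, y, z) =
            (2 * pi)^-1 * \int[leb1 R]_(r in `[`|z|, c * t])
                            (Num.sqrt (r ^+ 2 - z ^+ 2))^-1 /\
          (2 * pi)^-1 * \int[leb1 R]_(r in `[`|z|, c * t])
                            (Num.sqrt (r ^+ 2 - z ^+ 2))^-1 =
            (2 * pi)^-1 * Lfun (`|z| / (c * t)),
        forall y z : R, c * t < `|z| -> vx_at c t (0, y, z) = 0
      & forall y : R, log_singularity (fun z => vx_at c t (0, y, z)) 0]) /\
  (fun s : R => Lfun s - (- ln (s / 2) - s ^+ 2 / 4))
    =O_ (0^'+) (fun s : R => s ^+ 4) /\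
  (forall s : R, 0 < s <= 1 -> expR (- Lfun s) = tan (asin s / 2)).
Proof.
split; last by split; [exact: Lfun_bigO|exact: expR_Lfun].
move=> t t0; have ct0 : 0 < c * t by rewrite mulr_gt0.
split.
- move=> psi tp; rewrite (_ : 0 = c0); last exact: val_inj.
  exact: (distr_solution_vx_formula _ _ _ _ _ hc hsol t0 tp).
- move=> y z zI; rewrite -(vx_at_inside c t y z zI).
  by split; last exact: vx_at_Lfun.
- by move=> y z; exact: vx_at_outside.
- by move=> y; exact: vx_at_log_singularity.
Qed.
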